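(* Let $f=(f^{x_1},f^{y_1},\dots,f^{x_n},f^{y_n})\in C^{0,\alpha}_{\rm loc}(\Omega;\mathbb{R}^{2n})$, where $\Omega\subset\mathbb{R}^m$ is an open domain and $\alpha\in\big(\frac12,1\big]$. Then the following conditions are equivalent: (a) There is a function $\tau:\Omega\to\mathbb{R}$ such that $F=(f,\tau)\in C^{0,\alpha}_{\rm loc}(\Omega;\mathbb{H}^n)$. (b) For every piecewise smooth closed curve $\eta:[0,1]\to\Omega$, $\eta(0)=\eta(1)$, $$\sum_{j=1}^n\int_0^1\gamma^{x_j}\,d\gamma^{y_j}-\gamma^{y_j}\,d\gamma^{x_j}=0,\qquad\text{where }\gamma=f\circ\eta:[0,1]\to\mathbb{R}^{2n}.$$ (c) For every piecewise smooth closed curve $\eta:[0,1]\to\Omega$, $\eta(0)=\eta(1)$, $$\sum_{j=1}^n\int_{\mathbb{R}^2}w(\gamma_j,z)\,dz=0,\qquad\text{where }\gamma_j=(f^{x_j},f^{y_j})\circ\eta:[0,1]\to\mathbb{R}^2.$$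
   Context: Heisenberg group: $\mathbb{H}^n$ is $\mathbb{R}^{2n+1}$ with coordinates $(z,t)=(x_1,y_1,\dots,x_n,y_n,t)$, regarded as a metric space with the Korányi metric $$d_K\big((z,t),(z',t')\big)=\Big(|z-z'|^4+\Big|t-t'+2\sum_{j=1}^n(x_j'y_j-x_jy_j')\Big|^2\Big)^{1/4}.$$ For a metric space $Y$, $C^{0,\alpha}_{\rm loc}(\Omega;Y)$ is the set of maps $\Omega\to Y$ that are $\alpha$-Hölder continuous on every compact subset of $\Omega$. A domain is connected. Generalized integral: for $g,h\in C^{0,\alpha}([0,1])$ with $\alpha>\frac12$, $\int_0^1 g\,dh:=\lim_{\varepsilon\to0}\int_0^1 g^\varepsilon(x)(h^\varepsilon)'(x)\,dx$, where $g^\varepsilon,h^\varepsilon$ are Lipschitz with $g^\varepsilon\to g$, $h^\varepsilon\to h$ in the $C^{0,\alpha'}([0,1])$ norm for some $\alpha'\in(\frac12,\alpha]$; the limit exists and does not depend on the approximation. Winding number: a closed curve $\gamma_j:[0,1]\to\mathbb{R}^2$, $\gamma_j(0)=\gamma_j(1)$, is identified with a continuous map $\mathbb{S}^1=\partial\mathbb{B}^2\to\mathbb{R}^2$ (via $s\mapsto e^{2\pi i s}$), and for $z\notin\gamma_j([0,1])$, $w(\gamma_j,z)=\deg(G,\mathbb{B}^2,z)$ is the Brouwer degree at $z$ of any continuous extension $G:\overline{\mathbb{B}}^2\to\mathbb{R}^2$. Since $\gamma_j$ is $\alpha$-Hölder with $\alpha>\frac12$, its image has measure zero, so $w(\gamma_j,\cdot)$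 is defined almost everywhere, and it is integrable. *)

(* Defs.v *)
From mathcomp Require Import all_boot all_order all_algebra.
From mathcomp Require Import all_classical all_reals all_analysis.
Import Order.TTheory GRing.Theory Num.Theory.
Import numFieldNormedType.Exports.

Set Implicit Arguments.
Unset Strict Implicit.
Unset Printing Implicit Defensive.

Local Open Scope classical_set_scope.
Local Open Scope ring_scope.

Section Euclid.
Context {R : realType}.

(* The library norm on row vectors is the sup norm. *)
Definition euclid_dist k (u v : 'rV[R]_k) : R :=
  Num.sqrt (\sum_(i < k) (u 0 i - v 0 i) ^+ 2).

(* The components of f are functions on the whole space; only their values on
   Omega are constrained. *)
Definition holder_loc m (Y : Type) (dY : Y -> Y -> R) (alpha : R)
    (Omega : set 'rV[R]_m) (f : 'rV[R]_m -> Y) : Prop :=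
  forall K : set 'rV[R]_m, compact K -> K `<=` Omega ->
    exists C : R, forall p q, K p -> K q ->
      dY (f p) (f q) <= C * euclid_dist p q `^ alpha.

End Euclid.

Section Heisenberg.
Context {R : realType}.

(* The coordinates of R^(2n) are ordered (x_1, y_1, ..., x_n, y_n). *)
Lemma xidx_subproof n (j : 'I_n) : (2 * j < 2 * n)%N.
Proof. by rewrite ltn_mul2l /=. Qed.

Lemma yidx_subproof n (j : 'I_n) : ((2 * j).+1 < 2 * n)%N.
Proof. by have := leq_mul (leqnn 2) (ltn_ord j); rewrite mulnS. Qed.

Definition xidx n (j : 'I_n) : 'I_(2 * n) := Ordinal (xidx_subproof j).
Definition yidx n (j : 'I_n) : 'I_(2 * n) := Ordinal (yidx_subproof j).

Definition heisenberg (n : nat) : Type := ('rV[R]_(2 * n) * R)%type.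

Definition koranyi n (p q : heisenberg n) : R :=
  (euclid_dist p.1 q.1 ^+ 4 +
   `|p.2 - q.2 + 2 * \sum_(j < n) (q.1 0 (xidx j) * p.1 0 (yidx j)
                                 - p.1 0 (xidx j) * q.1 0 (yidx j))| ^+ 2)
  `^ 4^-1.

End Heisenberg.

Section Curves.
Context {R : realType}.

Definition smooth (g : R -> R) : Prop :=
  forall (k : nat) (x : R), derivable (derive1n k g) x 1.

(* The breakpoints are 0 = nth 0 (0 :: s) 0 < ... < last 0 s = 1. The closed
   pieces overlap at the breakpoints, so eta is continuous on [0, 1]. *)
Definition piecewise_smooth m (eta : R -> 'rV[R]_m) : Prop :=
  exists2 s : seq R, itv_partition 0 1 s &
    forall (k : nat) (i : 'I_m), (k < size s)%N ->
      exists2 g : R -> R, smooth g &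
        forall t, nth 0 (0 :: s) k <= t <= nth 0 (0 :: s) k.+1 ->
          eta t 0 i = g t.

Definition closed_curve_in m (Omega : set 'rV[R]_m) (eta : R -> 'rV[R]_m) :
    Prop :=
  [/\ piecewise_smooth eta,
      forall t, 0 <= t <= 1 -> Omega (eta t) & eta 0 = eta 1].

End Curves.

Section GeneralizedIntegral.
Context {R : realType}.

Definition holder_norm (a : R) (g : R -> R) : \bar R :=
  let sup_norm := ereal_sup [set `|g t|%:E | t in `[0, 1]] in
  let seminorm :=
    ereal_sup [set (`|g p.1 - g p.2| / `|p.1 - p.2| `^ a)%:E | p in
      [set p : R * R | [/\ 0 <= p.1 <= 1, 0 <= p.2 <= 1 & p.1 != p.2]]] in
  (sup_norm + seminorm)%E.

Definition lipschitz_approx (a : R) (g : R -> R) (geps : R -> R -> R) : Prop :=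
  (forall eps, 0 < eps -> exists k : R, k.-lipschitz_(`[0, 1]) (geps eps)) /\
  holder_norm a (geps eps \- g) @[eps --> 0^'+] --> 0%E.

(* A Lipschitz function is differentiable almost everywhere on [0, 1]; the
   values of derive1 elsewhere do not matter. *)
Definition is_gen_integral (alpha : R) (g h : R -> R) (l : R) : Prop :=
  forall (a : R) (geps heps : R -> R -> R), 2^-1 < a <= alpha ->
    lipschitz_approx a g geps -> lipschitz_approx a h heps ->
    (\int[lebesgue_measure]_(t in `[0, 1]) (geps eps t * derive1 (heps eps) t))
      @[eps --> 0^'+] --> l.

Definition gen_integral (alpha : R) (g h : R -> R) : R :=
  xget 0 [set l | is_gen_integral alpha g h l].

End GeneralizedIntegral.

Section Degree.
Context {R : realType}.
Implicit Types (D : set (R * R)) (G H : R * R -> R * R) (z : R * R).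

Definition norm2 (p : R * R) : R := Num.sqrt (p.1 ^+ 2 + p.2 ^+ 2).

Definition C1_on D H : Prop :=
  forall p, D p -> differentiable H p /\
    forall v : R * R, {for p, continuous (fun q => 'D_v H q)}.

Definition jacobian2 H (p : R * R) : R :=
  ('D_(1, 0) H p).1 * ('D_(0, 1) H p).2 -
  ('D_(0, 1) H p).1 * ('D_(1, 0) H p).2.

(* Brouwer degree on a bounded open set D: approximate G by a C^1 map H having
   z as a regular value and count the preimages of z with sign. By compactness,
   the third condition says that the sup of |G - H| over the closure of D is
   less than the distance from z to G(boundary of D). *)
Definition is_brouwer_degree D G z (d : int) : Prop :=
  exists H,
    [/\ {within closure D, continuous H}, C1_on D H,
        forall p q, closure D p -> (closure D `\` D) q ->
          norm2 (G p - H p) < norm2 (z - G q),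
        forall p, D p -> H p = z -> jacobian2 H p != 0
      & d = \sum_(p \in D `&` H @^-1` [set z]) sgz (jacobian2 H p)].

Definition brouwer_degree D G z : int :=
  xget 0 [set d | is_brouwer_degree D G z d].

Definition unit_disk : set (R * R) := [set p | norm2 p < 1].

Definition extends_curve (gamma : R -> R * R) G : Prop :=
  {within closure unit_disk, continuous G} /\
  forall s, 0 <= s <= 1 -> G (cos (2 * pi * s), sin (2 * pi * s)) = gamma s.

(* Equal to 0 when z lies on the curve. *)
Definition winding (gamma : R -> R * R) z : int :=
  xget 0 [set d | forall G, extends_curve gamma G ->
                    brouwer_degree unit_disk G z = d].

End Degree.

(* Main.v *)
From HB Require Import structures.
Require Import Defs.
From mathcomp Require Import all_boot all_order all_algebra.
From mathcomp Require Import all_classical all_reals all_analysis.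
From mathcomp Require Import measurable_realfun.
From mathcomp Require Import ring lra zify.
Import Order.TTheory GRing.Theory Num.Theory.
Import numFieldNormedType.Exports.
Set Implicit Arguments.
Unset Strict Implicit.
Unset Printing Implicit Defensive.
Local Open Scope classical_set_scope.
Local Open Scope ring_scope.

(** Let omega be the standard symplectic form ([symp]). The square of the Korányi distance from
    (f(p), tau(p)) to (f(q), tau(q)) dominates |tau(p) - tau(q) + 2 omega(f(q), f(p))|, and the
    distance is at most 2v whenever v^2 bounds this quantity and v bounds |f(p) - f(q)|
    ([le_koranyi], [koranyi_le]). So (a) asks for tau(p) - tau(q) = -2 omega(f(q), f(p)) + O(|p -
    q|^(2 alpha)), locally uniformly. Since 2 alpha > 1, such errors disappear in the limit along
    fine partitions of a Lipschitz curve: tau has to be -2 times a primitive of the form sum_j x_j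
    dy_j - y_j dx_j pulled back by f, and (b) and (c) both say that the integrals of this form over
    loops vanish.

    The integrals are Young integrals: [young_integral] is the limit of dyadic left Riemann sums.
    Inserting midpoints at level k changes the sum by at most A B (2 rho^2)^k with rho = 2^(-alpha),
    and 2 rho^2 < 1 because alpha > 1/2. This yields convergence, the Love-Young estimate
    ([young_integral_bound]) and continuity in the Hölder norm ([young_integral_near]). For
    Lipschitz functions the limit is the Lebesgue integral ([lipschitz_young]), and inf-convolutions
    supply Lipschitz approximations, so the generalized integral is the Young integral
    ([gen_integral_young]).

    From (a) to (b), the increments of tau cancel along the dyadic partitions of a loop
    ([horizontal_area]). Between (b) and the integrals of (c) stands a Green formula: the integral
    of the winding number of a plane Hölder loop is the integral of x dy ([winding_integral]), which
    is half the integral of x dy - y dx by integration by parts ([sum_winding_area]). From (c) to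
    (a), tau(p) is -2 times the integral along a polygonal chain from a base point to p, independent
    of the chain because closed polygons contribute 0 ([potential_exists]); the Love-Young estimate
    on one segment gives the required bound ([potential_holder]).

    The Green formula rests on a combinatorial winding number: [turns] counts with sign the edges of
    an inscribed polygon that cross a horizontal half-line. It equals the degree by an argument
    principle ([degree_turns]): polar coordinates carry the disk to a square, which is cut into a
    fine grid; a cell away from the zeros has index 0, and a block around a regular zero has the
    sign of the Jacobian as its index. Maps with a regular value come from splines and Sard's
    argument ([regular_approximation]). When the base point z of the half-line varies, the crossing
    number of an edge from a to b integrates to (b.2 - a.2)(a.1 + M) up to O(|b - a|^2) over a box
    of radius M, so a polygon yields a Riemann sum of x dy. Refining the polygon changes the count
    only in small boxes around its vertices, whose total area decreases geometrically, and dominated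
    convergence concludes. *)

(** * Uniform continuity on subsets of normed spaces *)

Section UniformContinuity.
Context {R : realType}.

(** The modulus is kept explicit because each discretisation below needs one mesh size valid at all
    its nodes. *)
Definition unif_cont_on (U V : normedModType R) (A : set U) (f : U -> V) :=
  forall e, 0 < e -> exists2 d, 0 < d &
    forall x y, A x -> A y -> `|x - y| < d -> `|f x - f y| < e.

Lemma heine_cantor (U V : normedModType R) (A : set U) (f : U -> V) :
  compact A -> {within A, continuous f} -> unif_cont_on A f.
Proof.
move=> cA cf e e0.
have /compact_near_coveringP ncA := cA.
have e20 : 0 < e / 2 by rewrite divr_gt0.
have half_lt (r : R) : 0 < r -> r / 2 < r by lra.
have [|d /= d0 dP] := ncA R (0^'+)
  (fun d x => A x -> forall y, A y -> `|x - y| < d -> `|f x - f y| < e) _.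
  move=> x Ax.
  have /subspace_continuousP /(_ x Ax) := cf.
  move=> /cvgrPdist_lt /(_ _ e20) /nbhs_ballP [r /= r0 rP].
  have rP' y : A y -> `|x - y| < r -> `|f x - f y| < e / 2.
    by move=> Ay xy; apply: rP => //; rewrite -ball_normE.
  exists (ball x (r / 2), [set d | d < r / 2]).
    split; first by apply: nbhsx_ballx; rewrite divr_gt0.
    by apply: nbhs_right_lt; rewrite divr_gt0.
  move=> [x' d] /= [xx' dr] Ax' y Ay x'y.
  move: xx'; rewrite -ball_normE /= => xx'.
  rewrite -(subrK (f x) (f x')) -addrA (splitr e).
  apply: (le_lt_trans (ler_normD _ _)); apply: ltrD.
    by rewrite distrC; apply: rP' => //; apply: lt_trans xx' (half_lt _ r0).
  apply: rP' => //; rewrite -(subrK x' x) -addrA (splitr r).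
  by apply: (le_lt_trans (ler_normD _ _)); apply: ltrD => //; apply: lt_trans dr.
exists (d / 2); rewrite ?divr_gt0// => x y Ax Ay xy.
by apply: (dP (d / 2)) => //=; rewrite ?sub0r ?normrN ?gtr0_norm ?divr_gt0// half_lt.
Qed.

Lemma unif_cont_within (U V : normedModType R) (A : set U) (f : U -> V) :
  unif_cont_on A f -> {within A, continuous f}.
Proof.
move=> uf; apply/subspace_continuousP => x Ax.
apply/cvgrPdist_lt => e /uf[d d0 dP]; apply/nbhs_ballP; exists d => //= y.
by rewrite -ball_normE /= => xy Ay; exact: dP.
Qed.

Lemma unif_cont_comp (U V W : normedModType R) (A : set U) (B : set V)
    (f : U -> V) (g : V -> W) : (forall x, A x -> B (f x)) ->
  unif_cont_on A f -> unif_cont_on B g -> unif_cont_on A (g \o f).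
Proof.
move=> AB uf ug e /ug[d /uf[d' d'0 d'P] dP]; exists d' => // x y Ax Ay xy.
by apply: dP; [exact: AB|exact: AB|exact: d'P].
Qed.

Lemma unif_cont_sub (U V : normedModType R) (A B : set U) (f : U -> V) :
  A `<=` B -> unif_cont_on B f -> unif_cont_on A f.
Proof.
by move=> AB uf e /uf[d d0 dP]; exists d => // x y /AB Ax /AB Ay; exact: dP.
Qed.

Lemma unif_cont_subc (U V : normedModType R) (A : set U) (f : U -> V) (z : V) :
  unif_cont_on A f -> unif_cont_on A (fun x => f x - z).
Proof.
move=> uf e /uf[d d0 dP]; exists d => // x y Ax Ay xy.
by rewrite opprB addrA subrK; exact: dP.
Qed.

Lemma unif_cont_bounded (U V : normedModType R) (A : set U) (f : U -> V) :
  compact A -> unif_cont_on A f -> exists2 M, 0 < M & forall x, A x -> `|f x| <= M.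
Proof.
move=> cA /unif_cont_within cf.
have /ex_strict_bound_gt0[k k_gt0 /= imVfltk] : bounded_set (f @` A).
  exact/compact_bounded/continuous_compact.
by exists k => // x Ax; apply/ltW/imVfltk; exists x.
Qed.

Lemma norm_fst_le (U V : normedModType R) (p : U * V) : `|p.1| <= `|p|.
Proof. by rewrite prod_normE le_max lexx. Qed.

Lemma norm_snd_le (U V : normedModType R) (p : U * V) : `|p.2| <= `|p|.
Proof. by rewrite prod_normE le_max lexx orbT. Qed.

Lemma unif_cont_fst (U V W : normedModType R) (A : set U) (f : U -> V * W) :
  unif_cont_on A f -> unif_cont_on A (fun x => (f x).1).
Proof.
move=> uf e /uf[d d0 dP]; exists d => // x y Ax Ay xy.
by apply: le_lt_trans (dP _ _ Ax Ay xy); exact: (norm_fst_le (f x - f y)).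
Qed.

Lemma unif_cont_snd (U V W : normedModType R) (A : set U) (f : U -> V * W) :
  unif_cont_on A f -> unif_cont_on A (fun x => (f x).2).
Proof.
move=> uf e /uf[d d0 dP]; exists d => // x y Ax Ay xy.
by apply: le_lt_trans (dP _ _ Ax Ay xy); exact: (norm_snd_le (f x - f y)).
Qed.

Lemma unif_cont_pair (U V W : normedModType R) (A : set U) (f : U -> V) (g : U -> W) :
  unif_cont_on A f -> unif_cont_on A g -> unif_cont_on A (fun x => (f x, g x)).
Proof.
move=> uf ug e e0; have [d d0 dP] := uf e e0; have [d' d'0 d'P] := ug e e0.
exists (Num.min d d'); first by rewrite lt_min d0.
move=> x y Ax Ay; rewrite lt_min => /andP[xy xy'].
by rewrite prod_normE gt_max dP//= d'P.
Qed.

End UniformContinuity.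

(** * Signed crossings of a half-line by segments *)

Section Crossing.
Context {R : realType}.
Implicit Types (a b c v : R * R).

(** The norm on [R * R] is the sup norm, so the scalar product is introduced by hand. The condition
    0 < [dotp v a] places [a] in the open half-plane with inner normal [v]. *)
Definition dotp a b : R := a.1 * b.1 + a.2 * b.2.
Definition cross a b : R := a.1 * b.2 - a.2 * b.1.

Lemma dotpDr a b c : dotp a (b + c) = dotp a b + dotp a c.
Proof. by rewrite /dotp /=; ring. Qed.

Lemma dotp_le a b : `|dotp a b| <= 2 * `|a| * `|b|.
Proof.
rewrite /dotp; apply: (le_trans (ler_normD _ _)).
have -> : 2 * `|a| * `|b| = `|a| * `|b| + `|a| * `|b| by ring.
by rewrite !normrM; apply: lerD; apply: ler_pM => //; rewrite prod_normE le_max lexx ?orbT.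
Qed.

Lemma dotp_ge a : `|a| ^+ 2 <= dotp a a.
Proof.
have sq (x : R) : `|x| ^+ 2 = x * x by rewrite -normrX ger0_norm ?sqr_ge0// expr2.
rewrite /dotp prod_normE /Num.max; case: ifP => _; rewrite sq.
  by rewrite lerDr -expr2 sqr_ge0.
by rewrite lerDl -expr2 sqr_ge0.
Qed.

(* The signed number of crossings of the half-line [R+ * {0}] by the segment
   from [a] to [b]; a point of ordinate 0 counts as lying above the axis. *)
Definition crossing a b : int :=
  [&& a.2 < 0, 0 <= b.2 & 0 < cross a b]%:R -
  [&& b.2 < 0, 0 <= a.2 & cross a b < 0]%:R.

Lemma crossN a b : cross b a = - cross a b.
Proof. by rewrite /cross; ring. Qed.

Lemma crossingN a b : crossing b a = - crossing a b.
Proof. by rewrite /crossing opprB crossN oppr_gt0 oppr_lt0. Qed.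

Lemma crossingxx a : crossing a a = 0.
Proof. by rewrite /crossing; case: ltP => //= ; case: ltP. Qed.

Lemma crossing_le1 a b : `|crossing a b| <= 1.
Proof.
rewrite /crossing; case: (ltP a.2 0) => ? /=; case: (ltP b.2 0) => ? //=.
  by rewrite subr0; case: (0 < _).
by rewrite sub0r; case: (_ < 0).
Qed.

Definition above v a : int := ((0 < v.1) && (0 <= a.2))%:R.

(* On a half-plane missing the origin the crossing number is a coboundary. *)
Lemma crossing_half_plane v a b : 0 < dotp v a -> 0 < dotp v b ->
  crossing a b = above v b - above v a.
Proof.
rewrite /dotp /crossing /above /cross => va vb.
(* For an upward crossing, [v.1] times the cross product is a sum of two nonnegative terms, one of
   them positive. So the cross product has the sign of [v.1]: the half-plane meets at most one of
   the two rays of the axis. *)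
have key : a.2 < 0 -> 0 <= b.2 -> 0 < v.1 * (a.1 * b.2 - a.2 * b.1).
  move=> a0 b0.
  have -> : v.1 * (a.1 * b.2 - a.2 * b.1) =
     b.2 * (v.1 * a.1 + v.2 * a.2) + (- a.2) * (v.1 * b.1 + v.2 * b.2) by ring.
  by apply: ltr_wpDl; [rewrite mulr_ge0// ltW|rewrite mulr_gt0// oppr_gt0].
have key' : b.2 < 0 -> 0 <= a.2 -> v.1 * (a.1 * b.2 - a.2 * b.1) < 0.
  move=> a0 b0.
  have -> : v.1 * (a.1 * b.2 - a.2 * b.1) =
     - (a.2 * (v.1 * b.1 + v.2 * b.2) + (- b.2) * (v.1 * a.1 + v.2 * a.2)) by ring.
  by rewrite oppr_lt0; apply: ltr_wpDl; [rewrite mulr_ge0// ltW|rewrite mulr_gt0// oppr_gt0].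
case: (ltP a.2 0) key key' => a0 key key'; case: (ltP b.2 0) key key' => b0 key key' /=.
- by rewrite !andbF.
- have := key isT isT; case: (ltP 0 v.1) => v0.
    by rewrite (pmulr_rgt0 _ v0) => ->.
  move=> K; suff -> : (0 < a.1 * b.2 - a.2 * b.1) = false by [].
  by apply: contraTF K => d0; rewrite -leNgt mulr_le0_ge0// ltW.
- have := key' isT isT; case: (ltP 0 v.1) => v0.
    by rewrite (pmulr_rlt0 _ v0) => ->.
  move=> K; suff -> : (a.1 * b.2 - a.2 * b.1 < 0) = false by [].
  by apply: contraTF K => d0; rewrite -leNgt mulr_le0// ltW.
- by rewrite !subrr.
Qed.

Lemma crossing_triangle v a b c : 0 < dotp v a -> 0 < dotp v b -> 0 < dotp v c ->
  crossing a b + crossing b c + crossing c a = 0.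
Proof.
move=> va vb vc; rewrite (crossing_half_plane va vb) (crossing_half_plane vb vc).
by rewrite (crossing_half_plane vc va); lia.
Qed.

(** Within a half-plane the coboundary telescopes, so a polygonal path may be replaced by its
    chord. *)
Lemma crossing_path (P : nat -> R * R) m n v : (m <= n)%N ->
  (forall i, (m <= i <= n)%N -> 0 < dotp v (P i)) ->
  \sum_(m <= i < n) crossing (P i) (P i.+1) = crossing (P m) (P n).
Proof.
move=> mn h.
rewrite (crossing_half_plane (h m _) (h n _)) ?leqnn ?mn//.
rewrite -(telescope_sumr (fun i => above v (P i)) mn).
apply: eq_big_nat => i /andP[mi lin]; apply: crossing_half_plane; apply: h.
  by rewrite mi ltnW.
by rewrite lin (leq_trans mi).
Qed.

(** Discrete homotopy: each quadrilateral between the two paths lies in a half-plane and contributes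
    0, which leaves the two end rungs. *)
Lemma crossing_paths (P Q : nat -> R * R) m n : (m <= n)%N ->
  (forall i, (m <= i < n)%N -> exists v, [/\ 0 < dotp v (P i), 0 < dotp v (P i.+1),
     0 < dotp v (Q i) & 0 < dotp v (Q i.+1)]) ->
  \sum_(m <= i < n) crossing (P i) (P i.+1) =
  \sum_(m <= i < n) crossing (Q i) (Q i.+1) +
  crossing (P m) (Q m) - crossing (P n) (Q n).
Proof.
move=> mn h; apply/eqP; rewrite -addrA addrC -subr_eq -[_ - crossing _ _]opprB.
rewrite -(telescope_sumr (fun i => crossing (P i) (Q i)) mn).
rewrite -sumrB -sumrN; apply/eqP; apply: eq_big_nat => i imn; have [v [p p' q q']] := h _ imn.
rewrite (crossing_half_plane p p') (crossing_half_plane q q').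
by rewrite (crossing_half_plane p q) (crossing_half_plane p' q'); ring.
Qed.

(* Discrete Green formula. *)
Lemma crossing_grid (P : nat -> nat -> R * R) (i0 i1 j0 j1 : nat) :
  (i0 <= i1)%N -> (j0 <= j1)%N ->
  \sum_(i0 <= i < i1) \sum_(j0 <= j < j1)
    (crossing (P i j) (P i.+1 j) + crossing (P i.+1 j) (P i.+1 j.+1) +
     crossing (P i.+1 j.+1) (P i j.+1) + crossing (P i j.+1) (P i j)) =
  \sum_(i0 <= i < i1) crossing (P i j0) (P i.+1 j0) +
  \sum_(j0 <= j < j1) crossing (P i1 j) (P i1 j.+1) -
  \sum_(i0 <= i < i1) crossing (P i j1) (P i.+1 j1) -
  \sum_(j0 <= j < j1) crossing (P i0 j) (P i0 j.+1).
Proof.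
move=> i01 j01.
transitivity (\sum_(i0 <= i < i1) (crossing (P i j0) (P i.+1 j0)
   - crossing (P i j1) (P i.+1 j1)
   + (\sum_(j0 <= j < j1) crossing (P i.+1 j) (P i.+1 j.+1)
     - \sum_(j0 <= j < j1) crossing (P i j) (P i j.+1)))).
  apply: eq_bigr => i _; rewrite -[_ - crossing _ _]opprB.
  rewrite -(telescope_sumr (fun j => crossing (P i j) (P i.+1 j)) j01).
  rewrite -sumrB -sumrN -big_split /=; apply: eq_bigr => j _.
  by rewrite (crossingN _ (P i j.+1)) (crossingN _ (P i.+1 j.+1)); ring.
rewrite big_split /= (telescope_sumr (fun i => \sum_(j0 <= j < j1)
  crossing (P i j) (P i j.+1)) i01) sumrB; ring.
Qed.

End Crossing.

(** * Crossing numbers of inscribed polygons and their stability *)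

Section Turns.
Context {R : realType}.
Local Notation I := (`[0, 1]%classic : set R).

(** For a closed curve avoiding 0 and for large [n], this is the winding number around 0. *)
Definition turns n (b : R -> R * R) : int :=
  \sum_(0 <= i < n) crossing (b (i%:R / n%:R)) (b (i.+1%:R / n%:R)).

(** By compactness the scalar product has a positive minimum on the diagonal, and uniform continuity
    of [b1] spreads positivity to a uniform neighbourhood of the diagonal. *)
Lemma dotp_unif (U : normedModType R) (K : set U) (b0 b1 : U -> R * R) :
  compact K -> unif_cont_on K b0 -> unif_cont_on K b1 ->
  (forall x, K x -> 0 < dotp (b0 x) (b1 x)) ->
  exists2 d, 0 < d & forall x y, K x -> K y -> `|x - y| < d ->
    0 < dotp (b0 x) (b1 y).
Proof.
move=> cK u0 u1 pos.
have [K0|/set0P [k0 Kk0]] := eqVneq K set0; first by exists 1 => // x y; rewrite K0.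
have cf : {within K, continuous (fun x => dotp (b0 x) (b1 x))}.
  move=> x; apply: cvgD; apply: cvgM.
  - by have h := unif_cont_within (unif_cont_fst u0); exact: (h x).
  - by have h := unif_cont_within (unif_cont_fst u1); exact: (h x).
  - by have h := unif_cont_within (unif_cont_snd u0); exact: (h x).
  - by have h := unif_cont_within (unif_cont_snd u1); exact: (h x).
have [|m mK mP] := compact_EVT_min _ cK cf; first by exists k0.
have [M M0 MP] := unif_cont_bounded cK u0.
move: mK; rewrite inE => /pos; set eta := dotp _ _ => eta0.
have [|d d0 dP] := u1 (eta / (2 * M)); first by rewrite divr_gt0// mulr_gt0.
exists d => // x y Kx Ky xy.
rewrite -(subrK (b1 x) (b1 y)) dotpDr addrC -ltrBlDr sub0r.
apply: (@lt_le_trans _ _ eta); last by apply: mP; rewrite inE.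
apply: (le_lt_trans (ler_norm _)); rewrite normrN.
apply: (le_lt_trans (dotp_le _ _)).
have -> : eta = 2 * M * (eta / (2 * M)).
  by rewrite mulrC divfK// mulf_neq0// ?gt_eqF.
apply: (@le_lt_trans _ _ (2 * M * `|b1 y - b1 x|)).
  by rewrite ler_wpM2r// ler_pM2l// MP.
by rewrite ltr_pM2l ?mulr_gt0// distrC dP.
Qed.

Lemma itv01 n i : (i <= n)%N -> (0 < n)%N -> I (i%:R / n%:R : R).
Proof.
move=> le_in n0; rewrite /= in_itv /= divr_ge0//=.
by rewrite ler_pdivrMr ?ltr0n// mul1r ler_nat.
Qed.

Lemma inv_nat_lt (d : R) : 0 < d -> exists2 N, (0 < N)%N &
  forall n, (N <= n)%N -> n%:R^-1 < d.
Proof.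
move=> d0; exists (Num.truncn d^-1).+1 => // n Nn.
have n0 : (0 < n)%N by exact: leq_ltn_trans Nn.
rewrite invf_plt ?posrE ?ltr0n//.
by apply: lt_le_trans (_ : (Num.truncn d^-1).+1%:R <= _); rewrite ?truncnS_gt ?ler_nat.
Qed.

(** A positive scalar product keeps the straight-line homotopy away from 0. For a fine mesh, four
    consecutive points of the two polygons lie in the half-plane of [b0 (i / n)], and the end rungs
    cancel because both curves are closed. *)
Lemma turns_homotopic (b0 b1 : R -> R * R) :
  unif_cont_on I b0 -> unif_cont_on I b1 ->
  (forall x, I x -> 0 < dotp (b0 x) (b1 x)) ->
  b0 0 = b0 1 -> b1 0 = b1 1 ->
  exists N, forall n, (N <= n)%N -> turns n b0 = turns n b1.
Proof.
move=> u0 u1 pos c0 c1.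
have cI := @segment_compact R 0 1.
have [d d0 dP] := dotp_unif cI u0 u1 pos.
have nz x : I x -> 0 < dotp (b0 x) (b0 x).
  move=> /pos p; apply: lt_le_trans (dotp_ge _); rewrite exprn_gt0// normr_gt0.
  by apply/eqP => b00; move: p; rewrite b00 /dotp /= !mul0r addr0 ltxx.
have [d' d'0 d'P] := dotp_unif cI u0 u0 nz.
have [|N N0 NP] := @inv_nat_lt (Num.min d d'); first by rewrite lt_min d0.
exists N => n Nn.
have n0 : (0 < n)%N by exact: leq_trans Nn.
have n0' : n%:R != 0 :> R by rewrite pnatr_eq0 -lt0n.
rewrite /turns.
pose P (b : R -> R * R) i := b (i%:R / n%:R).
rewrite (@crossing_paths _ (P b0) (P b1))//; last first.
  move=> i lt_in; exists (P b0 i).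
  have Ii := itv01 (ltnW lt_in) n0; have Ii1 := itv01 lt_in n0.
  have near1 : `|i%:R / n%:R - i.+1%:R / n%:R| < Num.min d d' :> R.
    rewrite -mulrBl -natr1 opprD addrA subrr sub0r mulN1r normrN.
    by rewrite ger0_norm ?invr_ge0// NP.
  move: near1; rewrite lt_min => /andP[near1 near1'].
  by split; [exact: nz|exact: d'P|exact: pos|exact: dP].
by rewrite /P mul0r divff// c0 c1 addrK.
Qed.

Lemma sum_blocks (V : zmodType) (F : nat -> V) n m :
  \sum_(0 <= k < n * m) F k = \sum_(0 <= i < n) \sum_(0 <= j < m) F (i * m + j)%N.
Proof.
elim: n => [|n IH]; first by rewrite !big_geq.
rewrite big_nat_recr //= -IH mulSn addnC (big_cat_nat (n := n * m)) ?leq_addr//=.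
congr (_ + _); rewrite -{1}[(n * m)%N]add0n big_addn addKn.
by apply: eq_big_nat => j _; rewrite addnC.
Qed.

(** Both subdivisions are compared with their common refinement of [n * m] points: the sub-edges of
    a short edge stay in the half-plane of its first vertex and collapse to that edge. *)
Lemma turns_stable (b : R -> R * R) :
  unif_cont_on I b -> (forall x, I x -> b x != 0) ->
  exists N, forall n m, (N <= n)%N -> (N <= m)%N -> turns n b = turns m b.
Proof.
move=> ub nb.
have pos x : I x -> 0 < dotp (b x) (b x).
  by move=> /nb p; apply: lt_le_trans (dotp_ge _); rewrite exprn_gt0// normr_gt0.
have [d d0 dP] := dotp_unif (@segment_compact R 0 1) ub ub pos.
have [|N N0 NP] := @inv_nat_lt d; first by [].
have refine n m : (N <= n)%N -> (0 < m)%N -> turns (n * m) b = turns n b.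
  move=> Nn m0.
  have n0 : (0 < n)%N by exact: leq_trans Nn.
  have n0' : n%:R != 0 :> R by rewrite pnatr_eq0 -lt0n.
  have m0' : m%:R != 0 :> R by rewrite pnatr_eq0 -lt0n.
  rewrite /turns (sum_blocks (fun k => crossing (b (k%:R / (n * m)%:R)) (b (k.+1%:R / (n * m)%:R)))).
  apply: eq_big_nat => i /andP[_ lt_in].
  under eq_bigr do rewrite -addnS.
  have start : ((i * m)%:R / (n * m)%:R) = i%:R / n%:R :> R.
    by rewrite !natrM; field; rewrite n0' m0'.
  rewrite (@crossing_path _ (fun j => b ((i * m + j)%:R / (n * m)%:R)) 0 m (b (i%:R / n%:R)))//.
    rewrite addn0 start; congr (crossing _ (b _)).
    by rewrite -[X in (_ + X)%N]mul1n -mulnDl addn1 !natrM; field; rewrite n0' m0'.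
  move=> j /andP[_ jm]; apply: dP; [exact/itv01/n0/ltnW| |].
    apply: itv01; last by rewrite muln_gt0 n0.
    apply: (@leq_trans (i * m + m)); first by rewrite leq_add2l.
    by rewrite -[X in (_ + X)%N]mul1n -mulnDl leq_mul2r addn1 lt_in orbT.
  rewrite -start -mulrBl natrD opprD addrA subrr sub0r mulNr normrN ger0_norm ?divr_ge0//.
  apply: le_lt_trans (NP _ Nn); rewrite natrM invfM mulrCA ler_piMr ?invr_ge0//.
  by rewrite ler_pdivrMr ?ltr0n// mul1r ler_nat.
exists N => n m Nn Nm; rewrite -(refine n m) ?(leq_trans N0)//.
by rewrite -(refine m n) ?(leq_trans N0)// mulnC.
Qed.

End Turns.

(** * Index of a linear map along a rectangle around the origin *)

Section LinearIndex.
Context {R : realType}.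
Implicit Types a b c d A B : R * R.

Lemma crossing_pos a b : 0 < cross a b -> crossing a b = ((a.2 < 0) && (0 <= b.2))%:R.
Proof.
by move=> ab; rewrite /crossing ab (lt_gtF ab) andbT !andbF subr0.
Qed.

(** With all cross products positive, the sum counts the passages from negative to nonnegative
    ordinates around the cycle. The parallelogram relation forbids the alternating pattern, so there
    is exactly one. *)
Lemma parallelogram_pos a b c d : a.2 + c.2 = b.2 + d.2 ->
  0 < cross a b -> 0 < cross b c -> 0 < cross c d -> 0 < cross d a ->
  ~ (a.2 < 0 /\ b.2 < 0 /\ c.2 < 0 /\ d.2 < 0) ->
  ~ (0 <= a.2 /\ 0 <= b.2 /\ 0 <= c.2 /\ 0 <= d.2) ->
  crossing a b + crossing b c + crossing c d + crossing d a = 1.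
Proof.
move=> e ab bc cd da nn np; rewrite !crossing_pos//.
move: nn np; case: (ltP a.2 0) => ha; case: (ltP b.2 0) => hb;
  case: (ltP c.2 0) => hc; case: (ltP d.2 0) => hd nn np => //=;
  try (exfalso; lra); exfalso; tauto.
Qed.

Lemma crossing_neg a b : cross a b < 0 -> crossing a b = - ((b.2 < 0) && (0 <= a.2))%:R.
Proof.
by move=> ab; rewrite /crossing ab (lt_gtF ab) andbT !andbF sub0r.
Qed.

Lemma parallelogram_neg a b c d : a.2 + c.2 = b.2 + d.2 ->
  cross a b < 0 -> cross b c < 0 -> cross c d < 0 -> cross d a < 0 ->
  ~ (a.2 < 0 /\ b.2 < 0 /\ c.2 < 0 /\ d.2 < 0) ->
  ~ (0 <= a.2 /\ 0 <= b.2 /\ 0 <= c.2 /\ 0 <= d.2) ->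
  crossing a b + crossing b c + crossing c d + crossing d a = -1.
Proof.
move=> e ab bc cd da nn np; rewrite !crossing_neg//.
move: nn np; case: (ltP a.2 0) => ha; case: (ltP b.2 0) => hb;
  case: (ltP c.2 0) => hc; case: (ltP d.2 0) => hd nn np => //=;
  try (exfalso; lra); exfalso; tauto.
Qed.

(** As the origin is interior to the rectangle, the cross product of each edge is a positive
    multiple of [cross A B]: all four edges turn the same way. *)
Lemma rectangle_index A B (x0 x1 y0 y1 : R) : x0 < 0 -> 0 < x1 -> y0 < 0 -> 0 < y1 ->
  cross A B != 0 ->
  let L x y := x *: A + y *: B in
  crossing (L x0 y0) (L x1 y0) + crossing (L x1 y0) (L x1 y1) +
  crossing (L x1 y1) (L x0 y1) + crossing (L x0 y1) (L x0 y0) = sgz (cross A B).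
Proof.
move=> hx0 hx1 hy0 hy1 AB L.
have LE x y : L x y = (x * A.1 + y * B.1, x * A.2 + y * B.2) by [].
have C x y x' y' : cross (L x y) (L x' y') = (x * y' - y * x') * cross A B.
  by rewrite !LE /cross /=; ring.
set u := A.2; set v := B.2.
have w1 : 0 < x1 * y1 by exact: mulr_gt0.
have w2 : 0 < - x0 * y1 by apply: mulr_gt0; lra.
have w3 : 0 < x0 * y0 by rewrite nmulr_rgt0.
have w4 : 0 < - y0 * x1 by apply: mulr_gt0; lra.
(* The origin is a combination of the four corners with positive weights, so the four ordinates can
   be neither all negative nor all nonnegative, unless they all vanish, which [cross A B] != 0
   excludes. *)
have W : x1 * y1 * (x0 * u + y0 * v) + - x0 * y1 * (x1 * u + y0 * v)
  + x0 * y0 * (x1 * u + y1 * v) + - y0 * x1 * (x0 * u + y1 * v) = 0 by ring.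
have nn : ~ (x0 * u + y0 * v < 0 /\ x1 * u + y0 * v < 0 /\
             x1 * u + y1 * v < 0 /\ x0 * u + y1 * v < 0).
  move=> [h1 [h2 [h3 h4]]].
  have := mulr_gt0 w1; have := nmulr_llt0 (x1*y1) h1; rewrite w1 => e1.
  have := nmulr_llt0 (-x0*y1) h2; rewrite w2 => e2.
  have := nmulr_llt0 (x0*y0) h3; rewrite w3 => e3.
  have := nmulr_llt0 (-y0*x1) h4; rewrite w4 => e4.
  lra.
have np : ~ (0 <= x0 * u + y0 * v /\ 0 <= x1 * u + y0 * v /\
             0 <= x1 * u + y1 * v /\ 0 <= x0 * u + y1 * v).
  move=> [h1 [h2 [h3 h4]]].
  have e1 := mulr_ge0 (ltW w1) h1; have e2 := mulr_ge0 (ltW w2) h2.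
  have e3 := mulr_ge0 (ltW w3) h3; have e4 := mulr_ge0 (ltW w4) h4.
  have z1 : x1 * y1 * (x0 * u + y0 * v) = 0 by lra.
  have z2 : - x0 * y1 * (x1 * u + y0 * v) = 0 by lra.
  have {}z1 : x0 * u + y0 * v = 0.
    by move/eqP: z1; rewrite mulf_eq0 gt_eqF//= => /eqP.
  have {}z2 : x1 * u + y0 * v = 0.
    by move/eqP: z2; rewrite mulf_eq0 gt_eqF//= => /eqP.
  have : (x1 - x0) * u = 0 by lra.
  move/eqP; rewrite mulf_eq0 gt_eqF ?subr_gt0 ?(lt_trans hx0)//= => /eqP u0.
  have : y0 * v = 0 by move: z1; rewrite u0; lra.
  move/eqP; rewrite mulf_eq0 lt_eqF//= => /eqP v0.
  by move/eqP: AB; apply; rewrite /cross -/u -/v u0 v0; ring.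
have p1 : 0 < x0 * y0 - y0 * x1 by lra.
have p2 : 0 < x1 * y1 - y0 * x1 by lra.
have p3 : 0 < x1 * y1 - y1 * x0 by lra.
have p4 : 0 < x0 * y0 - y1 * x0 by lra.
case: (ltgtP (cross A B) 0) AB => // [neg|pos] _; last first.
  { rewrite sgz_def gt_eqF//= lt_gtF//= expr0; apply: parallelogram_pos; rewrite ?C ?LE//=; try exact: mulr_gt0; first ring.
  all: by rewrite -/u -/v; tauto. }
rewrite sgz_def lt_eqF//= neg/= expr1.
apply: parallelogram_neg; rewrite ?C ?LE//=; try (by rewrite pmulr_rlt0); first ring.
all: by rewrite -/u -/v; tauto.
Qed.

End LinearIndex.

(** * Index of a grid block around a nondegenerate zero *)

Section Grid.
Context {R : realType}.
Implicit Types (p q A B : R * R) (Psi : R * R -> R * R).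

Definition unit_square : set (R * R) := `[0, 1]%classic `*` `[0, 1]%classic.

Lemma compact_unit_square : compact unit_square.
Proof. by apply: compact_setX; exact: segment_compact. Qed.

(** The hypothesis places all [P i] on the line through [P m] and [P n]. This line misses the
    origin, so all the points lie in one open half-plane. *)
Lemma crossing_segment (P : nat -> R * R) m n : (m <= n)%N ->
  (forall i, (m <= i <= n)%N ->
     cross (P i) (P n - P m) = cross (P m) (P n - P m)) ->
  cross (P m) (P n) != 0 ->
  \sum_(m <= i < n) crossing (P i) (P i.+1) = crossing (P m) (P n).
Proof.
move=> mn h nz.
pose w := P n - P m; pose k := cross (P m) (P n).
apply: (@crossing_path _ P m n (k * w.2, - (k * w.1))) => // i /h e.
have -> : dotp (k * w.2, - (k * w.1)) (P i) = k * cross (P i) w.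
  by rewrite /dotp /cross /=; ring.
rewrite e.
have -> : cross (P m) (P n - P m) = k by rewrite /k /cross /=; ring.
by rewrite -expr2 lt_neqAle sqr_ge0 andbT eq_sym sqrf_eq0.
Qed.

Definition grid_pt n i j : R * R := (i%:R / n%:R, j%:R / n%:R).

Definition grid_cell Psi n i j : int :=
  crossing (Psi (grid_pt n i j)) (Psi (grid_pt n i.+1 j)) +
  crossing (Psi (grid_pt n i.+1 j)) (Psi (grid_pt n i.+1 j.+1)) +
  crossing (Psi (grid_pt n i.+1 j.+1)) (Psi (grid_pt n i j.+1)) +
  crossing (Psi (grid_pt n i j.+1)) (Psi (grid_pt n i j)).

(** With [hi], the indices of the last grid points not exceeding [x - rho] and [x + rho] when these
    are nonnegative. *)
Definition lo n (x rho : R) := Num.truncn (n%:R * (x - rho)).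
Definition hi n (x rho : R) := Num.truncn (n%:R * (x + rho)).

Lemma grid_lo n (x rho : R) : (0 < n)%N -> 0 <= x - rho ->
  x - rho - n%:R^-1 < (lo n x rho)%:R / n%:R <= x - rho.
Proof.
move=> n0 h; have n0' : 0 < n%:R :> R by rewrite ltr0n.
have /andP[h1 h2] := truncn_itv (mulr_ge0 (ltW n0') h).
apply/andP; split; last by rewrite ler_pdivrMr// mulrC.
rewrite ltr_pdivlMr// mulrBl mulVf ?gt_eqF//.
by rewrite ltrBlDr natr1 mulrC.
Qed.

Lemma lo_ge n (x rho : R) i : (0 < n)%N -> 0 <= x - rho -> (i < lo n x rho)%N ->
  i.+1%:R / n%:R <= x - rho.
Proof.
move=> n0 h il; have /andP[_] := grid_lo n0 h; apply: le_trans.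
by rewrite ler_pM2r ?invr_gt0 ?ltr0n// ler_nat.
Qed.

Lemma grid_hi n (x rho : R) : (0 < n)%N -> 0 <= x + rho ->
  x + rho - n%:R^-1 < (hi n x rho)%:R / n%:R <= x + rho.
Proof.
by move=> n0 h; have := @grid_lo n x (- rho) n0; rewrite /lo opprK; exact.
Qed.

Lemma lo_le_hi n (x rho : R) : 0 <= rho -> (lo n x rho <= hi n x rho)%N.
Proof.
by move=> r0; apply: le_truncn; rewrite ler_wpM2l//; lra.
Qed.

Lemma compact_annulus p (r s : R) : compact [set q | r <= `|q - p| <= s].
Proof.
have -> : [set q | r <= `|q - p| <= s] =
  ((`[p.1 - s, p.1 + s]%classic `*` `[p.2 - s, p.2 + s]%classic) `&`
   [set q | `|q - p| <= s]) `&` [set q | r <= `|q - p|].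
  apply/seteqP; split => [q /= /andP[h1 h2]|q [[_ h2] h1]]; last by apply/andP.
  split=> //; split => //; split => /=; rewrite !in_itv /=.
    by have := le_trans (norm_fst_le (q - p)) h2; rewrite /= !ler_norml => /andP[? ?]; apply/andP; split; lra.
  by have := le_trans (norm_snd_le (q - p)) h2; rewrite /= !ler_norml => /andP[? ?]; apply/andP; split; lra.
have cn : continuous (fun q => `|q - p|).
  move=> q; apply: cvg_norm; apply: cvgB; [exact: cvg_id|exact: cvg_cst].
apply: compact_closedI; [apply: compact_closedI|].
- by apply: compact_setX; exact: segment_compact.
- exact: (closed_comp (fun q _ => cn q) (@closed_le _ s)).
- exact: (closed_comp (fun q _ => cn q) (@closed_ge _ r)).
Qed.

(** Along the boundary of the block, [Psi] shares half-planes with its linear part, whose index is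
    known from [rectangle_index]. *)
Lemma block_index Psi p A B (rho : R) : 0 < rho -> cross A B != 0 ->
  (forall q, `|q - p| <= 2 * rho -> unit_square q) ->
  unif_cont_on unit_square Psi ->
  (forall q, `|q - p| <= 2 * rho -> q != p ->
     0 < dotp ((q.1 - p.1) *: A + (q.2 - p.2) *: B) (Psi q)) ->
  exists N, forall n, (N <= n)%N ->
    \sum_(lo n p.1 rho <= i < hi n p.1 rho)
       \sum_(lo n p.2 rho <= j < hi n p.2 rho) grid_cell Psi n i j =
    sgz (cross A B).
Proof.
move=> rho0 AB sq uP pos.
pose L q := (q.1 - p.1) *: A + (q.2 - p.2) *: B.
have LE q : L q = ((q.1 - p.1) * A.1 + (q.2 - p.2) * B.1,
                    (q.1 - p.1) * A.2 + (q.2 - p.2) * B.2) by [].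
(* Both [Psi] and its linear part vanish at [p], so uniform positivity is sought on an annulus; it
   contains the boundary of the block once 1/n < rho/2. *)
pose K := [set q | rho / 2 <= `|q - p| <= 2 * rho].
have cK : compact K by exact: compact_annulus.
have KQ : K `<=` unit_square by move=> q /andP[_]; exact: sq.
have uPK := unif_cont_sub KQ uP.
have uL : unif_cont_on K L.
  apply: heine_cantor => //; apply: continuous_subspaceT => q.
  apply: cvgD; apply: cvgZr_tmp; apply: cvgB; try exact: cvg_cst.
    exact: (@cvg_fst _ _ (nbhs q.1) (nbhs q.2)).
  exact: (@cvg_snd _ _ (nbhs q.1) (nbhs q.2)).
have Kp q : K q -> q != p.
  by move=> /andP[h _]; apply: contraTneq h => ->; rewrite subrr normr0 -ltNge divr_gt0.
have [d d0 dP] := @dotp_unif _ _ K L Psi cK uL uPK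
  (fun q Kq => pos q (proj2 (andP Kq)) (Kp q Kq)).
have LL q : K q -> 0 < dotp (L q) (L q).
  move=> Kq; apply: lt_le_trans (dotp_ge _); rewrite exprn_gt0// normr_gt0.
  by apply/eqP => L0; have := pos q (proj2 (andP Kq)) (Kp q Kq); rewrite -/(L q) L0 /dotp /= !mul0r addr0 ltxx.
have [d' d'0 d'P] := dotp_unif cK uL uL LL.
have [|N N0 NP] := @inv_nat_lt R (Num.min d (Num.min d' (rho / 2))).
  by rewrite !lt_min d0 d'0 divr_gt0.
exists N => n Nn.
have n0 : (0 < n)%N by exact: leq_trans Nn.
have n0' : 0 < n%:R :> R by rewrite ltr0n.
have := NP _ Nn; rewrite !lt_min => /and3P[nd nd' nrho].
set i0 := lo n p.1 rho; set i1 := hi n p.1 rho.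
set j0 := lo n p.2 rho; set j1 := hi n p.2 rho.
have i01 : (i0 <= i1)%N by apply: lo_le_hi; exact: ltW.
have j01 : (j0 <= j1)%N by apply: lo_le_hi; exact: ltW.
have pin (e1 e2 : R) : `|e1| <= 1 -> `|e2| <= 1 -> unit_square (p.1 + e1 * rho, p.2 + e2 * rho).
  move=> h1 h2; apply: sq; rewrite prod_normE /= ge_max.
  rewrite ![_ + _ * _ - _]addrC !addKr !normrM !(gtr0_norm rho0).
  by apply/andP; split; apply: ler_pM => //; lra.
have n1 : `|- 1 : R| <= 1 by rewrite normrN1.
have n2 : `|1 : R| <= 1 by rewrite normr1.
have [] := pin _ _ n1 n1; have [] := pin _ _ n2 n2; rewrite /= !in_itv /= !mulN1r !mul1r.
move=> /andP[_ h1] /andP[_ h2] /andP[h3 _] /andP[h4 _].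
have /andP[x0l x0h] := grid_lo n0 h3; have /andP[y0l y0h] := grid_lo n0 h4.
have [x1l x1h] : p.1 + rho - n%:R^-1 < i1%:R / n%:R /\ i1%:R / n%:R <= p.1 + rho.
  by apply/andP; apply: grid_hi => //; lra.
have [y1l y1h] : p.2 + rho - n%:R^-1 < j1%:R / n%:R /\ j1%:R / n%:R <= p.2 + rho.
  by apply/andP; apply: grid_hi => //; lra.
rewrite -/i0 in x0l x0h; rewrite -/j0 in y0l y0h.
have mid (a b c : nat) : (a <= b <= c)%N -> (a%:R / n%:R <= b%:R / n%:R :> R) && (b%:R / n%:R <= c%:R / n%:R :> R).
  by move=> /andP[ab bc]; apply/andP; split; rewrite ler_pM2r ?invr_gt0 ?ltr0n ?ler_nat.
have side i j : (i0 <= i <= i1)%N -> (j0 <= j <= j1)%N ->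
    [\/ i = i0, i = i1, j = j0 | j = j1] -> K (grid_pt n i j).
  move=> ii jj e; have /andP[b1 b2] := mid _ _ _ ii; have /andP[b3 b4] := mid _ _ _ jj.
  have low : (rho / 2 <= `|i%:R / n%:R - p.1|) || (rho / 2 <= `|j%:R / n%:R - p.2|).
    rewrite !ler_normr; case: e => e; rewrite e in b1 b2 b3 b4 *.
    - by apply/orP; left; apply/orP; right; lra.
    - by apply/orP; left; apply/orP; left; lra.
    - by apply/orP; right; apply/orP; right; lra.
    - by apply/orP; right; apply/orP; left; lra.
  rewrite /K /= prod_normE /= le_max ge_max low /= !ler_norml.
  by apply/and3P; split; first apply/andP; try split; lra.
have stepE (k : nat) : k%:R / n%:R - k.+1%:R / n%:R = - n%:R^-1 :> R.
  by rewrite -mulrBl -natr1 opprD addrA subrr sub0r mulN1r.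
have adjh i j : `|grid_pt n i j - grid_pt n i.+1 j| = n%:R^-1.
  by rewrite prod_normE /= stepE subrr normr0 normrN ger0_norm ?invr_ge0// max_l ?invr_ge0.
have adjv i j : `|grid_pt n i j - grid_pt n i j.+1| = n%:R^-1.
  by rewrite prod_normE /= stepE subrr normr0 normrN ger0_norm ?invr_ge0// max_r ?invr_ge0.
pose P i j := Psi (grid_pt n i j); pose Q i j := L (grid_pt n i j).
have QE i j i' j' : cross (Q i j) (Q i' j') =
   ((i%:R / n%:R - p.1) * (j'%:R / n%:R - p.2) - (j%:R / n%:R - p.2) * (i'%:R / n%:R - p.1)) * cross A B.
  by rewrite /Q !LE /cross /=; ring.
have horiz j : j = j0 \/ j = j1 ->
    \sum_(i0 <= i < i1) crossing (P i j) (P i.+1 j) =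
    crossing (Q i0 j) (Q i1 j) + crossing (P i0 j) (Q i0 j) - crossing (P i1 j) (Q i1 j).
  move=> e.
  have jj : (j0 <= j <= j1)%N by case: e => ->; rewrite leqnn ?j01.
  have Kj i : (i0 <= i <= i1)%N -> K (grid_pt n i j).
    by move=> ii; apply: side => //; case: e => ->; [constructor 3|constructor 4].
  (* [Psi] is exchanged for its linear part along the side. The linear image of the side collapses
     to its chord, and the corner terms left over cancel around the block. *)
  rewrite (@crossing_paths _ (fun i => P i j) (fun i => Q i j))//.
    congr (_ + _ - _).
    apply: (@crossing_segment (fun i => Q i j)) => //.
      by move=> i _; rewrite /Q !LE /cross /=; ring.
    rewrite QE mulf_neq0//.
    have -> : (i0%:R / n%:R - p.1) * (j%:R / n%:R - p.2) - (j%:R / n%:R - p.2) * (i1%:R / n%:R - p.1) = (j%:R / n%:R - p.2) * (i0%:R / n%:R - i1%:R / n%:R) :> R by ring.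
    apply: mulf_neq0; last by rewrite lt_eqF; lra.
    by case: e => ->; [rewrite lt_eqF//|rewrite gt_eqF//]; lra.
  move=> i /andP[ii ii']; exists (Q i j).
  have K1 := Kj i; rewrite ii (ltnW ii') in K1; have {}K1 := K1 isT.
  have K2 := Kj i.+1; rewrite ii' (leq_trans ii (leqnSn _)) in K2; have {}K2 := K2 isT.
  split; [|apply: dP => //; by rewrite adjh| exact: LL | apply: d'P => //; by rewrite adjh].
  by apply: dP => //; rewrite subrr normr0.
have vert i : i = i0 \/ i = i1 ->
    \sum_(j0 <= j < j1) crossing (P i j) (P i j.+1) =
    crossing (Q i j0) (Q i j1) + crossing (P i j0) (Q i j0) - crossing (P i j1) (Q i j1).
  move=> e.
  have jj : (i0 <= i <= i1)%N by case: e => ->; rewrite leqnn ?i01.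
  have Kj j : (j0 <= j <= j1)%N -> K (grid_pt n i j).
    by move=> ii; apply: side => //; case: e => ->; [constructor 1|constructor 2].
  rewrite (@crossing_paths _ (P i) (Q i))//.
    congr (_ + _ - _).
    apply: (@crossing_segment (Q i)) => //.
      by move=> j _; rewrite /Q !LE /cross /=; ring.
    rewrite QE mulf_neq0//.
    rewrite [_ * (j1%:R / _ - _)]mulrC -mulrBl.
    apply: mulf_neq0; first by rewrite gt_eqF; lra.
    by case: e => ->; [rewrite lt_eqF//|rewrite gt_eqF//]; lra.
  move=> j /andP[ii ii']; exists (Q i j).
  have K1 := Kj j; rewrite ii (ltnW ii') in K1; have {}K1 := K1 isT.
  have K2 := Kj j.+1; rewrite ii' (leq_trans ii (leqnSn _)) in K2; have {}K2 := K2 isT.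
  split; [|apply: dP => //; by rewrite adjv| exact: LL | apply: d'P => //; by rewrite adjv].
  by apply: dP => //; rewrite subrr normr0.
have -> := crossing_grid P i01 j01.
rewrite !horiz ?vert; try by [left|right].
have <- := @rectangle_index _ A B (i0%:R / n%:R - p.1) (i1%:R / n%:R - p.1)
  (j0%:R / n%:R - p.2) (j1%:R / n%:R - p.2) _ _ _ _ AB; try lra.
rewrite -!/(L (grid_pt n _ _)) -!/(Q _ _).
rewrite (crossingN (Q i0 j1) (Q i1 j1)) (crossingN (Q i0 j0) (Q i0 j1)).
rewrite /Q /L /=; ring.
Qed.

End Grid.

(** * Argument principle on the unit square *)

Section SquareDegree.
Context {R : realType}.
Implicit Types (p q A B : R * R) (Psi : R * R -> R * R).

Lemma seq_small (T : eqType) (s : seq T) (P : T -> R -> Prop) :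
  (forall x, x \in s -> exists2 r, 0 < r & forall t, 0 < t <= r -> P x t) ->
  exists2 r, 0 < r & forall t, 0 < t <= r -> forall x, x \in s -> P x t.
Proof.
elim: s => [|x s IH] h; first by exists 1.
have [y ys|r r0 rP] := IH; first by apply: h; rewrite in_cons ys orbT.
have [r' r'0 r'P] := h x (mem_head _ _).
exists (Num.min r r'); first by rewrite lt_min r0.
move=> t; rewrite le_min => /and3P[t0 tr tr'] y; rewrite in_cons => /predU1P[->|ys].
  by apply: r'P; rewrite t0.
by apply: rP => //; rewrite t0.
Qed.

Lemma seq_large (T : eqType) (s : seq T) (P : T -> nat -> Prop) :
  (forall x, x \in s -> exists N, forall n, (N <= n)%N -> P x n) ->
  exists N, forall n, (N <= n)%N -> forall x, x \in s -> P x n.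
Proof.
elim: s => [|x s IH] h; first by exists 0%N.
have [y ys|N NP] := IH; first by apply: h; rewrite in_cons ys orbT.
have [N' N'P] := h x (mem_head _ _).
exists (maxn N N') => n; rewrite geq_max => /andP[Nn N'n] y.
by rewrite in_cons => /predU1P[->|ys]; [exact: N'P|exact: NP].
Qed.

(** Fréchet differentiability at [p] with partial derivatives [A] and [B], in a form directly usable
    in estimates. *)
Definition has_columns Psi p A B := forall e, 0 < e -> exists2 d, 0 < d &
  forall q, `|q - p| < d ->
    `|Psi q - Psi p - ((q.1 - p.1) *: A + (q.2 - p.2) *: B)| <= e * `|q - p|.

(** The linear part L satisfies |L| >= m |q - p|, while the remainder is at most m |q - p| / 4;
    hence its product with L, at most 2 |L| times the remainder, cannot outweigh |L|^2. *)
Lemma columns_dominate Psi p A B : cross A B != 0 -> Psi p = 0 ->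
  has_columns Psi p A B ->
  exists2 r, 0 < r & forall q, `|q - p| <= r -> q != p ->
    0 < dotp ((q.1 - p.1) *: A + (q.2 - p.2) *: B) (Psi q).
Proof.
move=> AB P0 hc.
pose M := `|A| + `|B| + 1; pose m := `|cross A B| / (2 * M).
have M0 : 0 < M by rewrite /M ltr_wpDl// addr_ge0.
have m0 : 0 < m by rewrite divr_gt0 ?normr_gt0// mulr_gt0.
have cross_le (a b : R * R) : `|cross a b| <= 2 * `|a| * `|b|.
  rewrite /cross; apply: (le_trans (ler_normB _ _)); rewrite !normrM -mulrA mulr2n mulrDl mul1r.
  by apply: lerD; apply: ler_pM => //; rewrite ?norm_fst_le ?norm_snd_le.
(* Cramer's rule: the cross products of [w] with [B] and with [A] isolate [x] and [y]. *)
have dom (x y : R) : m * Num.max `|x| `|y| <= `|x *: A + y *: B|.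
  set w := _ + _.
  have e1 : cross w B = x * cross A B by rewrite /w /cross /= -![_ *: _]/(_ * _); ring.
  have e2 : cross A w = y * cross A B by rewrite /w /cross /= -![_ *: _]/(_ * _); ring.
  have l1 : `|x| * `|cross A B| <= `|w| * (2 * M).
    rewrite -normrM -e1; apply: (le_trans (cross_le _ _)).
    have : `|w| * `|B| <= `|w| * M by rewrite ler_wpM2l// /M; have := normr_ge0 A; lra.
    by lra.
  have l2 : `|y| * `|cross A B| <= `|w| * (2 * M).
    rewrite -normrM -e2; apply: (le_trans (cross_le _ _)).
    have : `|w| * `|A| <= `|w| * M by rewrite ler_wpM2l// /M; have := normr_ge0 B; lra.
    by lra.
  rewrite /m mulrAC ler_pdivrMr ?mulr_gt0// mulrC.
  by rewrite /Num.max; case: ifP.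
have [|d d0 dP] := hc (m / 4); first by rewrite divr_gt0.
exists (d / 2); rewrite ?divr_gt0// => q qd qp.
set L := _ + _.
have qd' : `|q - p| < d by lra.
have qp0 : 0 < `|q - p| by rewrite normr_gt0 subr_eq0.
have h1 : m * `|q - p| <= `|L| by rewrite prod_normE; exact: dom.
have := dP q qd'; rewrite P0 subr0 -/L => h2.
rewrite -(subrK L (Psi q)) dotpDr addrC -ltrBlDr sub0r.
apply: (@lt_le_trans _ _ (`|L| ^+ 2)); last exact: dotp_ge.
apply: (le_lt_trans (ler_norm _)); rewrite normrN.
apply: (le_lt_trans (dotp_le _ _)); rewrite expr2 -mulrA mulrCA ltr_pM2l.
  have : 0 < m * `|q - p| by rewrite mulr_gt0.
  lra.
by apply: lt_le_trans h1; rewrite mulr_gt0.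
Qed.

Lemma sum_subrange (V : zmodType) (F : nat -> V) a b n : (b <= n)%N ->
  \sum_(a <= i < b) F i = \sum_(0 <= i < n) if (a <= i < b)%N then F i else 0.
Proof.
move=> bn; rewrite -big_mkcond /=.
rewrite (big_nat_widenl a 0)// (big_nat_widen _ b n)//.
Qed.

(** By [crossing_grid] the boundary sum is the sum of the indices of all cells. Cells outside the
    blocks around the zeros contribute 0, and each block contributes the sign of the Jacobian. *)
Lemma square_degree Psi (A B : R * R -> R * R) (zs : seq (R * R)) :
  unif_cont_on unit_square Psi -> uniq zs ->
  (forall q, unit_square q -> Psi q = 0 -> q \in zs) ->
  (forall p, p \in zs -> [/\ 0 < p.1 < 1, 0 < p.2 < 1, Psi p = 0,
     cross (A p) (B p) != 0 & has_columns Psi p (A p) (B p)]) ->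
  exists N, forall n, (N <= n)%N ->
  \sum_(0 <= i < n) crossing (Psi (grid_pt n i 0)) (Psi (grid_pt n i.+1 0)) +
  \sum_(0 <= j < n) crossing (Psi (grid_pt n n j)) (Psi (grid_pt n n j.+1)) -
  \sum_(0 <= i < n) crossing (Psi (grid_pt n i n)) (Psi (grid_pt n i.+1 n)) -
  \sum_(0 <= j < n) crossing (Psi (grid_pt n 0 j)) (Psi (grid_pt n 0 j.+1)) =
  \sum_(p <- zs) sgz (cross (A p) (B p)).
Proof.
move=> uP uzs zP zsP.
(* One radius serves all zeros: the surrounding squares stay in the unit square, [Psi] is dominated
   there by its linear part, and the blocks of distinct zeros are disjoint. *)
have [r r0 rP] : exists2 r, 0 < r & forall t, 0 < t <= r -> forall p, p \in zs ->
    [/\ forall q, `|q - p| <= 2 * t -> unit_square q,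
        forall q, `|q - p| <= 2 * t -> q != p ->
          0 < dotp ((q.1 - p.1) *: A p + (q.2 - p.2) *: B p) (Psi q) &
        forall p', p' \in zs -> p' != p -> 4 * t < `|p - p'|].
  apply: seq_small => p pz; have [p1 p2 P0 AB hc] := zsP p pz.
  have [r1 r10 r1P] := columns_dominate AB P0 hc.
  have [r2 r20 r2P] : exists2 r, 0 < r & forall t, 0 < t <= r -> forall p', p' \in zs -> p' != p -> 4 * t < `|p - p'|.
    apply: (@seq_small _ zs (fun p' t => p' != p -> 4 * t < `|p - p'|)) => p' _.
    have [->|pp'] := eqVneq p' p; first by exists 1.
    have : 0 < `|p - p'| by rewrite normr_gt0 subr_eq0 eq_sym.
    by exists (`|p - p'| / 8); [lra|move=> t /andP[t0 t1] _; lra].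
  move: p1 p2 => /andP[p1 p1'] /andP[p2 p2'].
  exists (Num.min (r1 / 2) (Num.min r2 (Num.min (Num.min (p.1 / 2) ((1 - p.1) / 2)) (Num.min (p.2 / 2) ((1 - p.2) / 2))))).
    rewrite !lt_min r20 !divr_gt0//; lra.
  move=> t; rewrite !le_min => /and5P[t0 t1 t2 /andP[t3 t4] /andP[t5 t6]].
  split.
  - move=> q h; split; rewrite /= in_itv /=.
      have := le_trans (norm_fst_le (q - p)) h; rewrite /= ler_norml; lra.
    have := le_trans (norm_snd_le (q - p)) h; rewrite /= ler_norml; lra.
  - by move=> q h; apply: r1P; lra.
  - by apply: r2P; rewrite t0.
have /rP {}rP : 0 < r <= r by rewrite r0 lexx.
have [N1 N1P] : exists N, forall n, (N <= n)%N -> forall p, p \in zs ->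
    \sum_(lo n p.1 r <= i < hi n p.1 r)
       \sum_(lo n p.2 r <= j < hi n p.2 r) grid_cell Psi n i j =
    sgz (cross (A p) (B p)).
  apply: seq_large => p pz; have [p1 p2 P0 AB hc] := zsP p pz.
  by have [h1 h2 _] := rP p pz; exact: block_index.
(* Away from the zeros [Psi] has no zero, so neighbouring grid values share a half-plane. *)
pose K := unit_square `&` [set q | forall p, p \in zs -> r / 2 <= `|q - p|].
have cK : compact K.
  apply: compact_closedI; first exact: compact_unit_square.
  have -> : [set q | forall p, p \in zs -> r / 2 <= `|q - p|] =
    \bigcap_(p in [set` zs]) [set q | r / 2 <= `|q - p|].
    by apply/seteqP; split.
  apply: closed_bigI => p _.
  have cn : continuous (fun q => `|q - p|).
    by move=> q; apply: cvg_norm; apply: cvgB; [exact: cvg_id|exact: cvg_cst].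
  exact: (closed_comp (fun q _ => cn q) (@closed_ge _ (r / 2))).
have uK := unif_cont_sub (@subIsetl _ _ _ : K `<=` unit_square) uP.
have [|d d0 dP] := dotp_unif cK uK uK.
  move=> q [Qq qz]; apply: lt_le_trans (dotp_ge _); rewrite exprn_gt0// normr_gt0.
  apply/eqP => /(zP q Qq) /qz; rewrite subrr normr0; lra.
have [|N2 N20 N2P] := @inv_nat_lt R (Num.min d (r / 2)).
  by rewrite lt_min d0 divr_gt0.
exists (maxn N1 N2) => n; rewrite geq_max => /andP[N1n N2n].
have n0 : (0 < n)%N by exact: leq_trans N2n.
have n0' : 0 < n%:R :> R by rewrite ltr0n.
have := N2P _ N2n; rewrite lt_min => /andP[nd nr].
rewrite -(crossing_grid (fun i j => Psi (grid_pt n i j)))//.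
have bnd p : p \in zs -> [/\ 0 <= p.1 - r, p.1 + r <= 1, 0 <= p.2 - r & p.2 + r <= 1].
  move=> pz; have [h _ _] := rP p pz.
  have [] := h (p.1 - r, p.2 - r).
    rewrite prod_normE /= ![_ - r]addrC !addrK !normrN (gtr0_norm r0) ge_max; lra.
  have [] := h (p.1 + r, p.2 + r).
    rewrite prod_normE /= ![_ + r]addrC !addrK (gtr0_norm r0) ge_max; lra.
  by rewrite /= !in_itv /=; move=> /andP[_ ?] /andP[_ ?] /andP[? _] /andP[? _].
pose inb p i j := (lo n p.1 r <= i < hi n p.1 r)%N && (lo n p.2 r <= j < hi n p.2 r)%N.
have hi_le (x : R) : 0 <= x + r <= 1 -> (hi n x r <= n)%N.
  move=> /andP[x0 x1]; rewrite -(ler_nat R).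
  apply: (le_trans (_ : _ <= n%:R * (x + r))).
    by rewrite truncn_le mulr_ge0// ler0n.
  by rewrite ler_piMr.
have stepE (k : nat) : k%:R / n%:R - k.+1%:R / n%:R = - n%:R^-1 :> R.
  by rewrite -mulrBl -natr1 opprD addrA subrr sub0r mulN1r.
have ninv0 : 0 < n%:R^-1 :> R by rewrite invr_gt0.
have lo_small (x : R) i : 0 <= x - r -> (i < lo n x r)%N ->
    i%:R / n%:R <= x - r /\ i.+1%:R / n%:R <= x - r.
  move=> x0 il; have h := lo_ge n0 x0 il; split => //.
  by have := stepE i; lra.
have hi_big (x : R) i : 0 <= x + r -> (hi n x r <= i)%N ->
    x + r / 2 <= i%:R / n%:R /\ x + r / 2 <= i.+1%:R / n%:R.
  move=> x0 il; have /andP[h _] := grid_hi n0 x0.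
  have : (hi n x r)%:R / n%:R <= i%:R / n%:R :> R.
    by rewrite ler_pM2r ?invr_gt0// ler_nat.
  by have := stepE i; lra.
have far p i j : p \in zs -> ~~ inb p i j -> forall i' j', i' = i \/ i' = i.+1 ->
    j' = j \/ j' = j.+1 -> r / 2 <= `|grid_pt n i' j' - p|.
  move=> pz; have [b1 b2 b3 b4] := bnd p pz.
  have b2' : 0 <= p.1 + r by lra. 
  have b4' : 0 <= p.2 + r by lra.
  rewrite /inb !negb_and -!ltnNge !ltnS => /orP[/orP[]|/orP[]] h i' j' ei ej;
    rewrite prod_normE /= le_max !ler_normr.
  - have [h1 h2] := lo_small _ _ b1 h; apply/orP; left; apply/orP; right.
    by case: ei => ->; lra.
  - have [h1 h2] := hi_big _ _ b2' h; apply/orP; left; apply/orP; left.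
    by case: ei => ->; lra.
  - have [h1 h2] := lo_small _ _ b3 h; apply/orP; right; apply/orP; right.
    by case: ej => ->; lra.
  - have [h1 h2] := hi_big _ _ b4' h; apply/orP; right; apply/orP; left.
    by case: ej => ->; lra.
have near p i j : p \in zs -> inb p i j -> `|grid_pt n i j - p| <= 2 * r.
  move=> pz; have [b1 b2 b3 b4] := bnd p pz.
  have b2' : 0 <= p.1 + r by lra. 
  have b4' : 0 <= p.2 + r by lra.
  move=> /andP[/andP[a1 a2] /andP[a3 a4]].
  have w (x : R) k : 0 <= x - r -> 0 <= x + r -> (lo n x r <= k)%N -> (k < hi n x r)%N -> `|k%:R / n%:R - x| <= 2 * r.
    move=> x0 x1 k1 k2; have /andP[e1 _] := grid_lo n0 x0; have /andP[_ e2] := grid_hi n0 x1.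
    have : (lo n x r)%:R / n%:R <= k%:R / n%:R :> R by rewrite ler_pM2r ?invr_gt0// ler_nat.
    have : k%:R / n%:R <= (hi n x r)%:R / n%:R :> R by rewrite ler_pM2r ?invr_gt0// ler_nat ltnW.
    by rewrite ler_norml => ? ?; apply/andP; split; lra.
  by rewrite prod_normE /= ge_max !w.
(* A cell lies in the block of at most one zero, since zeros are more than 4r apart and block points
   are within 2r of theirs. A cell in no block has its four corner values in one half-plane, hence
   index 0. *)
have cellE i j : (i < n)%N -> (j < n)%N -> grid_cell Psi n i j =
    \sum_(p <- zs) if inb p i j then grid_cell Psi n i j else 0.
  move=> ltin ltjn; have [/hasP[p pz ip]|/hasPn nin] := boolP (has (fun p => inb p i j) zs).
    rewrite (bigD1_seq p)//= ip big1_seq ?addr0// => p' /andP[p'p p'z].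
    case: ifP => // ip'; have [_ _ /(_ p' p'z p'p)] := rP p pz.
    have := near p i j pz ip; have := near p' i j p'z ip'; rewrite (distrC _ p) => h1 h2.
    rewrite ltNge => /negP[]; rewrite -(subrKA (grid_pt n i j)).
    by apply: (le_trans (ler_normD _ _)); lra.
  rewrite big1_seq; last by move=> p /andP[_ /nin /negbTE ->].
  have Kc i' j' : i' = i \/ i' = i.+1 -> j' = j \/ j' = j.+1 -> K (grid_pt n i' j').
    move=> ei ej; split; last by move=> p pz; exact: (far p i j pz (nin p pz)).
    by split; apply: itv01 => //; [case: ei => ->|case: ej => ->] => //; exact: ltnW.
  have [L1 L2 R1 R2] : [/\ i = i \/ i = i.+1, i.+1 = i \/ i.+1 = i.+1,
     j = j \/ j = j.+1 & j.+1 = j \/ j.+1 = j.+1] by split; tauto.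
  have c i' j' : i' = i \/ i' = i.+1 -> j' = j \/ j' = j.+1 -> 0 < dotp (Psi (grid_pt n i j)) (Psi (grid_pt n i' j')).
    move=> ei ej; apply: dP; [exact: Kc|exact: Kc|].
    apply: le_lt_trans nd; rewrite prod_normE /= ge_max.
    by apply/andP; split; [case: ei => ->|case: ej => ->]; rewrite ?stepE ?subrr ?normr0 ?normrN ?ger0_norm ?invr_ge0.
  have c00 := c _ _ L1 R1; have c10 := c _ _ L2 R1; have c01 := c _ _ L1 R2; have c11 := c _ _ L2 R2.
  rewrite /grid_cell (crossing_half_plane c00 c10) (crossing_half_plane c10 c11).
  by rewrite (crossing_half_plane c11 c01) (crossing_half_plane c01 c00); ring.
transitivity (\sum_(0 <= i < n) \sum_(0 <= j < n) \sum_(p <- zs)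
    if inb p i j then grid_cell Psi n i j else 0).
  by apply: eq_big_nat => i /andP[_ ?]; apply: eq_big_nat => j /andP[_ ?]; exact: cellE.
under eq_bigr do rewrite exchange_big /=.
rewrite exchange_big /=; apply: eq_big_seq => p pz.
have [b1 b2 b3 b4] := bnd p pz.
rewrite -(N1P n N1n p pz) (sum_subrange _ _ (hi_le _ _)); last by lra.
apply: eq_bigr => i _; rewrite /inb; case: ifP => _ /=; last by rewrite big1.
by rewrite (sum_subrange _ _ (hi_le _ _))//; lra.
Qed.

End SquareDegree.

(** * The closed unit disk in polar coordinates *)

Section Polar.
Context {R : realType}.
Implicit Types (p q c u : R * R).

Definition circle (s : R) : R * R := (cos (2 * pi * s), sin (2 * pi * s)).

Definition sqn p : R := p.1 ^+ 2 + p.2 ^+ 2.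

Lemma sqn_ge0 p : 0 <= sqn p. Proof. by rewrite addr_ge0// sqr_ge0. Qed.

Lemma norm2_lt1 p : (norm2 p < 1) = (sqn p < 1).
Proof. by rewrite /norm2 -[X in _ < X]sqrtr1 ltr_sqrt. Qed.

Lemma sqn_circle s : sqn (circle s) = 1.
Proof. exact: cos2Dsin2. Qed.

Lemma circle0 : circle 0 = (1, 0).
Proof. by rewrite /circle mulr0 cos0 sin0. Qed.

Lemma circle1 : circle 1 = (1, 0).
Proof. by rewrite /circle mulr1 mulrC mulr_natr cos2pi sin2pi. Qed.

Lemma norm_sqr (x : R) : `|x| ^+ 2 = x ^+ 2.
Proof. by rewrite -normrX ger0_norm ?sqr_ge0. Qed.

Lemma sqn_ge p : `|p| ^+ 2 <= sqn p.
Proof. by have := dotp_ge p; rewrite /dotp /sqn !expr2. Qed.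

Lemma sqn_le p : sqn p <= 2 * `|p| ^+ 2.
Proof.
rewrite /sqn -[p.1 ^+ 2]norm_sqr -[p.2 ^+ 2]norm_sqr.
have := norm_fst_le p; have := norm_snd_le p => h2 h1.
have h3 : `|p.1| ^+ 2 <= `|p| ^+ 2 by rewrite ler_sqr ?nnegrE.
have h4 : `|p.2| ^+ 2 <= `|p| ^+ 2 by rewrite ler_sqr ?nnegrE.
lra.
Qed.

Lemma unit_diskE : unit_disk = [set p : R * R | sqn p < 1].
Proof. by apply/seteqP; split => p /=; rewrite /unit_disk /= norm2_lt1. Qed.

Lemma sqn_continuous : continuous sqn.
Proof.
have -> : sqn = (fun p => p.1 * p.1 + p.2 * p.2).
  by apply/funext => p; rewrite /sqn !expr2.
move=> p; by apply: cvgD; apply: cvgM; first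
  [exact: (@cvg_fst _ _ (nbhs p.1) (nbhs p.2))|exact: (@cvg_snd _ _ (nbhs p.1) (nbhs p.2))].
Qed.

Lemma closure_unit_disk : closure unit_disk = [set p : R * R | sqn p <= 1].
Proof.
rewrite unit_diskE; apply/seteqP; split.
  have cl : closed [set p : R * R | sqn p <= 1].
    exact: (closed_comp (fun q _ => @sqn_continuous q) (@closed_le _ 1)).
  move=> p /(@closure_subset _ _ [set p : R * R | sqn p <= 1]).
  have /closure_id <- := cl; apply => q /= h; exact: ltW.
move=> p /= p1 B /nbhs_ballP[r /= r0 rB].
pose t : R := Num.min (2^-1) (r / (2 * (`|p| + 1))).
have n0 : 0 < `|p| + 1 by rewrite ltr_wpDl.
have t0 : 0 < t by rewrite lt_min invr_gt0 ltr0n/= divr_gt0// mulr_gt0.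
have t1 : t <= 2^-1 by rewrite ge_min lexx.
exists ((1 - t) *: p); split.
  suff : sqn ((1 - t) *: p) < 1 by [].
  have -> : sqn ((1 - t) *: p) = (1 - t) ^+ 2 * sqn p.
    by rewrite /sqn /= -![_ *: _]/(_ * _); ring.
  apply: (@le_lt_trans _ _ ((1 - t) ^+ 2)); first by rewrite ler_piMr// sqr_ge0.
  by rewrite expr_lt1//; lra.
apply: rB; rewrite -ball_normE /=.
rewrite scalerBl scale1r opprB addrC subrK normrZ gtr0_norm//.
have : t * (`|p| + 1) <= r / 2.
  rewrite -ler_pdivlMr//; rewrite ge_min; apply/orP; right.
  by rewrite le_eqVlt; apply/orP; left; apply/eqP; field; rewrite gt_eqF.
by lra.
Qed.

Lemma boundary_unit_disk : closure unit_disk `\` unit_disk = [set p : R * R | sqn p = 1].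
Proof.
rewrite closure_unit_disk unit_diskE; apply/seteqP; split => p /=.
  by move=> [h1 /negP]; rewrite -leNgt => h2; apply/eqP; rewrite eq_le h1.
by move=> ->; split => //; rewrite ltxx.
Qed.

Lemma compact_closed_disk : compact (closure (@unit_disk R)).
Proof.
rewrite closure_unit_disk.
have -> : [set p : R * R | sqn p <= 1] =
   (`[-1, 1]%classic `*` `[-1, 1]%classic) `&` [set p : R * R | sqn p <= 1].
  apply/seteqP; split => [p /= h|p []//]; split => //.
  have : `|p| <= 1.
    by have := le_trans (sqn_ge p) h; rewrite expr_le1.
  by rewrite prod_normE ge_max !ler_norml => /andP[? ?]; split; rewrite /= in_itv.
apply: compact_closedI.
  by apply: compact_setX; exact: segment_compact.
exact: (closed_comp (fun q _ => @sqn_continuous q) (@closed_le _ 1)).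
Qed.

Lemma circle_surj u : sqn u = 1 -> exists2 s, 0 <= s < 1 & circle s = u.
Proof.
move=> u1.
have x1 : -1 <= u.1 <= 1.
  by rewrite -ler_norml -(@expr_le1 _ 2)// norm_sqr -u1 /sqn lerDl sqr_ge0.
have pi0 := @pi_gt0 R.
have a0 := acos_ge0 x1; have a1 := acos_lepi x1.
have ca : cos (acos u.1) = u.1 by rewrite acosK// in_itv.
have sa : sin (acos u.1) = `|u.2|.
  rewrite sin_acos//; have -> : 1 - u.1 ^+ 2 = u.2 ^+ 2 by rewrite -u1 /sqn; ring.
  by rewrite sqrtr_sqr.
have [u2|u2] := leP 0 u.2.
  exists (acos u.1 / (2 * pi)).
    rewrite divr_ge0 ?mulr_ge0 ?pi_ge0//= ltr_pdivrMr ?mulr_gt0//; lra.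
  rewrite /circle mulrC divfK ?mulf_neq0 ?gt_eqF// ca sa ger0_norm//.
  by case: (u).
exists (1 - acos u.1 / (2 * pi)).
  have : 0 < acos u.1 / (2 * pi).
    rewrite divr_gt0 ?mulr_gt0// lt_neqAle a0 andbT eq_sym.
    apply: contraTneq u2 => e; rewrite -leNgt.
    move: sa; rewrite e sin0 => /esym/eqP; rewrite normr_eq0 => /eqP ->; exact: lexx.
  have : acos u.1 / (2 * pi) <= 1 by rewrite ler_pdivrMr ?mulr_gt0//; lra.
  by move=> ? ?; apply/andP; split; lra.
have -> : circle (1 - acos u.1 / (2 * pi)) = (cos (- acos u.1 + pi *+ 2), sin (- acos u.1 + pi *+ 2)).
  have e : 2 * pi * (1 - acos u.1 / (2 * pi)) = - acos u.1 + pi *+ 2.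
    by rewrite mulrBr mulr1 [X in _ - X]mulrC divfK ?mulf_neq0 ?gt_eqF// addrC mulr_natl.
  by rewrite /circle e.
rewrite cosD2pi sinD2pi cosN sinN ca sa ltr0_norm// opprK.
by case: (u).
Qed.

Lemma circle_inj s s' : 0 <= s < 1 -> 0 <= s' < 1 -> circle s = circle s' -> s = s'.
Proof.
have pi0 := @pi_gt0 R.
wlog ss' : s s' / s <= s'.
  move=> W h h' e; have [ss'|/ltW ss'] := leP s s'; first exact: W.
  by apply/esym; apply: W.
move=> /andP[s0 s1] /andP[s0' s1'] [ce se].
pose d := 2 * pi * s' - 2 * pi * s.
have cd : cos d = 1.
  by rewrite /d cosB ce se -!expr2; exact: cos2Dsin2.
have d0 : 0 <= d by rewrite /d -mulrBr mulr_ge0 ?mulr_ge0 ?subr_ge0// ltW.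
have d1 : d < 2 * pi.
  by rewrite /d -mulrBr gtr_pMr ?mulr_gt0//; lra.
have de : d = 0.
  have [dpi|dpi] := leP d pi.
    apply: (@cos_inj R); rewrite ?in_itv/= ?lexx ?d0 ?dpi ?pi_ge0//.
    by rewrite cos0.
  have : cos (2 * pi - d) = cos 0.
    by rewrite cosB [2 * pi]mulr_natl cos2pi sin2pi cd cos0 mul0r addr0 mulr1.
  move=> /(@cos_inj R); rewrite !in_itv/= lexx pi_ge0 => /(_ _ isT) h.
  have : 2 * pi - d = 0 by apply: h; apply/andP; split; lra.
  by lra.
have /eqP : 2 * pi * (s' - s) = 0 by rewrite mulrBr -de.
by rewrite !mulf_eq0 pnatr_eq0 (gt_eqF pi0)/= subr_eq0 => /eqP.
Qed.

(* Polar coordinates of the closed unit disk, centred at [c]. *)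
Definition polar c q : R * R := (1 - q.1) *: c + q.1 *: circle q.2.

Lemma polarE c q : polar c q = ((1 - q.1) * c.1 + q.1 * (circle q.2).1,
                                (1 - q.1) * c.2 + q.1 * (circle q.2).2).
Proof. by []. Qed.

Lemma sqn_convex (r : R) p q : 0 <= r <= 1 ->
  sqn ((1 - r) *: p + r *: q) <= (1 - r) * sqn p + r * sqn q.
Proof.
move=> /andP[r0 r1]; rewrite -subr_ge0.
have -> : (1 - r) * sqn p + r * sqn q - sqn ((1 - r) *: p + r *: q) =
   r * (1 - r) * sqn (p - q).
  by rewrite /sqn /= -![_ *: _]/(_ * _); ring.
by rewrite !mulr_ge0 ?sqn_ge0 ?subr_ge0.
Qed.

Lemma polar_le1 c q : sqn c <= 1 -> 0 <= q.1 <= 1 -> sqn (polar c q) <= 1.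
Proof.
move=> c1 /andP[q0 q1]; apply: le_trans (sqn_convex _ _ _) _; first by rewrite q0.
have : (1 - q.1) * sqn c <= (1 - q.1) * 1 by rewrite ler_wpM2l// subr_ge0.
by rewrite sqn_circle; lra.
Qed.

Lemma polar_lt1 c q : sqn c < 1 -> 0 <= q.1 < 1 -> sqn (polar c q) < 1.
Proof.
move=> c1 /andP[q0 q1]; apply: le_lt_trans (sqn_convex _ _ _) _; first by rewrite q0 ltW.
have : (1 - q.1) * sqn c < (1 - q.1) * 1 by rewrite ltr_pM2l// subr_gt0.
by rewrite sqn_circle; lra.
Qed.

(** If the radial coordinates differed, a point of the unit circle would be a point with radial
    coordinate less than 1, hence interior. If they agree, [circle_inj] applies. *)
Lemma polar_inj c q q' : sqn c < 1 -> 0 < q.1 -> 0 < q'.1 ->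
  0 <= q.2 < 1 -> 0 <= q'.2 < 1 -> polar c q = polar c q' -> q = q'.
Proof.
move=> c1; wlog qq' : q q' / q.1 <= q'.1.
  move=> W h1 h2 h3 h4 e; have [|/ltW] := leP q.1 q'.1 => ?; first exact: W.
  by apply/esym; apply: W.
move=> q0 q'0 s0 s'0 e.
have [rr'|rr'] := eqVneq q.1 q'.1.
  have ee : circle q.2 = circle q'.2.
    move: e; rewrite /polar rr' => /addrI e.
    by apply: (scalerI (lt0r_neq0 q'0)).
  by move: rr' (circle_inj s0 s'0 ee); case: (q) (q') => [? ?] [? ?] /= -> ->.
have rlt : q.1 < q'.1 by rewrite lt_neqAle rr'.
have : circle q'.2 = polar c (q.1 / q'.1, q.2).
  apply: (scalerI (lt0r_neq0 q'0)); apply/(addrI ((1 - q'.1) *: c)).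
  rewrite -[LHS]/(polar c q') -e /polar /= scalerDr addrA !scalerA.
  rewrite [q'.1 * (q.1 / _)]mulrC divfK ?gt_eqF// -scalerDl; congr (_ *: _ + _).
  by field; rewrite gt_eqF.
move=> /(congr1 sqn); rewrite sqn_circle => /esym/eqP; rewrite lt_eqF//.
by apply: polar_lt1 => //=; rewrite divr_ge0 ?ltW//= ltr_pdivrMr ?mul1r.
Qed.

(** The ray from [c] through [p] meets the circle at c + t (p - c) for some t > 1, by the
    intermediate value theorem; the radial coordinate of [p] is then 1/t. *)
Lemma polar_surj c p : sqn c < 1 -> sqn p < 1 -> p != c ->
  exists q, [/\ 0 < q.1 < 1, 0 <= q.2 < 1 & polar c q = p].
Proof.
move=> c1 p1 pc.
pose w := p - c; pose g (t : R) := sqn (c + t *: w).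
have w0 : 0 < sqn w.
  by apply: lt_le_trans (sqn_ge _); rewrite exprn_gt0// normr_gt0 subr_eq0.
have gE t : g t = t ^+ 2 * sqn w + 2 * t * dotp c w + sqn c.
  by rewrite /g /sqn /dotp /= -![_ *: _]/(_ * _); ring.
(* Chosen so that T^2 [sqn w] >= 8, which brings the ray out of the disk at time [T]. *)
pose T := 2 + 2 / sqn w.
have T1 : 1 <= T.
  have : 0 < 2 / sqn w by rewrite divr_gt0.
  by rewrite /T; lra.
have gT : 1 <= g T.
  have h1 : 8 <= T ^+ 2 * sqn w.
    have -> : T ^+ 2 * sqn w = 4 * sqn w + 8 + 4 / sqn w.
      by rewrite /T; field; rewrite gt_eqF.
    have : 0 < 4 / sqn w by rewrite divr_gt0.
    by lra.
  have h2 : 0 <= sqn (2 *: c + T *: w) by exact: sqn_ge0.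
  have h3 : sqn (2 *: c + T *: w) = 2 * g T + 2 * sqn c - T ^+ 2 * sqn w.
    rewrite gE /sqn /dotp /= -![_ *: _]/(_ * _); ring.
  by have := sqn_ge0 c; lra.
have gc : {within `[1, T]%classic, continuous g}.
  apply: continuous_subspaceT => t.
  have -> : g = (fun t => t ^+ 2 * sqn w + 2 * t * dotp c w + sqn c) by apply/funext.
  apply: cvgD; last exact: cvg_cst.
  apply: cvgD; apply: cvgM; try exact: cvg_cst; first exact: exprn_continuous.
  by apply: cvgM; [exact: cvg_cst|exact: cvg_id].
have g1 : g 1 < 1 by rewrite /g scale1r addrC subrK.
have [|t tT gt1] := @IVT _ g 1 T 1 T1 gc.
  by rewrite ge_min le_max (ltW g1) gT orbT.
move: tT; rewrite in_itv /= => /andP[t1 tT].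
have {}t1 : 1 < t.
  rewrite lt_neqAle t1 andbT; apply/negP => /eqP e.
  by move: gt1 g1; rewrite -e => ->; rewrite ltxx.
have t0 : 0 < t by lra.
have [s s01 se] := circle_surj gt1.
exists (t^-1, s); split => //=; first by rewrite invr_gt0 t0 invf_lt1.
rewrite /polar /= se scalerDr scalerA mulVf ?gt_eqF// scale1r addrA -scalerDl subrK scale1r.
by rewrite addrC subrK.
Qed.

Definition circle' (s : R) : R * R := (- (2 * pi) * sin (2 * pi * s), 2 * pi * cos (2 * pi * s)).

Lemma lipschitz_of_derive (f df : R -> R) (K : R) (a b : R) :
  (forall x : R, is_derive x 1 f (df x)) -> (forall x, `|x - a| <= `|b - a| -> `|df x| <= K) ->
  `|f b - f a| <= K * `|b - a|.
Proof.
move=> fd dK.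
have cf (x : R) : {for x, continuous f}.
  by apply: differentiable_continuous; apply/derivable1_diffP; case: (fd x).
have [ab|/ltW ab] := leP a b.
  have [|c cab ->] := @MVT_segment R f df a b ab (fun x _ => fd x).
    by apply: continuous_subspaceT => x; exact: cf.
  rewrite normrM ler_wpM2r//; apply: dK; move: cab; rewrite in_itv /= => /andP[? ?].
  by rewrite !ger0_norm; lra.
have [|c cab e] := @MVT_segment R f df b a ab (fun x _ => fd x).
  by apply: continuous_subspaceT => x; exact: cf.
rewrite distrC (distrC b) e normrM ler_wpM2r//; apply: dK; move: cab; rewrite in_itv /= => /andP[? ?].
by rewrite !ler0_norm; lra.
Qed.

Lemma sin_lip (a b : R) : `|sin b - sin a| <= `|b - a|.
Proof.
rewrite -[leRHS]mul1r; apply: (@lipschitz_of_derive _ cos) => x _.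
by rewrite ler_norml cos_geN1 cos_le1.
Qed.

Lemma cos_taylor (a b : R) : `|cos b - cos a + (b - a) * sin a| <= (b - a) ^+ 2.
Proof.
have := @lipschitz_of_derive (fun x => cos x + x * sin a) (fun x => - sin x + sin a) `|b - a| a b.
have -> : cos b + b * sin a - (cos a + a * sin a) = cos b - cos a + (b - a) * sin a by ring.
rewrite -expr2 norm_sqr; apply => x.
  by apply: is_derive_eq; rewrite scaler0 add0r -[_%:A]/(sin a * 1) mulr1.
by move=> h; rewrite addrC distrC; apply: le_trans (sin_lip _ _) h.
Qed.

Lemma sin_taylor (a b : R) : `|sin b - sin a - (b - a) * cos a| <= (b - a) ^+ 2.
Proof.
have := cos_taylor (a - pi / 2) (b - pi / 2).
rewrite !cosBpihalf sinBpihalf mulrN.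
by have -> : b - pi / 2 - (a - pi / 2) = b - a by ring.
Qed.

End Polar.

(** * Argument principle on the disk *)

Section Argument.
Context {R : realType}.
Implicit Types (p q c A B : R * R).

Lemma cos_lip (a b : R) : `|cos b - cos a| <= `|b - a|.
Proof.
rewrite -!(sinDpihalf); have := sin_lip (a + pi / 2) (b + pi / 2).
by have -> : b + pi / 2 - (a + pi / 2) = b - a by ring.
Qed.

Lemma circle_lip (s t : R) : `|circle t - circle s| <= 2 * pi * `|t - s|.
Proof.
have e : 2 * pi * `|t - s| = `|2 * pi * t - 2 * pi * s|.
  by rewrite -mulrBr normrM (ger0_norm (mulr_ge0 _ (pi_ge0 R))).
by rewrite e prod_normE ge_max /= cos_lip sin_lip.
Qed.

Lemma circle_taylor (s t : R) :
  `|circle t - circle s - (t - s) *: circle' s| <= (2 * pi * (t - s)) ^+ 2.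
Proof.
have e : 2 * pi * (t - s) = 2 * pi * t - 2 * pi * s by rewrite mulrBr.
rewrite prod_normE ge_max e; apply/andP; split.
  apply: le_trans (cos_taylor _ _); rewrite /= -[_ *: _]/(_ * _).
  by rewrite le_eqVlt; apply/orP; left; apply/eqP; congr `|_|; ring.
apply: le_trans (sin_taylor _ _); rewrite /= -[_ *: _]/(_ * _).
by rewrite le_eqVlt; apply/orP; left; apply/eqP; congr `|_|; ring.
Qed.

Lemma has_columns_polar c q :
  has_columns (polar c) q (circle q.2 - c) (q.1 *: circle' q.2).
Proof.
move=> e e0; pose C := 2 * pi + `|q.1| * (2 * pi) ^+ 2.
have pi0 := @pi_gt0 R.
have C0 : 0 < C by rewrite ltr_pwDl ?mulr_gt0// mulr_ge0// sqr_ge0.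
exists (e / C); rewrite ?divr_gt0// => q' qq'.
have h1 := norm_fst_le (q' - q); have h2 := norm_snd_le (q' - q).
have -> : polar c q' - polar c q - ((q'.1 - q.1) *: (circle q.2 - c) + (q'.2 - q.2) *: (q.1 *: circle' q.2))
  = (q'.1 - q.1) *: (circle q'.2 - circle q.2) + q.1 *: (circle q'.2 - circle q.2 - (q'.2 - q.2) *: circle' q.2).
  rewrite /polar; apply/eqP; rewrite -pair_eqE; apply/andP; split; apply/eqP => /=;
    rewrite -![_ *: _]/(_ * _); ring.
apply: (@le_trans _ _ (C * `|q' - q| ^+ 2)); last first.
  by rewrite expr2 mulrA ler_wpM2r// mulrC -ler_pdivlMr// ltW.
apply: (le_trans (ler_normD _ _)); rewrite mulrDl !normrZ; apply: lerD.
  apply: (@le_trans _ _ (`|q' - q| * (2 * pi * `|q' - q|))); last by rewrite expr2; lra.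
  apply: ler_pM => //; apply: (le_trans (circle_lip _ _)).
  by rewrite ler_wpM2l// mulr_ge0// ltW.
rewrite -mulrA ler_wpM2l//; apply: (le_trans (circle_taylor _ _)).
rewrite exprMn ler_wpM2l ?sqr_ge0// -norm_sqr.
by rewrite lerXn2r// nnegrE.
Qed.

Lemma columns_le A B p : `|p.1 *: A + p.2 *: B| <= (`|A| + `|B|) * `|p|.
Proof.
apply: (le_trans (ler_normD _ _)); rewrite !normrZ mulrDl.
apply: lerD; rewrite mulrC; apply: ler_wpM2l => //; [exact: norm_fst_le|exact: norm_snd_le].
Qed.

(** Chain rule: the new columns are the images of the columns of [F] under the linear part of
    [G]. *)
Lemma has_columns_comp (F G : R * R -> R * R) q A B A' B' :
  has_columns F q A B -> has_columns G (F q) A' B' ->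
  has_columns (G \o F) q (A.1 *: A' + A.2 *: B') (B.1 *: A' + B.2 *: B').
Proof.
move=> hF hG e e0.
pose M := `|A| + `|B|; pose M' := `|A'| + `|B'|.
have M0 : 0 <= M by rewrite addr_ge0.
have M'0 : 0 <= M' by rewrite addr_ge0.
pose e2 := Num.min 1 (e / (2 * (M' + 1))); pose e1 := e / (2 * (M + 1)).
have e20 : 0 < e2 by rewrite lt_min ltr01/= divr_gt0//; lra.
have e10 : 0 < e1 by rewrite divr_gt0//; lra.
have [d1 d10 d1P] := hG _ e10; have [d2 d20 d2P] := hF _ e20.
exists (Num.min d2 (d1 / (M + 1))); first by rewrite lt_min d20 divr_gt0//; lra.
move=> q'; rewrite lt_min => /andP[q'1 q'2] /=.
pose r := F q' - F q - ((q'.1 - q.1) *: A + (q'.2 - q.2) *: B).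
have rle : `|r| <= e2 * `|q' - q| by exact: d2P.
have e21 : e2 <= 1 by rewrite ge_min lexx.
have Fle : `|F q' - F q| <= (M + 1) * `|q' - q|.
  rewrite -(subrK ((q'.1 - q.1) *: A + (q'.2 - q.2) *: B) (F q' - F q)) -/r.
  apply: (le_trans (ler_normD _ _)); rewrite addrC mulrDl; apply: lerD.
    exact: (columns_le A B (q' - q)).
  by apply: (le_trans rle); rewrite ler_wpM2r.
have Fd : `|F q' - F q| < d1.
  by apply: (le_lt_trans Fle); rewrite mulrC -ltr_pdivlMr//; lra.
have := d1P _ Fd; set G0 := G (F q') - G (F q) - _ => Gle.
have -> : G (F q') - G (F q) - ((q'.1 - q.1) *: (A.1 *: A' + A.2 *: B') + (q'.2 - q.2) *: (B.1 *: A' + B.2 *: B'))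
   = G0 + (r.1 *: A' + r.2 *: B').
  rewrite /G0 /r; apply/eqP; rewrite -pair_eqE; apply/andP; split; apply/eqP => /=;
    rewrite -![_ *: _]/(_ * _); ring.
apply: (le_trans (ler_normD _ _)).
have -> : e * `|q' - q| = e1 * ((M + 1) * `|q' - q|) + (M' + 1) * (e / (2 * (M' + 1)) * `|q' - q|).
  rewrite /e1; field; rewrite !gt_eqF//; lra.
apply: lerD; first by apply: (le_trans Gle); rewrite ler_wpM2l// ltW.
apply: (le_trans (columns_le _ _ _)); rewrite -/M'; apply: ler_pM => //; first lra.
by apply: (le_trans rle); rewrite ler_wpM2r// ge_min lexx orbT.
Qed.

Lemma has_columns_differentiable (H : R * R -> R * R) p : differentiable H p ->
  has_columns H p ('D_(1, 0) H p) ('D_(0, 1) H p).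
Proof.
move=> dH e e0.
have := diff_locally dH => /eqaddoP /(_ e e0) /nbhs_ballP[d /= d0 dP].
exists d => // q qd; have := dP (q - p); rewrite -ball_normE /= sub0r normrN => /(_ qd).
move=> h; apply: le_trans h; rewrite fctE /= subrK !deriveE// -!linearZ -linearD /=.
have -> : (q.1 - p.1) *: (1, 0) + (q.2 - p.2) *: (0, 1) = q - p :> R * R.
  apply/eqP; rewrite -pair_eqE; apply/andP; split; apply/eqP => /=;
    rewrite -![_ *: _]/(_ * _); ring.
by rewrite opprD addrA.
Qed.

(** If the solution set were infinite, the filter of sets missing only finitely many solutions would
    cluster at a point of [K]. Isolation excludes this at a solution, and continuity excludes it
    elsewhere. *)
Lemma isolated_zeros_finite (K : set (R * R)) (H : R * R -> R * R) (z : R * R) :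
  compact K -> {within K, continuous H} ->
  (forall p, K p -> H p = z -> exists2 r, 0 < r &
     forall q, `|q - p| < r -> q != p -> H q != z) ->
  finite_set (K `&` H @^-1` [set z]).
Proof.
move=> cK cH iso.
have uH := heine_cantor cK cH.
have loc p : exists r, 0 < r /\ (K p -> forall q, K q -> `|q - p| < r -> q != p -> H q != z).
  have [Kp|nKp] := pselect (K p); last by exists 1.
  have [Hp|Hp] := eqVneq (H p) z.
    by have [r r0 rP] := iso p Kp Hp; exists r; split => // _ q _; exact: rP.
  have [|r r0 rP] := uH `|H p - z|; first by rewrite normr_gt0 subr_eq0.
  exists r; split => // _ q Kq qp _; apply/eqP => Hq.
  by have := rP p q Kp Kq; rewrite distrC Hq ltxx => /(_ qp).
have [r rP] := choice loc.
apply: contrapT => nfin; set S := K `&` _ in nfin.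
pose F : set_system (R * R) := fun (B : set (R * R)) => finite_set (S `\` B).
have FF : ProperFilter F.
  split; first by rewrite /F setD0.
  split.
  - by rewrite /F setDT; exact: finite_set0.
  - by move=> P Q FP FQ; rewrite /F setDIr finite_setU.
  - by move=> P Q PQ; apply: sub_finite_set => x [Sx nQ]; split => // /PQ.
have FK : F K by rewrite /F (_ : S `\` K = set0)//; apply/seteqP; split => // x [[Kx _] nK].
have [p [Kp clp]] := cK F FF FK.
have [r0 /(_ Kp) rP'] := rP p.
have Fp : F (S `\` [set p]).
  apply: (@sub_finite_set _ _ [set p]); last exact: finite_set1.
  by move=> x [Sx nx]; apply: contrapT => xp; apply: nx.
have [q [[[Kq Hq] qp]]] := clp _ _ Fp (nbhsx_ballx p (r p) r0).
rewrite -ball_normE /= distrC => qb.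
have qnp : q != p by apply/eqP => e; exact: qp.
by have := rP' q Kq qb qnp; rewrite Hq eqxx.
Qed.

Lemma cross_lin A B a b :
  cross (a.1 *: A + a.2 *: B) (b.1 *: A + b.2 *: B) = cross A B * cross a b.
Proof. by rewrite /cross /= -![_ *: _]/(_ * _); ring. Qed.

(** The Jacobian of the polar map is 2 pi r (1 - <c, u>) with u on the circle, positive since [c] is
    interior; so pulling back by [polar] preserves the signs of Jacobians. *)
Lemma cross_polar c q : sqn c < 1 -> 0 < q.1 ->
  0 < cross (circle q.2 - c) (q.1 *: circle' q.2).
Proof.
move=> c1 q0.
have -> : cross (circle q.2 - c) (q.1 *: circle' q.2) =
  q.1 * (2 * pi) * (sqn (circle q.2) - dotp c (circle q.2)).
  by rewrite /cross /circle' /circle /sqn /dotp /= -![_ *: _]/(_ * _); ring.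
rewrite mulr_gt0// ?mulr_gt0// ?pi_gt0// subr_gt0.
have : 0 <= sqn (c - circle q.2) by exact: sqn_ge0.
have -> : sqn (c - circle q.2) = sqn c + sqn (circle q.2) - 2 * dotp c (circle q.2).
  by rewrite /sqn /dotp /=; ring.
by rewrite sqn_circle; lra.
Qed.

Lemma unif_cont_circle (A : set R) : unif_cont_on A circle.
Proof.
move=> e e0; exists (e / (2 * pi)); first by rewrite divr_gt0// mulr_gt0// pi_gt0.
move=> x y _ _ xy; apply: (le_lt_trans (circle_lip _ _)).
by rewrite mulrC -ltr_pdivlMr// mulr_gt0// pi_gt0.
Qed.

Lemma unif_cont_polar c : unif_cont_on unit_square (polar c).
Proof.
move=> e e0; pose C := 1 + `|c| + 1 + 2 * pi.
have pi0 := @pi_gt0 R; have c0 := normr_ge0 c.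
have C0 : 0 < C by rewrite /C; lra.
exists (e / C); first by rewrite divr_gt0.
move=> x y [_ _] [y1 y2] xy.
have -> : polar c x - polar c y = (x.1 - y.1) *: (circle x.2 - c) + y.1 *: (circle x.2 - circle y.2).
  rewrite /polar; apply/eqP; rewrite -pair_eqE; apply/andP; split; apply/eqP => /=;
    rewrite -![_ *: _]/(_ * _); ring.
have h1 := norm_fst_le (x - y); have h2 := norm_snd_le (x - y).
apply: (@le_lt_trans _ _ (C * `|x - y|)); last by rewrite mulrC -ltr_pdivlMr.
apply: (le_trans (ler_normD _ _)); rewrite !normrZ /C mulrDl; apply: lerD.
  rewrite mulrC; apply: ler_pM => //.
  apply: (le_trans (ler_normB _ _)).
  have : `|circle x.2| <= 1.
    by rewrite -(@expr_le1 _ 2)//; apply: (le_trans (sqn_ge _)); rewrite sqn_circle.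
  by lra.
have y11 : `|y.1| <= 1 by move: y1; rewrite /= in_itv /= ler_norml; lra.
rewrite -[leRHS]mul1r; apply: ler_pM => //.
apply: (le_trans (circle_lip _ _)); rewrite distrC ler_wpM2l//; first by rewrite mulr_ge0// ltW.
by rewrite distrC.
Qed.

Lemma fset_seq_choice (T : Type) (U : eqType) (s : seq U) (P : U -> T -> Prop) :
  (forall x, x \in s -> exists y, P x y) -> T -> exists g, forall x, x \in s -> P x (g x).
Proof.
move=> h t0.
have h' x : exists y, x \in s -> P x y.
  by have [/h[y Py]|xs] := boolP (x \in s); [exists y|exists t0].
by have [g gP] := choice h'; exists g.
Qed.

Lemma has_columns_subc (F : R * R -> R * R) q A B (z : R * R) :
  has_columns F q A B -> has_columns (fun x => F x - z) q A B.
Proof.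
move=> hF e /hF[d d0 dP]; exists d => // x /dP; apply: le_trans.
by rewrite opprB addrA subrK.
Qed.

(* The argument principle. *)
Lemma degree_turns (H : R * R -> R * R) (z : R * R) :
  {within closure unit_disk, continuous H} ->
  (forall p, unit_disk p -> H p = z -> differentiable H p /\ jacobian2 H p != 0) ->
  (forall s, H (circle s) != z) ->
  exists N, forall n, (N <= n)%N ->
    turns n (fun s => H (circle s) - z) =
    \sum_(p \in unit_disk `&` H @^-1` [set z]) sgz (jacobian2 H p).
Proof.
move=> cH reg bd.
set S := unit_disk `&` H @^-1` [set z].
have SE : S = closure unit_disk `&` H @^-1` [set z].
  rewrite /S closure_unit_disk unit_diskE; apply/seteqP; split => p /= [h1 h2]; split => //=.
    exact: ltW.
  rewrite lt_neqAle h1 andbT; apply/eqP => /circle_surj [s _ sp].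
  by have := bd s; rewrite sp h2 eqxx.
have finS : finite_set S.
  rewrite SE; apply: isolated_zeros_finite => //; first exact: compact_closed_disk.
  move=> p pD Hp; have [pD' _] : S p by rewrite SE.
  have [dH jH] := reg p pD' Hp.
  have hc := has_columns_differentiable dH.
  have hc' : has_columns (fun q => H q - z) p ('D_(1, 0) H p) ('D_(0, 1) H p).
    exact: has_columns_subc.
  have jH' : cross ('D_(1, 0) H p) ('D_(0, 1) H p) != 0.
    by move: jH; rewrite /jacobian2 /cross [X in _ - X]mulrC.
  have [|r r0 rP] := columns_dominate jH' _ hc'; first by rewrite Hp subrr.
  exists r => // q qr qp; apply/eqP => Hq.
  by have := rP q (ltW qr) qp; rewrite Hq subrr /dotp /= !mulr0 addr0 ltxx.
rewrite fsbig_finite//; set zs : seq _ := finmap.enum_fset _.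
have zsP p : (p \in zs) = (p \in S).
  exact: (in_fset_set finS p).
have [t t0 tP] : exists2 t : R, 0 < t & forall t', 0 < t' <= t -> forall p, p \in zs -> p.1 < 1 - t'.
  apply: (@seq_small _ _ zs (fun p t => p.1 < 1 - t)) => p.
  rewrite zsP inE => -[+ _]; rewrite unit_diskE => p1.
  have : p.1 < 1.
    rewrite ltNge; apply/negP => h; move: p1; rewrite /= ltNge => /negP; apply.
    by rewrite /sqn -[leLHS]addr0 lerD ?sqr_ge0// exprn_ege1.
  by exists ((1 - p.1) / 2); [lra|move=> t /andP[t0 t1]; lra].
pose t' := Num.min t 1.
have t'0 : 0 < t' by rewrite lt_min t0 ltr01.
have t'1 : t' <= 1 by rewrite ge_min lexx orbT.
have zst p : p \in zs -> p.1 < 1 - t'.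
  by apply: tP; rewrite t'0 ge_min lexx.
(* The centre lies on the first axis, to the right of every zero. So no zero is at the centre or on
   the cut from [c] to (1, 0), and all zeros have polar coordinates in the open square. *)
pose c : R * R := (1 - t', 0).
have c1 : sqn c < 1.
  by rewrite /sqn /= expr0n addr0 expr_lt1//; lra.
have [g gP] : exists g : R * R -> R * R, forall p, p \in zs ->
    [/\ 0 < (g p).1 < 1, 0 < (g p).2 < 1 & polar c (g p) = p].
  apply: (@fset_seq_choice (R * R)%type _ zs (fun p q => [/\ 0 < q.1 < 1, 0 < q.2 < 1 & polar c q = p])) => [p pz|]; last exact: (0, 0).
  have pc : p != c by apply: contraTneq (zst p pz) => ->; rewrite /= ltxx.
  have p1 : sqn p < 1 by move: pz; rewrite zsP inE => -[]; rewrite unit_diskE.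
  have [q [q1 /andP[q2 q2'] qp]] := polar_surj c1 p1 pc.
  exists q; split => //; rewrite q2' andbT lt_neqAle q2 andbT eq_sym.
  apply: contraTneq (zst p pz) => q20; rewrite -leNgt -qp polarE /= q20 mulr0 cos0.
  have : 0 <= q.1 * t' by rewrite mulr_ge0//; lra.
  by lra.
pose Psi q := H (polar c q) - z.
pose A p := let q := p in (circle q.2 - c).1 *: 'D_(1, 0) H (polar c q) + (circle q.2 - c).2 *: 'D_(0, 1) H (polar c q).
pose B q := (q.1 *: circle' q.2).1 *: 'D_(1, 0) H (polar c q) + (q.1 *: circle' q.2).2 *: 'D_(0, 1) H (polar c q).
have polarD q : unit_square q -> closure unit_disk (polar c q).
  move=> [q1 _]; rewrite closure_unit_disk /=; apply: polar_le1; first exact: ltW.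
  by move: q1; rewrite /= in_itv.
have uPsi : unif_cont_on unit_square Psi.
  apply: unif_cont_subc; apply: (unif_cont_comp (f := polar c) (g := H) polarD).
    exact: unif_cont_polar.
  by apply: heine_cantor => //; exact: compact_closed_disk.
have inj_g : {in zs &, injective g}.
  by move=> p p' pz pz' e; have [_ _ <-] := gP p pz; have [_ _ <-] := gP p' pz'; rewrite e.
have jE q : cross (A q) (B q) = jacobian2 H (polar c q) * cross (circle q.2 - c) (q.1 *: circle' q.2).
  by rewrite /A /B cross_lin /jacobian2 /cross [X in (_ - X) * _]mulrC.
have [|q qQ Psi0|q /mapP[p pz ->]|N NP] := @square_degree R Psi A B [seq g p | p <- zs] uPsi.
- by rewrite map_inj_in_uniq ?finmap.fset_uniq.
- have Hq : H (polar c q) = z by apply/eqP; rewrite -subr_eq0; apply/eqP.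
  have Sq : S (polar c q) by rewrite SE; split => //; exact: polarD.
  have pz : polar c q \in zs by rewrite zsP inE.
  case: qQ => /=; rewrite !in_itv /= => /andP[q10 q11] /andP[q20 q21].
  have off : (circle q.2).1 != 1.
    apply: contraTneq (zst _ pz) => e; rewrite -leNgt polarE e /=.
    have : 0 <= q.1 * t' by rewrite mulr_ge0//; lra.
    by lra.
  have {}q10 : 0 < q.1.
    rewrite lt_neqAle q10 andbT eq_sym; apply: contraTneq (zst _ pz) => e.
    by rewrite -leNgt polarE /= e; lra.
  have {}q21 : 0 <= q.2 < 1.
    rewrite q20 lt_neqAle q21 andbT; apply: contra_neq off => ->.
    by rewrite circle1.
  apply/mapP; exists (polar c q) => //.
  have [/andP[g10 _] /andP[g20 g21] gp] := gP _ pz.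
  by apply/esym; apply: (polar_inj c1) => //; rewrite g21 ltW.
- have [g1 g2 gp] := gP p pz.
  have : S p by apply: set_mem; rewrite -zsP.
  move=> [pD pz']; have [dH jH] := reg p pD pz'.
  have {}pz' : H p = z by [].
  split => //.
  + by rewrite /Psi gp pz' subrr.
  + rewrite jE gp mulf_neq0// gt_eqF//; apply: cross_polar => //.
    by case/andP: g1.
  + apply: has_columns_subc.
    have hc := has_columns_differentiable dH; rewrite -[X in has_columns _ X _ _]gp in hc.
    have := has_columns_comp (has_columns_polar c (g p)) hc.
    by rewrite /A /B gp.
exists (maxn N 1) => n; rewrite geq_max => /andP[Nn n0].
have := NP n Nn; rewrite big_map.
have -> : \sum_(p <- zs) sgz (cross (A (g p)) (B (g p))) = \sum_(p <- zs) sgz (jacobian2 H p).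
  apply: eq_big_seq => p pz; have [g1 _ gp] := gP p pz.
  rewrite jE gp sgzM [X in _ * X](_ : _ = 1) ?mulr1//.
  by rewrite gtr0_sgz//; apply: cross_polar => //; case/andP: g1.
move=> <-.
have nn : n%:R / n%:R = 1 :> R by rewrite divff// pnatr_eq0 -lt0n.
(* The left side of the square goes to the centre, and the bottom and top sides both go to the cut
   and cancel; only the right side, the unit circle, remains. *)
have left0 : \sum_(0 <= j < n) crossing (Psi (grid_pt n 0 j)) (Psi (grid_pt n 0 j.+1)) = 0.
  rewrite big1// => j _; have e k : Psi (grid_pt n 0 k) = H c - z.
    by rewrite /Psi /grid_pt mul0r /polar /= subr0 scale1r scale0r addr0.
  by rewrite !e crossingxx.
have topbot : \sum_(0 <= i < n) crossing (Psi (grid_pt n i n)) (Psi (grid_pt n i.+1 n)) =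
   \sum_(0 <= i < n) crossing (Psi (grid_pt n i 0)) (Psi (grid_pt n i.+1 0)).
  apply: eq_bigr => i _; have e k : Psi (grid_pt n k n) = Psi (grid_pt n k 0).
    by rewrite /Psi /grid_pt mul0r nn /polar /= circle0 circle1.
  by rewrite !e.
rewrite left0 topbot subr0 addrC addKr /turns; apply: eq_bigr => j _.
have e k : Psi (grid_pt n n k) = H (circle (k%:R / n%:R)) - z.
  by rewrite /Psi /grid_pt nn /polar /= subrr scale0r add0r scale1r.
by rewrite !e.
Qed.

End Argument.

(** * Quadratic splines and maps with quadratic Taylor remainder *)

Definition columns {R : realType} (A B q : R * R) : R * R := q.1 *: A + q.2 *: B.

Lemma columns_is_linear {R : realType} (A B : R * R) : linear (columns A B).
Proof.
move=> k u v; rewrite /columns; apply/eqP; rewrite -pair_eqE; apply/andP; split;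
  apply/eqP => /=; rewrite -![_ *: _]/(_ * _); ring.
Qed.

HB.instance Definition _ {R : realType} (A B : R * R) :=
  GRing.isLinear.Build R (R * R)%type (R * R)%type _ (columns A B) (columns_is_linear A B).

Section Splines.
Context {R : realType}.
Implicit Types (p q : R * R).

Lemma columns_continuous (A B : R * R) : continuous (columns A B).
Proof.
move=> q; apply: cvgD; apply: cvgZr_tmp.
  exact: (@cvg_fst _ _ (nbhs q.1) (nbhs q.2)).
exact: (@cvg_snd _ _ (nbhs q.1) (nbhs q.2)).
Qed.

(** Converse of [has_columns_differentiable]: [columns A B] is linear and continuous with the right
    remainder, and differentials are unique. *)
Lemma differentiable_columns (H : R * R -> R * R) p A B : has_columns H p A B ->
  differentiable H p /\ 'd H p = columns A B :> (R * R -> R * R).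
Proof.
move=> hc.
have E : H \o shift p = cst (H p) + columns A B +o_ (0 : R * R) id.
  apply/eqaddoP => e /hc[d d0 dP]; apply/nbhs_ballP; exists d => //= h.
  rewrite -ball_normE /= sub0r normrN => hd; have := dP (h + p).
  by rewrite addrK => /(_ hd); rewrite !fctE /= !addrK /columns (opprD (H p)) addrA.
have dE := diff_unique (@columns_continuous A B) E.
split=> //; apply/diff_locallyP; rewrite dE; split => //; exact: columns_continuous.
Qed.

(** A C^1 function with gradient (a, b), with bounds and Taylor remainder uniform on the whole
    plane. The class is stable under sums and products, and the quadratic remainder is what [sard]
    uses. *)
Definition quadratic_C1 (F : R * R -> R) := exists a b : R * R -> R, exists C : R,
  [/\ continuous a, continuous b,
      forall p, [/\ `|F p| <= C, `|a p| <= C & `|b p| <= C] &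
      forall p q, `|F q - F p - ((q.1 - p.1) * a p + (q.2 - p.2) * b p)| <=
        C * `|q - p| ^+ 2].

Lemma quadratic_C1_cst (k : R) : quadratic_C1 (fun=> k).
Proof.
exists (fun=> 0), (fun=> 0), `|k|; split; try by move=> p; exact: cvg_cst.
  by move=> p; rewrite normr0.
by move=> p q; rewrite !mulr0 addr0 subrr subr0 normr0 mulr_ge0// sqr_ge0.
Qed.

Lemma quadratic_C1D (F G : R * R -> R) :
  quadratic_C1 F -> quadratic_C1 G -> quadratic_C1 (fun p => F p + G p).
Proof.
move=> [a [b [C [ca cb bd q]]]] [a' [b' [C' [ca' cb' bd' q']]]].
exists (fun p => a p + a' p), (fun p => b p + b' p), (C + C'); split.
- by move=> p; apply: cvgD; [exact: ca|exact: ca'].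
- by move=> p; apply: cvgD; [exact: cb|exact: cb'].
- move=> p; have [h1 h2 h3] := bd p; have [h1' h2' h3'] := bd' p.
  by split; apply: (le_trans (ler_normD _ _)); exact: lerD.
- move=> p x; rewrite [leRHS]mulrDl.
  apply: le_trans (lerD (q p x) (q' p x)); apply: le_trans (ler_normD _ _).
  by rewrite le_eqVlt; apply/orP; left; apply/eqP; congr `|_|; ring.
Qed.

Lemma quadratic_C1_sum (I : Type) (r : seq I) (F : I -> R * R -> R) :
  (forall i, quadratic_C1 (F i)) -> quadratic_C1 (fun p => \sum_(i <- r) F i p).
Proof.
move=> qF; elim: r => [|i r IH].
  under eq_fun do rewrite big_nil; exact: quadratic_C1_cst.
under eq_fun do rewrite big_cons; exact: quadratic_C1D.
Qed.

(** Beyond the product rule, the remainder contains the product of the two increments. It is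
    quadratic because both factors are Lipschitz: by Taylor at distance up to 1, by boundedness
    beyond. *)
Lemma quadratic_C1M (F G : R * R -> R) :
  quadratic_C1 F -> quadratic_C1 G -> quadratic_C1 (fun p => F p * G p).
Proof.
move=> [a [b [C [ca cb bd qF]]]] [a' [b' [C' [ca' cb' bd' qG]]]].
have C0 : 0 <= C by have [h _ _] := bd 0; apply: le_trans h.
have C'0 : 0 <= C' by have [h _ _] := bd' 0; apply: le_trans h.
have lip (F0 a0 b0 : R * R -> R) (K : R) : 0 <= K ->
  (forall p, [/\ `|F0 p| <= K, `|a0 p| <= K & `|b0 p| <= K]) ->
  (forall p q, `|F0 q - F0 p - ((q.1 - p.1) * a0 p + (q.2 - p.2) * b0 p)| <= K * `|q - p| ^+ 2) ->
  forall p q, `|F0 q - F0 p| <= 3 * K * `|q - p|.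
  move=> K0 bd0 q0 p q; have [Fp ap bp] := bd0 p; have [Fq _ _] := bd0 q.
  have [le1|gt1] := leP `|q - p| 1.
    have e : F0 q - F0 p = (F0 q - F0 p - ((q.1 - p.1) * a0 p + (q.2 - p.2) * b0 p))
       + ((q.1 - p.1) * a0 p + (q.2 - p.2) * b0 p) by rewrite subrK.
    rewrite e; apply: (le_trans (ler_normD _ _)).
    have h1 : K * `|q - p| ^+ 2 <= K * `|q - p| by rewrite ler_wpM2l// expr2 ler_piMr.
    have h2 : `|(q.1 - p.1) * a0 p| <= `|q - p| * K.
      by rewrite normrM; apply: ler_pM => //; exact: (norm_fst_le (q - p)).
    have h3 : `|(q.2 - p.2) * b0 p| <= `|q - p| * K.
      by rewrite normrM; apply: ler_pM => //; exact: (norm_snd_le (q - p)).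
    have := q0 p q; have := ler_normD ((q.1 - p.1) * a0 p) ((q.2 - p.2) * b0 p).
    by lra.
  apply: (le_trans (ler_normB _ _)).
  have : 3 * K * 1 <= 3 * K * `|q - p| by rewrite ler_wpM2l ?mulr_ge0// ltW.
  by lra.
have lF := lip F a b C C0 bd qF; have lG := lip G a' b' C' C'0 bd' qG.
(* 11 = 1 + 1 + 9: one Taylor remainder for each factor, and the product of the Lipschitz constants
   3C and 3C'. *)
exists (fun p => a p * G p + F p * a' p), (fun p => b p * G p + F p * b' p), (11 * (C * C')).
have CC0 : 0 <= C * C' by exact: mulr_ge0.
have contF (F0 a0 b0 : R * R -> R) (K : R) : 0 <= K -> (forall p q, `|F0 q - F0 p| <= 3 * K * `|q - p|) -> continuous F0.
  move=> K0 l p; apply/cvgrPdist_lt => e e0.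
  apply/(@nbhs_ballP R (R * R)%type); exists (e / (3 * K + 1)); first by rewrite /= divr_gt0//; lra.
  move=> q; rewrite -ball_normE /= => pq; rewrite distrC; apply: (le_lt_trans (l _ _)).
  move: pq; rewrite distrC ltr_pdivlMr//; last lra.
  have := normr_ge0 (q - p); lra.
have cF := contF F a b C C0 lF; have cG := contF G a' b' C' C'0 lG.
split.
- by move=> p; apply: cvgD; apply: cvgM; [exact: ca|exact: cG|exact: cF|exact: ca'].
- by move=> p; apply: cvgD; apply: cvgM; [exact: cb|exact: cG|exact: cF|exact: cb'].
- move=> p; have [h1 h2 h3] := bd p; have [h1' h2' h3'] := bd' p.
  have m (x y : R) : `|x| <= C -> `|y| <= C' -> `|x * y| <= C * C'.
    by move=> ? ?; rewrite normrM; exact: ler_pM.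
  have m1 := m _ _ h1 h1'; have m2 := m _ _ h2 h1'; have m3 := m _ _ h1 h2'.
  have m4 := m _ _ h3 h1'; have m5 := m _ _ h1 h3'.
  split; first lra; apply: (le_trans (ler_normD _ _)); lra.
- move=> p x; have [h1 h2 h3] := bd p; have [h1' h2' h3'] := bd' p.
  have -> : F x * G x - F p * G p - ((x.1 - p.1) * (a p * G p + F p * a' p) + (x.2 - p.2) * (b p * G p + F p * b' p)) =
    (F x - F p - ((x.1 - p.1) * a p + (x.2 - p.2) * b p)) * G p +
    F p * (G x - G p - ((x.1 - p.1) * a' p + (x.2 - p.2) * b' p)) +
    (F x - F p) * (G x - G p) by ring.
  apply: (le_trans (ler_normD _ _)); apply: (le_trans (lerD (ler_normD _ _) (lexx _))).
  rewrite !normrM.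
  have k1 := ler_pM (normr_ge0 _) (normr_ge0 _) (qF p x) h1'.
  have k2 := ler_pM (normr_ge0 _) (normr_ge0 _) h1 (qG p x).
  have k3 := ler_pM (normr_ge0 _) (normr_ge0 _) (lF p x) (lG p x).
  have -> : 11 * (C * C') * `|x - p| ^+ 2 = C * `|x - p| ^+ 2 * C' + C * (C' * `|x - p| ^+ 2) + 3 * C * `|x - p| * (3 * C' * `|x - p|) by ring.
  by apply: lerD => //; exact: lerD.
Qed.

(* [pos_sq] is the truncated square, the basic spline of degree 2. *)
Definition pos_part (t : R) := Num.max 0 t.
Definition pos_sq (t : R) := pos_part t ^+ 2.

Lemma pos_sq_taylor (s t : R) :
  `|pos_sq t - pos_sq s - (t - s) * (2 * pos_part s)| <= (t - s) ^+ 2.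
Proof.
rewrite /pos_sq /pos_part /Num.max; case: ltP => ht; case: ltP => hs; rewrite ler_norml.
- by have := sqr_ge0 (t - s) => h; apply/andP; split; lra.
- have h : 0 <= - s * t by apply: mulr_ge0; lra.
  have := sqr_ge0 s; have := sqr_ge0 t; have := sqr_ge0 (t - s).
  by move=> h1 h2 h3; apply/andP; split; lra.
- have h : 0 <= s * - t by apply: mulr_ge0; lra.
  have := sqr_ge0 s; have := sqr_ge0 t; have := sqr_ge0 (t - s).
  by move=> h1 h2 h3; apply/andP; split; lra.
- by have := sqr_ge0 (t - s) => h; apply/andP; split; lra.
Qed.

(** The centred quadratic B-spline, half the third difference of [pos_sq]: it is C^1, nonnegative
    and supported in [-3/2, 3/2], and its integer translates sum to 1. [bspline'] is its
    derivative. *)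
Definition bspline (t : R) := 2^-1 * (pos_sq (t + 3/2) - 3 * pos_sq (t + 1/2)
  + 3 * pos_sq (t - 1/2) - pos_sq (t - 3/2)).
Definition bspline' (t : R) := pos_part (t + 3/2) - 3 * pos_part (t + 1/2)
  + 3 * pos_part (t - 1/2) - pos_part (t - 3/2).

Lemma bspline_cases (t : R) : [/\ `|t| >= 3/2, bspline t = 0 & bspline' t = 0] \/
   [/\ `|t| <= 3/2, 0 <= bspline t, bspline t <= 1 & `|bspline' t| <= 3].
Proof.
rewrite /bspline /bspline' /pos_sq /pos_part /Num.max ler_normr !ler_norml.
case: (ltP 0 (t + 3/2)) => h1; case: (ltP 0 (t + 1/2)) => h2;
case: (ltP 0 (t - 1/2)) => h3; case: (ltP 0 (t - 3/2)) => h4; try (exfalso; lra).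
- by left; split; [apply/orP; left; lra|field|lra].
- have u1 : 0 <= (t - 1/2) * (3/2 - t) by apply: mulr_ge0; lra.
  by right; split; [apply/andP; split; lra|nra|nra|lra].
- by right; split; [apply/andP; split; lra|nra|nra|lra].
- by right; split; [apply/andP; split; lra|nra|nra|lra].
- by left; split; [apply/orP; right; lra|field|lra].
Qed.

End Splines.

(** * Uniform approximation by tensor-product splines *)

Section SplineApproximation.
Context {R : realType}.
Implicit Types (p q : R * R).

Lemma bspline_taylor (s t : R) :
  `|bspline t - bspline s - (t - s) * bspline' s| <= 4 * (t - s) ^+ 2.
Proof.
rewrite /bspline /bspline'.
have q (c : R) := pos_sq_taylor (s + c) (t + c).
have e (c : R) : t + c - (s + c) = t - s by ring.
have := q (3/2); have := q (1/2); have := q (- (1/2)); have := q (- (3/2)).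
rewrite !e => h1 h2 h3 h4.
move: h1 h2 h3 h4; rewrite !ler_norml => /andP[a1 b1] /andP[a2 b2] /andP[a3 b3] /andP[a4 b4].
by apply/andP; split; lra.
Qed.

Lemma bspline_bound (t : R) : 0 <= bspline t <= 1 /\ `|bspline' t| <= 3.
Proof.
case: (bspline_cases t) => [[_ -> ->]|[_ -> -> ->]]; last by split.
by rewrite normr0 lexx ler01.
Qed.

Lemma bspline_supp (t : R) : bspline t != 0 -> `|t| <= 3/2.
Proof. by case: (bspline_cases t) => [[_ -> _]|[]]; rewrite ?eqxx. Qed.

(** The third difference is a first difference of the second difference [D], so the sum telescopes
    between a value 0 and a value 1 of [D]. *)
Lemma bspline_sum (t : R) m : 1/2 <= t -> t - m%:R <= - (3/2) ->
  \sum_(0 <= k < m) bspline (t - k%:R) = 1.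
Proof.
move=> t1 t2.
pose D (x : R) := 2^-1 * (pos_sq (x + 3/2) - 2 * pos_sq (x + 1/2) + pos_sq (x - 1/2)).
have step k : bspline (t - k%:R) = (- D (t - k.+1%:R)) - (- D (t - k%:R)).
  rewrite opprK /bspline /D.
  have -> : t - k.+1%:R + 3/2 = t - k%:R + 1/2 by rewrite -natr1; field.
  have -> : t - k.+1%:R + 1/2 = t - k%:R - 1/2 by rewrite -natr1; field.
  have -> : t - k.+1%:R - 1/2 = t - k%:R - 3/2 by rewrite -natr1; field.
  by field.
under eq_bigr do rewrite step.
rewrite (telescope_sumr (fun k => - D (t - k%:R)))// opprK.
have pos (x : R) : 0 <= x -> pos_sq x = x ^+ 2.
  by move=> x0; rewrite /pos_sq /pos_part max_r.
have neg (x : R) : x <= 0 -> pos_sq x = 0.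
  by move=> x0; rewrite /pos_sq /pos_part max_l// expr0n.
have -> : D (t - m%:R) = 0.
  rewrite /D (neg (t - m%:R + 3/2)) ?(neg (t - m%:R + 1/2)) ?(neg (t - m%:R - 1/2)); try lra.
have -> : D (t - 0%:R) = 1; last by rewrite oppr0 add0r.
rewrite /D subr0 (pos (t + 3/2)) ?(pos (t + 1/2)) ?(pos (t - 1/2)); try lra.
Qed.

Lemma bspline'_lip (s t : R) : `|bspline' t - bspline' s| <= 8 * `|t - s|.
Proof.
have pl (c : R) : `|pos_part (t + c) - pos_part (s + c)| <= `|t - s|.
  have A := ler_norm (t - s); have := ler_norm (s - t); rewrite distrC => B.
  rewrite /pos_part /Num.max; case: ltP => h1; case: ltP => h2;
    by rewrite ler_norml; apply/andP; split; lra.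
have := pl (3/2); have := pl (1/2); have := pl (- (1/2)); have := pl (- (3/2)).
set a := `|t - s|; rewrite /bspline' !ler_norml => /andP[a1 b1] /andP[a2 b2] /andP[a3 b3] /andP[a4 b4].
by apply/andP; split; lra.
Qed.

(** The boolean [i] selects the coordinate; products of one function of each kind are the
    tensor-product splines. *)
Lemma quadratic_C1_bspline (k c : R) (i : bool) :
  quadratic_C1 (fun p : R * R => bspline (k * (if i then p.1 else p.2) + c)).
Proof.
pose x p := if i then p.1 else p.2.
pose d p := k * bspline' (k * x p + c).
exists (fun p => if i then d p else 0), (fun p => if i then 0 else d p).
have dx p q : `|x q - x p| <= `|q - p|.
  by rewrite /x; case: (i); [exact: (norm_fst_le (q - p))|exact: (norm_snd_le (q - p))].
have cd : continuous d.
  move=> p; apply/cvgrPdist_lt => e e0.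
  have K0 : 0 < `|k| ^+ 2 * 8 + 1 by rewrite ltr_wpDl// mulr_ge0// sqr_ge0.
  apply/(@nbhs_ballP R (R * R)%type); exists (e / (`|k| ^+ 2 * 8 + 1)); first by rewrite /= divr_gt0.
  move=> q; rewrite -ball_normE /= => pq; rewrite /d -mulrBr normrM.
  apply: (@le_lt_trans _ _ (`|k| ^+ 2 * 8 * `|p - q|)); last first.
    by move: pq; rewrite ltr_pdivlMr//; have := normr_ge0 (p - q); lra.
  have := bspline'_lip (k * x q + c) (k * x p + c).
  have -> : k * x p + c - (k * x q + c) = k * (x p - x q) by ring.
  rewrite normrM => h.
  have h2 : `|k| * (8 * (`|k| * `|x p - x q|)) <= `|k| * (8 * (`|k| * `|p - q|)).
    by rewrite ler_wpM2l// ler_wpM2l// ler_wpM2l.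
  apply: (le_trans _ (_ : `|k| * (8 * (`|k| * `|p - q|)) <= _)); last by rewrite expr2; lra.
  by apply: le_trans h2; rewrite ler_wpM2l.
exists (1 + 3 * `|k| + 4 * k ^+ 2).
have k2 := sqr_ge0 k; have k1 := normr_ge0 k.
split.
- by case: (i); [exact: cd|move=> p; exact: cvg_cst].
- by case: (i); [move=> p; exact: cvg_cst|exact: cd].
- move=> p; have [/andP[h1 h2] h3] := bspline_bound (k * x p + c).
  have h4 : `|d p| <= 3 * `|k| by rewrite /d normrM mulrC ler_wpM2r.
  have C0 : 0 <= 1 + 3 * `|k| + 4 * k ^+ 2 by lra.
  have h5 : `|d p| <= 1 + 3 * `|k| + 4 * k ^+ 2 by lra.
  split; first by rewrite ger0_norm//; apply: (le_trans h2); lra.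
    by case: (i); rewrite ?normr0.
  by case: (i); rewrite ?normr0.
- move=> p q.
  have -> : (q.1 - p.1) * (if i then d p else 0) + (q.2 - p.2) * (if i then 0 else d p) =
     (k * x q + c - (k * x p + c)) * bspline' (k * x p + c).
    by rewrite /d /x; case: (i); ring.
  apply: (le_trans (bspline_taylor _ _)).
  have -> : k * x q + c - (k * x p + c) = k * (x q - x p) by ring.
  rewrite exprMn mulrA -[(x q - x p) ^+ 2]norm_sqr.
  have s : `|x q - x p| ^+ 2 <= `|q - p| ^+ 2 by rewrite lerXn2r// nnegrE.
  apply: ler_pM => //; first by rewrite mulr_ge0.
  lra.
Qed.

(** Quasi-interpolation: at a point of [K] the spline is a convex combination of values of [G] at
    points of [K] within 4/N. *)
Lemma spline_approx (K : set (R * R)) (G : R * R -> R) (e : R) :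
  K `<=` `[-1, 1]%classic `*` `[-1, 1]%classic -> unif_cont_on K G -> 0 < e ->
  exists2 H, quadratic_C1 H & forall p, K p -> `|H p - G p| <= e.
Proof.
move=> Ksub uG e0.
have [d d0 dP] := uG e e0.
have [|N N0 NP] := @inv_nat_lt R (d / 4); first by rewrite divr_gt0.
have N0' : 0 < N%:R :> R by rewrite ltr0n.
(* The nodes run from -1 - 1/N to 1 + 1/N in each coordinate; this margin makes the weights sum to 1
   on all of [-1, 1]. *)
pose m := (2 * N + 3)%N; pose M : R := N%:R + 1.
pose pt (k l : nat) : R * R := ((k%:R - M) / N%:R, (l%:R - M) / N%:R).
(* [G] is controlled on [K] only, so every node near [K] is replaced by a point of [K]. *)
have sel q : exists q', (exists2 p, K p & `|p - q| <= 2 / N%:R) -> K q' /\ `|q' - q| <= 2 / N%:R.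
  by have [[p Kp pq]|n] := pselect (exists2 p, K p & `|p - q| <= 2 / N%:R); [exists p|exists q].
have [g gP] := choice sel.
pose w (t : R) (k : nat) := bspline (N%:R * t + M - k%:R).
exists (fun p => \sum_(0 <= k < m) \sum_(0 <= l < m) (w p.1 k * w p.2 l) * G (g (pt k l))).
  apply: quadratic_C1_sum => k; apply: quadratic_C1_sum => l.
  apply: quadratic_C1M; last exact: quadratic_C1_cst.
  apply: quadratic_C1M.
    have := @quadratic_C1_bspline N%:R (M - k%:R) true; rewrite /= => h.
    by rewrite /w; under eq_fun do rewrite -addrA.
  have := @quadratic_C1_bspline N%:R (M - l%:R) false; rewrite /= => h.
  by rewrite /w; under eq_fun do rewrite -addrA.
move=> p Kp.
have w1 t : -1 <= t <= 1 -> \sum_(0 <= k < m) w t k = 1.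
  move=> /andP[t1 t2]; have h1 : - N%:R <= N%:R * t by rewrite -mulrN1 ler_wpM2l// ltW.
  have h2 : N%:R * t <= N%:R by rewrite -[leRHS]mulr1 ler_wpM2l// ltW.
  apply: bspline_sum; rewrite /M; first lra.
  by rewrite /m natrD natrM; lra.
have w0 t k : 0 <= w t k by have [/andP[]] := bspline_bound (N%:R * t + M - k%:R).
have [p1 p2] := Ksub p Kp; move: p1 p2; rewrite /= !in_itv /= => p1 p2.
have eG : G p = \sum_(0 <= k < m) \sum_(0 <= l < m) (w p.1 k * w p.2 l) * G p.
  under eq_bigr => k _ do rewrite -mulr_suml -mulr_sumr w1// mulr1.
  by rewrite -mulr_suml w1// mul1r.
rewrite {1}eG -sumrB.
under eq_bigr => k _ do rewrite -sumrB.
under eq_bigr => k _ do under eq_bigr => l _ do rewrite -mulrBr.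
have ee : e = \sum_(0 <= k < m) \sum_(0 <= l < m) (w p.1 k * w p.2 l) * e.
  under eq_bigr => k _ do rewrite -mulr_suml -mulr_sumr w1// mulr1.
  by rewrite -mulr_suml w1// mul1r.
rewrite [leRHS]ee; apply: (le_trans (ler_norm_sum _ _ _)); apply: ler_sum => k _.
apply: (le_trans (ler_norm_sum _ _ _)); apply: ler_sum => l _.
have ww : 0 <= w p.1 k * w p.2 l by apply: mulr_ge0; exact: w0.
rewrite normrM (ger0_norm ww).
have [->|wn0] := eqVneq (w p.1 k * w p.2 l) 0; first by rewrite !mul0r.
apply: ler_wpM2l => //; apply/ltW.
move: wn0; rewrite mulf_eq0 negb_or => /andP[wk wl].
have near t (j : nat) : w t j != 0 -> `|t - (j%:R - M) / N%:R| <= 2 / N%:R.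
  move=> /bspline_supp.
  have -> : N%:R * t + M - j%:R = N%:R * (t - (j%:R - M) / N%:R) by field; rewrite gt_eqF.
  rewrite normrM (gtr0_norm N0') => h.
  by rewrite ler_pdivlMr// mulrC; lra.
have pn : `|p - pt k l| <= 2 / N%:R by rewrite prod_normE /= ge_max !near.
have [Kg gn] := gP (pt k l) (ex_intro2 _ _ p Kp pn).
apply: dP => //; apply: (@le_lt_trans _ _ (4 / N%:R)).
  rewrite -(subrKA (pt k l)); apply: (le_trans (ler_normD _ _)); rewrite (distrC _ p).
  have -> : 4 / N%:R = 2 / N%:R + 2 / N%:R :> R by rewrite -mulrDl; congr (_ / _); ring.
  exact: lerD.
by have := NP N (leqnn _); lra.
Qed.

End SplineApproximation.

(** * Area of thin strips *)

Section Strips.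
Context {R : realType}.
Implicit Types (p q : R * R).
Local Notation leb := (@lebesgue_measure R).
Local Notation leb2 := ((leb \x leb)%E : set (R * R) -> \bar R).

Definition strip (h : R * R) (r a b e eta : R) : set (R * R) :=
  [set q | [/\ `|q.1 - h.1| <= r, `|q.2 - h.2| <= r & `|a * q.1 + b * q.2 - e| <= eta]].

Lemma measurable_strip (h : R * R) (r a b e eta : R) : measurable (strip h r a b e eta).
Proof.
have m (f : R * R -> R) (c : R) : measurable_fun setT f -> measurable [set q | `|f q| <= c].
  move=> mf; have -> : [set q | `|f q| <= c] = setT `&` f @^-1` `[- c, c]%classic.
    by apply/seteqP; split => q /=; rewrite in_itv /= ler_norml; [move=> ->|case].
  exact: mf.
have -> : strip h r a b e eta =
  [set q | `|q.1 - h.1| <= r] `&` ([set q | `|q.2 - h.2| <= r] `&` [set q | `|a * q.1 + b * q.2 - e| <= eta]).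
  by apply/seteqP; split => q /=; [case|case => ? []].
apply: measurableI; [|apply: measurableI]; apply: m.
- by apply: measurable_funB => //; exact: measurable_fst.
- by apply: measurable_funB => //; exact: measurable_snd.
- by apply: measurable_funB => //; apply: measurable_funD; exact: measurable_funM.
Qed.

Lemma lebesgue_le_itv (S : set R) (c r : R) : 0 <= r -> measurable S ->
  S `<=` [set x | `|x - c| <= r] -> (leb S <= (2 * r)%:E)%E.
Proof.
move=> r0 mS Sc.
apply: (@le_trans _ _ (leb `[c - r, c + r]%classic)).
  apply: le_measure; rewrite ?inE//= => x /Sc /=; rewrite in_itv /= ler_norml => /andP[? ?].
  by apply/andP; split; lra.
rewrite lebesgue_measure_itv /= lte_fin; case: ifP => _; last by rewrite lee_fin; lra.
by rewrite -EFinB lee_fin; lra.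
Qed.

(** Integration over vertical slices: with |b| = 1 each slice lies in an interval of length 2 eta,
    and the slices are empty outside an interval of length 2r. *)
Lemma strip_measure1 (S : set (R * R)) (h : R * R) (r a b e eta : R) :
  0 <= r -> 0 <= eta -> `|b| = 1 -> measurable S ->
  S `<=` [set q | `|q.1 - h.1| <= r /\ `|a * q.1 + b * q.2 - e| <= eta] ->
  (leb2 S <= (2 * r * (2 * eta))%:E)%E.
Proof.
move=> r0 eta0 b1 mS Ssub.
have mI : measurable [set x : R | `|x - h.1| <= r].
  have -> : [set x : R | `|x - h.1| <= r] = `[h.1 - r, h.1 + r]%classic.
    by apply/seteqP; split => x /=; rewrite in_itv /= ler_norml => /andP[? ?]; apply/andP; split; lra.
  exact: measurable_itv.
rewrite /= /product_measure1.
apply: (@le_trans _ _ (\int[leb]_x (2 * eta * \1_[set x : R | `|x - h.1| <= r] x)%:E)%E).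
  apply: ge0_le_integral => //.
  - exact: measurable_fun_xsection.
  - by apply/measurable_EFinP; apply: measurable_funM => //; exact: measurable_indic.
  - move=> x _; rewrite indicE; have [/set_mem xr|xr] := boolP (x \in _).
      rewrite mulr1; apply: (@lebesgue_le_itv _ (b^-1 * (e - a * x))) => //.
        exact: measurable_xsection.
      move=> y; rewrite /xsection /= inE => /Ssub /= [_].
      have -> : a * x + b * y - e = b * (y - b^-1 * (e - a * x)).
        by field; rewrite -normr_eq0 b1.
      by rewrite normrM b1 mul1r.
    have -> : (leb \o xsection S) x = 0%E; last by rewrite mulr0.
    rewrite /= (_ : xsection S x = set0) ?measure0//.
    apply/seteqP; split => // y; rewrite /xsection /= inE => /Ssub /= [xr' _].
    by move: xr; rewrite notin_setE; exact.
under eq_integral do rewrite EFinM.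
rewrite ge0_integralZl_EFin//; last 2 first.
- by apply/measurable_EFinP; exact: measurable_indic.
- by lra.
rewrite integral_indic// setIT.
have := @lebesgue_le_itv _ h.1 r r0 mI (fun x => id).
move=> hle; apply: (@le_trans _ _ ((2 * eta)%:E * (2 * r)%:E)%E).
  by apply: lee_pmul => //; rewrite lee_fin; lra.
by rewrite -EFinM lee_fin mulrC.
Qed.

Lemma leb2_swap (S : set (R * R)) : measurable S ->
  leb2 ((fun q => (q.2, q.1)) @^-1` S) = leb2 S.
Proof.
move=> mS.
transitivity ((leb \x^ leb)%E S) => //.
by apply/esym; apply: product_measure_unique => //= A B mA mB; rewrite product_measure2E.
Qed.

Lemma strip_measure (h : R * R) (r a b e eta : R) : 0 <= r -> 0 <= eta ->
  (`|a| = 1 \/ `|b| = 1) ->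
  (leb2 (strip h r a b e eta) <= (2 * r * (2 * eta))%:E)%E.
Proof.
move=> r0 eta0 ab; have mS := measurable_strip h r a b e eta.
case: ab => ab; last first.
  by apply: (@strip_measure1 _ h r a b e eta) => // q [? ? ?].
rewrite -leb2_swap//; apply: (@strip_measure1 _ (h.2, h.1) r b a e eta) => //.
  have -> : (fun q => (q.2, q.1)) @^-1` strip h r a b e eta = strip (h.2, h.1) r b a e eta.
    by apply/seteqP; split => q /= [h1 h2 h3]; split => //=; rewrite [X in X - e]addrC.
  exact: measurable_strip.
by move=> q /= [? ?]; rewrite [X in X - e]addrC.
Qed.

Lemma measure_union_le (d : measure_display) (T : measurableType d)
    (mu : {measure set T -> \bar R}) (I : Type) (s : seq I) (F : I -> set T) (c : R) (A : set T) :
  (forall i, measurable (F i)) -> (forall i, (mu (F i) <= c%:E)%E) -> measurable A ->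
  (forall x, A x -> List.Exists (fun i => F i x) s) -> (mu A <= ((size s)%:R * c)%:E)%E.
Proof.
move=> mF Fc; elim: s A => [|i s IH] A mA cov.
  rewrite (_ : A = set0) ?measure0 ?mul0r//.
  by apply/seteqP; split => // x /cov /List.Exists_nil.
have -> : A = (A `&` F i) `|` (A `\` F i) by rewrite setUIDK.
apply: (le_trans (measureU2 _ _ _)); [exact: measurableI|exact: measurableD|].
have -> : (size (i :: s))%:R * c = c + (size s)%:R * c by rewrite /= -natr1; ring.
rewrite EFinD; apply: leeD.
  by apply: le_trans (Fc i); apply: le_measure; rewrite ?inE//; exact: measurableI.
apply: IH; first exact: measurableD.
by move=> x [Ax nx]; have /List.Exists_cons [] := cov x Ax.
Qed.

End Strips.

(** * Sard's theorem in the plane and regular approximation *)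

Section Sard.
Context {R : realType}.
Implicit Types (p q A B : R * R).
Local Notation leb := (@lebesgue_measure R).
Local Notation leb2 := ((leb \x leb)%E : set (R * R) -> \bar R).

(** The image of a degenerate differential lies in a line; the perpendicular of a nonzero column,
    rescaled to sup norm 1, is a normal to it. *)
Lemma singular_normal A B : cross A B = 0 -> exists a b : R,
  [/\ (`|a| = 1 \/ `|b| = 1), `|a| <= 1, `|b| <= 1,
      a * A.1 + b * A.2 = 0 & a * B.1 + b * B.2 = 0].
Proof.
have unit_dir (u v : R) : (u, v) != 0 -> exists k : R, [/\ (`|k * u| = 1 \/ `|k * v| = 1), `|k * u| <= 1 & `|k * v| <= 1].
  move=> uv; have [le|/ltW le] := leP `|u| `|v|.
    have v0 : v != 0.
      apply: contraNneq uv => v0; move: le; rewrite v0 normr0 normr_le0 => /eqP ->.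
      by [].
    exists v^-1; rewrite mulVf// normr1; split => //; first by right.
    by rewrite normrM normfV ler_pdivrMl ?normr_gt0// mulr1.
  have u0 : u != 0.
    apply: contraNneq uv => u0; move: le; rewrite u0 normr0 normr_le0 => /eqP ->.
    by [].
  exists u^-1; rewrite mulVf// normr1; split => //; first by left.
  by rewrite normrM normfV ler_pdivrMl ?normr_gt0// mulr1.
move=> AB.
have [A0|A0] := eqVneq A 0; last first.
  have [|k [k1 k2 k3]] := unit_dir (- A.2) A.1.
    apply: contra A0 => /eqP [/eqP e1 /eqP e2]; move: e1 e2; rewrite oppr_eq0 => /eqP e1 /eqP e2.
    by apply/eqP; move: e1 e2; case: (A) => x y /= -> ->.
  exists (k * - A.2), (k * A.1); split => //; first by ring.
  by move: AB; rewrite /cross => AB; rewrite -[RHS](mulr0 k) -AB; ring.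
have [B0|B0] := eqVneq B 0.
  by exists 1, 0; rewrite A0 B0 /= !mulr0 addr0 normr1 normr0; split => //; left.
have [|k [k1 k2 k3]] := unit_dir (- B.2) B.1.
  apply: contra B0 => /eqP [/eqP e1 /eqP e2]; move: e1 e2; rewrite oppr_eq0 => /eqP e1 /eqP e2.
  by apply/eqP; move: e1 e2; case: (B) => x y /= -> ->.
exists (k * - B.2), (k * B.1); split => //; last by ring.
by rewrite A0 /= !mulr0 addr0.
Qed.

Lemma trunc_close (N : nat) (x y : R) : (0 < N)%N -> 0 <= x -> 0 <= y ->
  Num.truncn (N%:R * x) = Num.truncn (N%:R * y) -> `|x - y| <= N%:R^-1.
Proof.
move=> N0 x0 y0 e; have N0' : 0 < N%:R :> R by rewrite ltr0n.
have /andP[a1 a2] := truncn_itv (mulr_ge0 (ltW N0') x0).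
have /andP[b1 b2] := truncn_itv (mulr_ge0 (ltW N0') y0).
rewrite -(ler_pM2l N0') mulfV ?gt_eqF// -{1}(gtr0_norm N0') -normrM.
move: a1 a2 b1 b2; rewrite e -natr1 => a1 a2 b1 b2.
by rewrite ler_norml; apply/andP; split; lra.
Qed.

(** Suppose that all values in the box of radius [e] around [z] are critical, and cut the square
    into about N^2 cells. By the quadratic remainder, a cell containing a critical point is mapped
    into a strip of length O(C/N) and width O(C/N^2) along the image of the differential. The strips
    have total area O(C^2/N), too little to cover the box. *)
Lemma sard (H A B : R * R -> R * R) (C : R) :
  (forall p, `|A p| <= C /\ `|B p| <= C) ->
  (forall p q, `|H q - H p - columns (A p) (B p) (q - p)| <= C * `|q - p| ^+ 2) ->
  forall z e, 0 < e -> exists2 z', `|z' - z| <= e &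
    forall p, -1 <= p.1 <= 1 -> -1 <= p.2 <= 1 -> H p = z' -> cross (A p) (B p) != 0.
Proof.
move=> bd quad z e e0; apply: contrapT => none.
have C0 : 0 <= C by have [h _] := bd 0; apply: le_trans h.
have crit z' : `|z' - z| <= e -> exists p, [/\ -1 <= p.1 <= 1, -1 <= p.2 <= 1, H p = z' & cross (A p) (B p) = 0].
  move=> z'z; apply: contrapT => nex; apply: none; exists z' => // p p1 p2 Hp.
  by apply/eqP => c0; apply: nex; exists p.
(* The strips have total area at most 4 N^2 (2r)(2 eta) = 1024 C^2 / N, which must stay below the
   area 4 e^2 of the box. *)
pose N := (Num.truncn (1024 * (C ^+ 2 + 1) / e ^+ 2)).+1.
have NP : 1024 * (C ^+ 2 + 1) / e ^+ 2 < N%:R by rewrite /N truncnS_gt.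
have N0 : (0 < N)%N by [].
have N0' : 0 < N%:R :> R by rewrite ltr0n.
pose idx p : nat * nat := (Num.truncn (N%:R * ((p.1 + 1) / 2)), Num.truncn (N%:R * ((p.2 + 1) / 2))).
pose P (i : nat * nat) p := [/\ -1 <= p.1 <= 1, -1 <= p.2 <= 1, cross (A p) (B p) = 0 & idx p = i].
(* One critical point is selected in each cell that has any; the strip of the cell is centred at its
   image. *)
have selex i : exists p, (exists q, P i q) -> P i p.
  by have [[q Pq]|n] := pselect (exists q, P i q); [exists q|exists 0].
have [s sP] := choice selex.
pose r := 8 * C / N%:R; pose eta := 8 * C / N%:R ^+ 2.
have r0 : 0 <= r by rewrite divr_ge0 ?mulr_ge0// ltW.
have eta0 : 0 <= eta by rewrite divr_ge0 ?mulr_ge0// sqr_ge0.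
have norm_ex i : exists ab : R * R, cross (A (s i)) (B (s i)) = 0 ->
  [/\ (`|ab.1| = 1 \/ `|ab.2| = 1), `|ab.1| <= 1, `|ab.2| <= 1,
      ab.1 * (A (s i)).1 + ab.2 * (A (s i)).2 = 0 & ab.1 * (B (s i)).1 + ab.2 * (B (s i)).2 = 0].
  have [c0|c0] := pselect (cross (A (s i)) (B (s i)) = 0); last by exists 0.
  by have [a [b h]] := singular_normal c0; exists (a, b).
have [nu nuP] := choice norm_ex.
pose F i : set (R * R) := if `[< cross (A (s i)) (B (s i)) = 0 >] then
   strip (H (s i)) r (nu i).1 (nu i).2 ((nu i).1 * (H (s i)).1 + (nu i).2 * (H (s i)).2) eta else set0.
have mF i : measurable (F i).
  by rewrite /F; case: ifP => _; [exact: measurable_strip|exact: measurable0].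
have Fc i : (leb2 (F i) <= (2 * r * (2 * eta))%:E)%E.
  rewrite /F; case: asboolP => c0.
    by apply: strip_measure => //; have [] := nuP i c0.
  by rewrite measure0 lee_fin mulr_ge0// mulr_ge0.
pose cells := [seq (i, j) | i <- iota 0 N.+1, j <- iota 0 N.+1].
pose Box : set (R * R) := `[z.1 - e, z.1 + e]%classic `*` `[z.2 - e, z.2 + e]%classic.
have mBox : measurable Box by apply: measurableX; exact: measurable_itv.
have cov x : Box x -> List.Exists (fun i => F i x) cells.
  move=> [x1 x2].
  have xz : `|x - z| <= e.
    move: x1 x2; rewrite /= !in_itv /= => /andP[? ?] /andP[? ?].
    by rewrite prod_normE /= ge_max !ler_norml; apply/andP; split; apply/andP; split; lra.
  have [p [p1 p2 Hp c0]] := crit x xz.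
  apply/List.Exists_exists; exists (idx p); split.
    have lt_idx (y : R) : -1 <= y <= 1 -> (Num.truncn (N%:R * ((y + 1) / 2)) < N.+1)%N.
      move=> /andP[y1 y2]; rewrite ltnS -(ler_nat R).
      apply: (le_trans (_ : _ <= N%:R * ((y + 1) / 2))).
        by rewrite truncn_le; apply: mulr_ge0; lra.
      by apply: ler_piMr; lra.
    have /allpairsP mem : idx p \in cells.
      by rewrite /cells; apply: allpairs_f; rewrite mem_iota /= add0n lt_idx.
    suff : forall (T : eqType) (y : T) (t : seq T), y \in t -> List.In y t.
      by apply; apply/allpairsP.
    move=> T y; elim=> // a t IH; rewrite in_cons => /predU1P[->|yt]; first by left.
    by right; exact: IH.
  have [s1 s2 sc si] : P (idx p) (s (idx p)) by apply: sP; exists p.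
  rewrite /F; case: asboolP => // _.
  have [_ n1 n2 nA nB] := nuP _ sc.
  set q := s (idx p) in s1 s2 sc si n1 n2 nA nB *.
  have [e1 e2] := si.
  have /andP[p11 p12] := p1; have /andP[p21 p22] := p2.
  have /andP[s11 s12] := s1; have /andP[s21 s22] := s2.
  have d1 : `|(p.1 + 1) / 2 - (q.1 + 1) / 2| <= N%:R^-1 by apply: trunc_close => //; lra.
  have d2 : `|(p.2 + 1) / 2 - (q.2 + 1) / 2| <= N%:R^-1 by apply: trunc_close => //; lra.
  have pq : `|p - q| <= 2 / N%:R.
    rewrite prod_normE /= ge_max; apply/andP; split.
      by move: d1; rewrite !ler_norml => /andP[? ?]; apply/andP; split; lra.
    by move: d2; rewrite !ler_norml => /andP[? ?]; apply/andP; split; lra.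
  have rem := quad q p; set rm := _ - _ - _ in rem.
  have rem' : `|rm| <= 4 * C / N%:R ^+ 2.
    apply: (le_trans rem); have -> : 4 * C / N%:R ^+ 2 = C * (2 / N%:R) ^+ 2 by field; rewrite gt_eqF.
    rewrite ler_wpM2l//; apply: lerXn2r; rewrite ?nnegrE//.
  have Hpq : H p - H q = columns (A q) (B q) (p - q) + rm by rewrite /rm [RHS]addrC subrK.
  have [bA bB] := bd q.
  have Hr : `|H p - H q| <= r.
    rewrite Hpq; apply: (le_trans (ler_normD _ _)).
    have := columns_le (A q) (B q) (p - q) => h.
    have h' : (`|A q| + `|B q|) * `|p - q| <= (2 * C) * (2 / N%:R).
      by apply: ler_pM => //; lra.
    have h'' : 4 * C / N%:R ^+ 2 <= 4 * C / N%:R.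
      rewrite ler_wpM2l ?mulr_ge0// lef_pV2 ?posrE ?exprn_gt0//.
      have N1 : 1 <= N%:R :> R by rewrite ler1n.
      by rewrite expr2; nra.
    have -> : r = 2 * C * (2 / N%:R) + 4 * C / N%:R by rewrite /r; field; rewrite gt_eqF.
    by apply: lerD; [exact: le_trans h'|exact: le_trans h''].
  rewrite -Hp; split.
  - exact: (le_trans (norm_fst_le (H p - H q))).
  - exact: (le_trans (norm_snd_le (H p - H q))).
  - set a := (nu _).1; set b := (nu _).2.
    have -> : a * (H p).1 + b * (H p).2 - (a * (H q).1 + b * (H q).2) =
       a * (H p - H q).1 + b * (H p - H q).2 by rewrite /=; ring.
    rewrite Hpq.
    have -> : a * (columns (A q) (B q) (p - q) + rm).1 + b * (columns (A q) (B q) (p - q) + rm).2 =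
      (p.1 - q.1) * (a * (A q).1 + b * (A q).2) + (p.2 - q.2) * (a * (B q).1 + b * (B q).2) + (a * rm.1 + b * rm.2).
      by rewrite /columns /= -![_ *: _]/(_ * _); ring.
    rewrite nA nB !mulr0 addr0 add0r; apply: (le_trans (ler_normD _ _)); rewrite !normrM.
    have -> : eta = 4 * C / N%:R ^+ 2 + 4 * C / N%:R ^+ 2 by rewrite /eta; field; rewrite gt_eqF.
    apply: lerD; rewrite -[leRHS]mul1r; apply: ler_pM => //; apply: le_trans rem'.
      exact: norm_fst_le.
    exact: norm_snd_le.
pose It (c : R) : set R := `[c - e, c + e]%classic.
have lI (c : R) : leb (It c) = (2 * e)%:E.
  rewrite /It.
  rewrite lebesgue_measure_itv /= lte_fin ifT; last by lra.
  by rewrite -EFinB; congr (_%:E); ring.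
have muBox : leb2 Box = (4 * e ^+ 2)%:E.
  transitivity (leb (It z.1) * leb (It z.2))%E.
    by rewrite /Box product_measure1E//; exact: measurable_itv.
  by rewrite !lI -EFinM; congr (_%:E); ring.
have : (leb2 Box <= ((size cells)%:R * (2 * r * (2 * eta)))%:E)%E.
  exact: (@measure_union_le R _ _ (leb \x leb)%E _ cells F _ Box mF Fc mBox cov).
rewrite muBox size_allpairs !size_iota lee_fin.
apply/negP; rewrite -ltNge.
have l1 : (N.+1 * N.+1)%:R * (2 * r * (2 * eta)) <= 4 * N%:R ^+ 2 * (2 * r * (2 * eta)).
  rewrite ler_wpM2r ?mulr_ge0// natrM -natr1.
  have : 1 <= N%:R :> R by rewrite ler1n.
  by nra.
apply: (le_lt_trans l1).
have -> : 4 * N%:R ^+ 2 * (2 * r * (2 * eta)) = 1024 * C ^+ 2 / N%:R.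
  by rewrite /r /eta; field; rewrite gt_eqF.
rewrite ltr_pdivrMr//.
have : 1024 * (C ^+ 2 + 1) < N%:R * e ^+ 2 by rewrite -ltr_pdivrMr// exprn_gt0.
have := sqr_ge0 C; have : 0 < e ^+ 2 by rewrite exprn_gt0.
have : 0 < N%:R * e ^+ 2 by rewrite mulr_gt0// exprn_gt0.
by lra.
Qed.

(** Both coordinates are approximated by splines. Sard's argument gives a regular value [z'] near
    [z], and translating the map by [z' - z] makes [z] itself regular. *)
Lemma regular_approximation (G : R * R -> R * R) (z : R * R) (e : R) :
  {within closure unit_disk, continuous G} -> 0 < e ->
  exists H : R * R -> R * R,
    [/\ {within closure unit_disk, continuous H}, C1_on unit_disk H,
        forall p, closure unit_disk p -> `|G p - H p| <= e &
        forall p, unit_disk p -> H p = z -> jacobian2 H p != 0].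
Proof.
move=> cG e0.
have uG := heine_cantor (@compact_closed_disk R) cG.
have dsub : closure (@unit_disk R) `<=` `[-1, 1]%classic `*` `[-1, 1]%classic.
  rewrite closure_unit_disk => p /= h.
  have : `|p| <= 1 by have := le_trans (sqn_ge p) h; rewrite expr_le1.
  by rewrite prod_normE ge_max !ler_norml => /andP[? ?]; split; rewrite /= in_itv.
have e2 : 0 < e / 2 by rewrite divr_gt0.
have [F1 [a1 [b1 [C1 [ca1 cb1 bd1 q1]]]] F1P] := spline_approx dsub (unif_cont_fst uG) e2.
have [F2 [a2 [b2 [C2 [ca2 cb2 bd2 q2]]]] F2P] := spline_approx dsub (unif_cont_snd uG) e2.
pose H0 p := (F1 p, F2 p).
pose A p := (a1 p, a2 p); pose B p := (b1 p, b2 p); pose C := Num.max C1 C2.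
have bdC p : `|A p| <= C /\ `|B p| <= C.
  have [_ h1 h2] := bd1 p; have [_ h3 h4] := bd2 p.
  rewrite !prod_normE /= /C !ge_max !le_max; split; apply/andP; split; apply/orP; by [left|right].
have C1C : C1 <= C by rewrite le_max lexx.
have C2C : C2 <= C by rewrite le_max lexx orbT.
have quadC p q : `|H0 q - H0 p - columns (A p) (B p) (q - p)| <= C * `|q - p| ^+ 2.
  rewrite prod_normE ge_max; apply/andP; split.
    by apply: (le_trans (q1 p q)); rewrite ler_wpM2r// sqr_ge0.
  by apply: (le_trans (q2 p q)); rewrite ler_wpM2r// sqr_ge0.
have C0 : 0 <= C by have [h _] := bdC 0; apply: le_trans h.
have [z' z'z z'reg] := sard bdC quadC z e2.
pose H p := H0 p - (z' - z).
have colH p : has_columns H p (A p) (B p).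
  apply: has_columns_subc => t t0; exists (t / (C + 1)); first by rewrite divr_gt0//; lra.
  move=> q qp; have := quadC p q; rewrite /columns => h; apply: (le_trans h).
  rewrite expr2 mulrA ler_wpM2r//; move: qp; rewrite ltr_pdivlMr; last lra.
  by have := normr_ge0 (q - p); lra.
have dH p := proj1 (differentiable_columns (colH p)).
have dHE p := proj2 (differentiable_columns (colH p)).
have DE v p : 'D_v H p = columns (A p) (B p) v by rewrite deriveE// dHE.
exists H; split.
- by apply: continuous_subspaceT => p; exact: differentiable_continuous.
- move=> p _; split => // v.
  have -> : (fun q => 'D_v H q) = (fun q => columns (A q) (B q) v) by apply/funext => q.
  have cA : continuous A by move=> q; exact: (cvg_pair (ca1 q) (ca2 q)).
  have cB : continuous B by move=> q; exact: (cvg_pair (cb1 q) (cb2 q)).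
  by apply: cvgD; (apply: cvgZ; first exact: cvg_cst); [exact: cA|exact: cB].
- move=> p pD; have h1 := F1P p pD; have h2 := F2P p pD.
  have -> : G p - H p = (G p - H0 p) + (z' - z) by rewrite /H opprB addrCA addrC addrA.
  apply: (le_trans (ler_normD _ _)).
  have : `|G p - H0 p| <= e / 2 by rewrite prod_normE ge_max /= distrC h1 distrC h2.
  by lra.
- move=> p pD Hp.
  have [p1 p2] := dsub p (@subset_closure _ _ p pD).
  have := z'reg p; move: p1 p2; rewrite /= !in_itv /= => p1 p2 /(_ p1 p2).
  have -> : jacobian2 H p = cross (A p) (B p).
    by rewrite /jacobian2 !DE /columns /cross /= -![_ *: _]/(_ * _); ring.
  by apply; apply/eqP; rewrite -subr_eq0 -[X in _ - X](subrK z z') opprD addrA -/(H p) Hp subrr.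
Qed.

End Sard.

(** * The winding number as an eventual crossing number *)

Section Winding.
Context {R : realType}.
Implicit Types (p q : R * R) (gamma : R -> R * R).
Local Notation I := (`[0, 1]%classic : set R).

(** A compact source makes [P] a quotient map onto its image. A point [q] with the same image as
    [q0] is handled by continuity of [g]; near any other [q], the image stays away from [P q0]. *)
Lemma within_continuous_factor (U V W : normedModType R) (K : set U)
    (P : U -> V) (g : U -> W) (G : V -> W) :
  compact K -> unif_cont_on K P -> unif_cont_on K g ->
  (forall q : U, K q -> G (P q) = g q) -> {within P @` K, continuous G}.
Proof.
move=> cK uP ug GP; apply/subspace_continuousP => _ [q0 Kq0 <-].
apply/cvgrPdist_lt => e e0.
have /compact_near_coveringP ncK := cK.
have [|d /= d0 dP] := ncK R (0^'+)
  (fun d (q : U) => K q -> `|P q0 - P q| < d -> `|G (P q0) - G (P q)| < e) _.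
  move=> /= q Kq; have [Pq|Pq] := eqVneq (P q0) (P q).
    have [r r0 rP] := ug e e0.
    exists (ball q r, setT); first by split; [exact: nbhsx_ballx|exact: filterT].
    move=> [q' d] /= [+ _] Kq' _; rewrite -ball_normE /= Pq !GP// => qq'.
    exact: rP.
  have [r r0 rP] := uP (`|P q0 - P q| / 2) ltac:(by rewrite divr_gt0 // normr_gt0 subr_eq0).
  exists (ball q r, [set d | d < `|P q0 - P q| / 2]).
    split; first exact: nbhsx_ballx.
    by apply: nbhs_right_lt; rewrite divr_gt0// normr_gt0 subr_eq0.
  move=> [q' d] /= [+ dr] Kq' h; rewrite -ball_normE /= => qq'.
  have := rP q q' Kq Kq' qq'; have := ler_normD (P q0 - P q') (P q' - P q).
  rewrite subrKA (distrC (P q')) => h1 h2; exfalso; lra.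
apply/nbhs_ballP; exists (d / 2); first by rewrite /= divr_gt0.
move=> y yb [q Kq qy]; move: yb; rewrite -qy -ball_normE /= => h.
apply: (dP (d / 2)) => //=; last by rewrite divr_gt0.
by rewrite sub0r normrN gtr0_norm ?divr_gt0//; lra.
Qed.

(** The extension is the cone r gamma(s) in polar coordinates centred at 0. *)
Lemma curve_extension gamma : unif_cont_on I gamma -> gamma 0 = gamma 1 ->
  exists G, extends_curve gamma G.
Proof.
move=> ug g01; pose g q := q.1 *: gamma q.2.
have sq0 : sqn (0 : R * R) < 1 by rewrite /sqn /= expr0n addr0 ltr01.
have onto p : closure unit_disk p -> exists2 q, unit_square q & polar 0 q = p.
  rewrite closure_unit_disk /= => p1.
  have [->|p0] := eqVneq p 0.
    exists (0, 0); first by split; rewrite /= in_itv /= lexx ler01.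
    by rewrite /polar /= scaler0 scale0r addr0.
  move: p1; rewrite le_eqVlt => /orP[/eqP/circle_surj[s /andP[s0 s1] sp]|p1].
    exists (1, s); first by split; rewrite /= in_itv /= ?lexx ?ler01// s0 ltW.
    by rewrite /polar /= scaler0 scale1r add0r.
  have [q [/andP[q1 q2] /andP[q3 q4] qp]] := polar_surj sq0 p1 p0.
  by exists q => //; split; rewrite /= in_itv /=; apply/andP; split => //; exact: ltW.
(* These coordinates identify only points of radius 0, where [g] vanishes, and the angles 0 and 1,
   where the closed curve agrees. *)
have fac q q' : unit_square q -> unit_square q' -> polar 0 q = polar 0 q' -> g q = g q'.
  pose nrm q := (q.1, if q.2 == 1 then 0 else q.2).
  have gn q0 : g (nrm q0) = g q0.
    by rewrite /g /nrm /=; case: eqP => // ->; rewrite g01.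
  have pn q0 : polar 0 (nrm q0) = polar 0 q0.
    by rewrite /polar /nrm /=; case: eqP => // ->; rewrite circle0 circle1.
  have n1 q0 : unit_square q0 -> 0 <= (nrm q0).2 < 1.
    move=> [_]; rewrite /= in_itv /= => /andP[h1 h2].
    by case: eqP => [_|/eqP h]; [rewrite lexx ltr01|rewrite h1 lt_neqAle h].
  have z0 q0 q1 : unit_square q0 -> unit_square q1 -> polar 0 q0 = polar 0 q1 -> q0.1 = 0 -> q1.1 = 0.
    move=> _ _ e q00; move: e; rewrite /polar q00 scaler0 scale0r scaler0 !add0r => /esym/eqP.
    rewrite scaler_eq0 => /orP[/eqP//|/eqP h].
    by have := sqn_circle q1.2; rewrite h /sqn /= expr0n addr0 => /esym/eqP; rewrite oner_eq0.
  move=> Qq Qq' e.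
  have [q0|q0] := eqVneq q.1 0.
    by rewrite /g q0 (z0 _ _ Qq Qq' e q0) !scale0r.
  have [q'0|q'0] := eqVneq q'.1 0.
    by rewrite /g q'0 (z0 _ _ Qq' Qq (esym e) q'0) !scale0r.
  rewrite -(gn q) -(gn q'); congr g; apply: (polar_inj sq0); rewrite ?pn ?n1//=.
    by rewrite lt_neqAle eq_sym q0; case: Qq; rewrite /= in_itv /= => /andP[].
  by rewrite lt_neqAle eq_sym q'0; case: Qq'; rewrite /= in_itv /= => /andP[].
have sel p : exists q, closure unit_disk p -> unit_square q /\ polar 0 q = p.
  by have [/onto[q h1 h2]|n] := pselect (closure unit_disk p); [exists q|exists 0].
have [s sP] := choice sel.
have polarD q : unit_square q -> closure unit_disk (polar 0 q).
  move=> [q1 _]; rewrite closure_unit_disk /=; apply: polar_le1; first exact: ltW.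
  by move: q1; rewrite /= in_itv.
pose G p := g (s p).
have GE q : unit_square q -> G (polar 0 q) = g q.
  move=> Qq; have [h1 h2] := sP _ (polarD q Qq); exact: fac.
exists G; split.
  have -> : closure (@unit_disk R) = [set polar 0 q | q in unit_square].
    apply/predeqP => p; split => [/onto[q Qq <-]|[q Qq <-]]; first by exists q.
    exact: polarD.
  apply: (@within_continuous_factor _ _ _ unit_square (polar 0) g) => //.
  - exact: compact_unit_square.
  - exact: unif_cont_polar.
  - have [M M0 MP] := unif_cont_bounded (@segment_compact R 0 1) ug.
    move=> e e0; have e2 : 0 < e / 2 by rewrite divr_gt0.
    have [d d0 dP] := ug _ e2.
    exists (Num.min d (e / (2 * M))); first by rewrite lt_min d0 divr_gt0// mulr_gt0.
    move=> x y [x1 x2] [y1 y2]; rewrite lt_min => /andP[xy xy'].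
    have -> : g x - g y = (x.1 - y.1) *: gamma x.2 + y.1 *: (gamma x.2 - gamma y.2).
      by rewrite /g scalerBl scalerBr addrA subrK.
    apply: (le_lt_trans (ler_normD _ _)); rewrite !normrZ (splitr e); apply: ler_ltD.
      apply: (@le_trans _ _ (e / (2 * M) * M)); last first.
        by rewrite le_eqVlt; apply/orP; left; apply/eqP; field; rewrite gt_eqF.
      apply: ler_pM => //; last exact: MP.
      by apply/ltW; apply: le_lt_trans xy'; exact: (norm_fst_le (x - y)).
    apply: (@le_lt_trans _ _ `|gamma x.2 - gamma y.2|).
      rewrite -[leRHS]mul1r ler_wpM2r//.
      by move: y1; rewrite /= in_itv /= => /andP[h1 h2]; rewrite ger0_norm.
    by apply: dP => //; apply: le_lt_trans xy; exact: (norm_snd_le (x - y)).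
move=> t /andP[t0 t1].
have -> : (cos (2 * pi * t), sin (2 * pi * t)) = polar 0 (1, t).
  by rewrite /polar /= scaler0 scale1r add0r.
rewrite GE; first by rewrite /g scale1r.
by split; rewrite /= in_itv /= ?lexx ?ler01// t0.
Qed.

Lemma norm2_ltE (a b : R * R) : (norm2 a < norm2 b) = (sqn a < sqn b).
Proof.
rewrite /norm2 -!/(sqn _); have [b0|b0] := ltP 0 (sqn b); first by rewrite ltr_sqrt.
rewrite (ler0_sqrtr b0) ltNge sqrtr_ge0/=; apply/esym/negbTE.
by rewrite -leNgt (le_trans b0)// sqn_ge0.
Qed.

Lemma circle_closure (s : R) : closure unit_disk (circle s).
Proof. by rewrite closure_unit_disk /= sqn_circle. Qed.

(** On the circle an admissible map satisfies |G - H| < |z - G|, so [H - z] and [gamma - z] have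
    positive scalar product and the same number of turns. [degree_turns] computes that number for
    [H]. *)
Lemma degree_unique gamma G (z : R * R) (d : int) :
  unif_cont_on I gamma -> extends_curve gamma G -> gamma 0 = gamma 1 ->
  is_brouwer_degree unit_disk G z d ->
  exists N, forall n, (N <= n)%N -> turns n (fun s => gamma s - z) = d.
Proof.
move=> ug [cG Gg] g01 [H [cH C1H GH reg ->]].
have Hz s t : norm2 (G (circle s) - H (circle s)) < norm2 (z - G (circle t)).
  apply: GH; first exact: circle_closure.
  by rewrite boundary_unit_disk /= sqn_circle.
have [|s|N NP] := degree_turns cH (z := z).
- by move=> p pD Hp; split; [have [] := C1H p pD|exact: reg].
- by apply/eqP => e; have := Hz s s; rewrite e norm2_ltE /sqn /= -sqrrN opprB -[(z.2 - _) ^+ 2]sqrrN opprB ltxx.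
have uHc : unif_cont_on I (fun s => H (circle s) - z).
  apply: unif_cont_subc; apply: (unif_cont_comp (f := circle) (g := H) (B := closure unit_disk)).
  - by move=> s _; exact: circle_closure.
  - exact: unif_cont_circle.
  - by apply: heine_cantor => //; exact: compact_closed_disk.
have [s Is|||N' N'P] := turns_homotopic uHc (unif_cont_subc z ug).
- have : G (circle s) = gamma s by apply: Gg; move: Is; rewrite /= in_itv.
  move=> <-; have := Hz s s; rewrite norm2_ltE => h.
  have := sqn_ge0 (H (circle s) - z); move: h.
  by rewrite /sqn /dotp /=; lra.
- by rewrite circle0 circle1.
- by rewrite g01.
exists (maxn N N') => n; rewrite geq_max => /andP[Nn N'n].
by rewrite -(N'P n N'n) NP.
Qed.

Lemma dist_curve_gt0 gamma (z : R * R) : unif_cont_on I gamma ->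
  (forall s, I s -> gamma s != z) ->
  exists2 d, 0 < d & forall s, I s -> d <= `|gamma s - z|.
Proof.
move=> ug gz.
have cn : {within I, continuous (fun s => `|gamma s - z|)}.
  apply: unif_cont_within => e /(unif_cont_subc z ug)[r r0 rP]; exists r => // x y Ix Iy xy.
  by apply: le_lt_trans (rP x y Ix Iy xy); exact: ler_dist_dist.
have [|s Is sP] := EVT_min _ cn; first by [].
exists `|gamma s - z|; first by rewrite normr_gt0 subr_eq0; apply: gz.
by move=> t It; apply: sP.
Qed.

(** An admissible map exists: with [d] a lower bound for the sup distance from [z] to the curve, an
    approximation within d/2 has squared Euclidean error at most d^2/2 < d^2. *)
Lemma brouwer_degree_turns gamma G (z : R * R) :
  unif_cont_on I gamma -> extends_curve gamma G -> gamma 0 = gamma 1 ->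
  (forall s, I s -> gamma s != z) ->
  exists N, forall n, (N <= n)%N ->
    brouwer_degree unit_disk G z = turns n (fun s => gamma s - z).
Proof.
move=> ug eG g01 gz; have [cG Gg] := eG.
have [d d0 dP] := dist_curve_gt0 ug gz.
have d2 : 0 < d / 2 by rewrite divr_gt0.
have [H [cH C1H GH reg]] := regular_approximation z cG d2.
have degH : is_brouwer_degree unit_disk G z
    (\sum_(p \in unit_disk `&` H @^-1` [set z]) sgz (jacobian2 H p)).
  exists H; split => // p q pD; rewrite boundary_unit_disk => /circle_surj[s /andP[s0 s1] <-].
  rewrite norm2_ltE [circle s]/circle Gg; last by rewrite s0 ltW.
  have h1 : `|G p - H p| ^+ 2 <= (d / 2) ^+ 2.
    by apply: lerXn2r; rewrite ?nnegrE ?(ltW d2)//; exact: GH.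
  have Is : I s by rewrite /= in_itv /= s0 ltW.
  have h2 : d ^+ 2 <= `|z - gamma s| ^+ 2.
    by rewrite distrC; apply: lerXn2r; rewrite ?nnegrE ?(ltW d0)//; exact: dP.
  have := sqn_le (G p - H p); have := sqn_ge (z - gamma s).
  have : 0 < d ^+ 2 by rewrite exprn_gt0.
  by lra.
have [N NP] := degree_unique ug eG g01 degH.
exists N => n Nn; rewrite NP//; apply: xget_unique => // d' /(degree_unique ug eG g01)[N' N'P].
by rewrite -(NP (maxn N N')) ?leq_maxl// N'P// leq_maxr.
Qed.

Lemma winding_turns gamma (z : R * R) :
  unif_cont_on I gamma -> gamma 0 = gamma 1 -> (forall s, I s -> gamma s != z) ->
  exists N, forall n, (N <= n)%N -> winding gamma z = turns n (fun s => gamma s - z).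
Proof.
move=> ug g01 gz.
have [N NP] := turns_stable (unif_cont_subc z ug)
  (fun s Is => eq_ind_r (fun b => ~~ b) (gz s Is) (subr_eq0 (gamma s) z)).
exists N => n Nn; apply: xget_unique => [G eG|d dP].
  have [N' N'P] := brouwer_degree_turns ug eG g01 gz.
  by rewrite (N'P (maxn N N')) ?leq_maxr//; apply: NP => //; exact: leq_maxl.
have [G eG] := curve_extension ug g01.
rewrite -(dP G eG); have [N' N'P] := brouwer_degree_turns ug eG g01 gz.
by rewrite (N'P (maxn N N')) ?leq_maxr//; apply: NP => //; exact: leq_maxl.
Qed.

(** At the boundary point where [G] equals [z], the strict inequality in [is_brouwer_degree] fails.
    So no degree exists and [brouwer_degree] takes its default value 0. *)
Lemma winding_on_curve gamma (z : R * R) s :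
  unif_cont_on I gamma -> gamma 0 = gamma 1 -> I s -> gamma s = z -> winding gamma z = 0.
Proof.
move=> ug g01 Is gz.
have deg0 G : extends_curve gamma G -> brouwer_degree unit_disk G z = 0.
  move=> [cG Gg]; apply: xgetPN => d [H [_ _ GH _ _]].
  have Gz : G (circle s) = z by rewrite [circle s]/circle Gg// -[_ <= _]/(_ \in `[0, 1]).
  have := GH (circle s) (circle s) (@circle_closure s).
  rewrite Gz subrr norm2_ltE => /(_ _)/wrap[].
    by rewrite boundary_unit_disk /= sqn_circle.
  by apply/negP; rewrite -leNgt [leLHS](_ : _ = 0) ?sqn_ge0// /sqn /= expr0n addr0.
apply: xget_unique => // d dP.
have [G eG] := curve_extension ug g01.
by rewrite -(dP G eG) deg0.
Qed.

End Winding.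

(** * Limits of integrals with geometrically small increments *)

Section TelescopingIntegrals.
Context (d : measure_display) (T : measurableType d) (R : realType).
Variable mu : {measure set T -> \bar R}.

(** The sum of all |F (k+1) - F k| is integrable by monotone convergence, and it dominates every
    [F n] because [F 0] vanishes. *)
Lemma Rintegral_telescoping (F : nat -> T -> R) (w : T -> R) (A q : R) :
  (forall k, measurable_fun setT (F k)) -> (forall x, F 0%N x = 0) ->
  0 <= q < 1 -> 0 <= A ->
  (forall k, \int[mu]_x `|F k.+1 x - F k x|%:E <= (A * q ^+ k)%:E)%E ->
  (forall x, F k x @[k --> \oo] --> w x) ->
  (\int[mu]_x F k x) @[k --> \oo] --> \int[mu]_x w x.
Proof.
move=> mF F0 /andP[q0 q1] A0 Fle Fw.
pose h k x : \bar R := (`|F k.+1 x - F k x|)%:E.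
have mh k : measurable_fun setT (h k).
  apply/measurable_EFinP; apply: measurableT_comp => //.
  by apply: measurable_funB; exact: mF.
have h0 k x : (0 <= h k x)%E by rewrite lee_fin.
pose g x : \bar R := (\sum_(0 <= k <oo) h k x)%E.
have mg : measurable_fun setT g by apply: ge0_emeasurable_sum => // k x _.
have g0 x : (0 <= g x)%E by apply: nneseries_ge0.
have ig : mu.-integrable setT g.
  apply/integrableP; split => //.
  under eq_integral do rewrite gee0_abs//.
  rewrite /g integral_nneseries//.
  apply: (@le_lt_trans _ _ (A / (1 - q))%:E); last exact: ltry.
  apply: lime_le; first by apply: is_cvg_nneseries => k _ _; exact: integral_ge0.
  apply: nearW => n; apply: (@le_trans _ _ (\sum_(0 <= k < n) (A * q ^+ k)%:E)%E).
    by apply: lee_sum => k _; exact: Fle.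
  rewrite sumEFin lee_fin -mulr_sumr ler_wpM2l//.
  rewrite -[leRHS]mul1r ler_pdivlMr ?subr_gt0//.
  have -> : (\sum_(0 <= k < n) q ^+ k) * (1 - q) = 1 - q ^+ n.
    elim: n => [|n IH]; first by rewrite big_geq// mul0r expr0 subrr.
    by rewrite big_nat_recr//= mulrDl IH exprS; ring.
  by rewrite lerBlDr lerDl exprn_ge0.
have mw : measurable_fun setT w.
  by apply: (measurable_fun_cvg (h := F)) => // x _; exact: Fw.
have dom n x : (`|(F n x)%:E| <= g x)%E.
  apply: (le_trans _ (nneseries_lim_ge n _)) => [|k _ _]; last exact: h0.
  rewrite sumEFin lee_fin.
  have -> : F n x = \sum_(0 <= k < n) (F k.+1 x - F k x).
    by rewrite (telescope_sumr (fun k => F k x))// F0 subr0.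
  exact: ler_norm_sum.
have Fw' x : (F n x)%:E @[n --> \oo] --> (w x)%:E.
  by apply: cvg_EFin; [exact: nearW|exact: Fw].
have [iw _ cw] := @dominated_convergence _ T R mu setT measurableT
  (fun n x => (F n x)%:E) (fun x => (w x)%:E) g
  (fun n => iffRL (measurable_EFinP _ _) (mF n)) (iffRL (measurable_EFinP _ _) mw)
  (aeW _ (fun x _ => Fw' x)) ig (aeW _ (fun x n _ => dom n x)).
apply: fine_cvg; rewrite fineK; last exact: integrable_fin_num.
exact: cw.
Qed.

End TelescopingIntegrals.

(** * Integral of the crossing number of one edge *)

Section CrossingIntegral.
Context {R : realType}.
Implicit Types (a b c z : R * R).
Local Notation leb := (@lebesgue_measure R).
Local Notation mu2 := (leb \x leb)%E.

Definition box c (r : R) : set (R * R) :=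
  `[c.1 - r, c.1 + r]%classic `*` `[c.2 - r, c.2 + r]%classic.

Lemma boxP c r z : box c r z <-> `|z - c| <= r.
Proof.
rewrite prod_normE /= ge_max !ler_norml /box /= !in_itv /=; split.
  by move=> [/andP[? ?] /andP[? ?]]; apply/andP; split; apply/andP; split; lra.
by move=> /andP[/andP[? ?] /andP[? ?]]; split; apply/andP; split; lra.
Qed.

Lemma measurable_box c r : measurable (box c r).
Proof. by apply: measurableX; exact: measurable_itv. Qed.

Lemma rect_measure (x0 x1 y0 y1 : R) (b0 b1 b2 b3 : bool) : x0 <= x1 -> y0 <= y1 ->
  mu2 ([set` Interval (BSide b0 x0) (BSide b1 x1)] `*` [set` Interval (BSide b2 y0) (BSide b3 y1)])
  = ((x1 - x0) * (y1 - y0))%:E.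
Proof.
move=> x01 y01; rewrite [LHS]product_measure1E; try exact: measurable_itv.
have len (u v : R) (s s' : bool) : u <= v -> leb [set` Interval (BSide s u) (BSide s' v)] = (v - u)%:E.
  move=> uv; rewrite lebesgue_measure_itv /= lte_fin; case: ltP => h; first by rewrite -EFinB.
  by have -> : v = u by [apply/eqP; rewrite eq_le uv h]; rewrite subrr.
by rewrite [X in (X * _)%E]len// [X in (_ * X)%E]len// -EFinM.
Qed.

Lemma box_measure c r : 0 <= r -> mu2 (box c r) = (4 * r ^+ 2)%:E.
Proof.
move=> r0; have h1 : c.1 - r <= c.1 + r by lra.
have h2 : c.2 - r <= c.2 + r by lra.
rewrite [LHS](rect_measure _ _ _ _ h1 h2).
by congr (_%:E); ring.
Qed.

Lemma measurable_crossing a b :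
  measurable_fun setT (fun z => (crossing (a - z) (b - z))%:~R : R).
Proof.
pose S1 := [set z | a.2 - z.2 < 0] `&` ([set z | 0 <= b.2 - z.2] `&` [set z | 0 < cross (a - z) (b - z)]).
pose S2 := [set z | b.2 - z.2 < 0] `&` ([set z | 0 <= a.2 - z.2] `&` [set z | cross (a - z) (b - z) < 0]).
have gt0 (f : R * R -> R) : measurable_fun setT f -> measurable [set z | 0 < f z].
  move=> mf; have -> : [set z | 0 < f z] = setT `&` f @^-1` `]0, +oo[%classic.
    by apply/seteqP; split => z /=; rewrite in_itv /= andbT; [move=> ->|case].
  exact: mf.
have ge0 (f : R * R -> R) : measurable_fun setT f -> measurable [set z | 0 <= f z].
  move=> mf; have -> : [set z | 0 <= f z] = setT `&` f @^-1` `[0, +oo[%classic.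
    by apply/seteqP; split => z /=; rewrite in_itv /= andbT; [move=> ->|case].
  exact: mf.
have lt0 (f : R * R -> R) : measurable_fun setT f -> measurable [set z | f z < 0].
  move=> mf; have -> : [set z | f z < 0] = setT `&` f @^-1` `]-oo, 0[%classic.
    by apply/seteqP; split => z /=; rewrite in_itv /=; [move=> ->|case].
  exact: mf.
have m2 (c : R * R) : measurable_fun setT (fun z : R * R => c.2 - z.2) by apply: measurable_funB.
have m1 (c : R * R) : measurable_fun setT (fun z : R * R => c.1 - z.1) by apply: measurable_funB.
have mc : measurable_fun setT (fun z : R * R => cross (a - z) (b - z)).
  apply: measurable_funB; apply: measurable_funM; by [exact: m1|exact: m2].
have mS1 : measurable S1.
  by apply: measurableI; [exact: lt0|apply: measurableI; [exact: ge0|exact: gt0]].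
have mS2 : measurable S2.
  by apply: measurableI; [exact: lt0|apply: measurableI; [exact: ge0|exact: lt0]].
have -> : (fun z => (crossing (a - z) (b - z))%:~R : R) = (fun z => \1_S1 z - \1_S2 z).
  apply/funext => z; rewrite /crossing rmorphB /= !indicE.
  have ind (c1 c2 c3 : bool) (S : set (R * R)) : (S z <-> [/\ c1, c2 & c3]) ->
      (([&& c1, c2 & c3]%:R : int)%:~R : R) = (z \in S)%:R.
    move=> h; have -> : (z \in S) = [&& c1, c2 & c3].
      by apply/idP/idP => [/set_mem/h[-> -> ->]//|/and3P H]; apply/mem_set/h.
    by case: [&& c1, c2 & c3].
  by congr (_ - _); apply: ind; rewrite /=; split => [[? []]|[]].
by apply: measurable_funB; exact: measurable_indic.
Qed.

Lemma integrable_supp (f : R * R -> R) c (r K : R) : measurable_fun setT f -> 0 <= r ->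
  (forall z, `|f z| <= K * \1_(box c r) z) -> mu2.-integrable setT (EFin \o f).
Proof.
move=> mf r0 fK.
have K0 : 0 <= K.
  have := le_trans (normr_ge0 _) (fK c); rewrite indicE mem_set ?mulr1//.
  by apply/boxP; rewrite subrr normr0.
apply/integrableP; split; first exact/measurable_EFinP.
apply: (@le_lt_trans _ _ (\int[mu2]_z (K%:E * (\1_(box c r) z)%:E))%E).
  apply: ge0_le_integral => //.
  - by apply: measurableT_comp => //; exact/measurable_EFinP.
  - apply: measurable_funeM; apply/measurable_EFinP; apply: measurable_indic; exact: measurable_box.
  - by move=> z _; rewrite /= -EFinM lee_fin.
rewrite ge0_integralZl_EFin//; last first.
  by apply/measurable_EFinP; apply: measurable_indic; exact: measurable_box.
rewrite integral_indic//; last exact: measurable_box.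
by rewrite setIT [X in (_ * X)%E]box_measure// -EFinM ltry.
Qed.

Lemma Rintegral_sum_nat (f : nat -> R * R -> R) n :
  (forall i, mu2.-integrable setT (EFin \o f i)) ->
  \int[mu2]_z (\sum_(0 <= i < n) f i z) = \sum_(0 <= i < n) \int[mu2]_z f i z.
Proof.
move=> fi; elim: n => [|n IH].
  rewrite big_geq//; under eq_Rintegral do rewrite big_geq//.
  by rewrite Rintegral_cst// mul0r.
rewrite big_nat_recr//= -IH -RintegralD//.
  by apply: eq_Rintegral => z _; rewrite big_nat_recr.
rewrite (_ : _ \o _ = fun z => (\sum_(0 <= i < n) (f i z)%:E)%E).
  by apply: (integrable_sum measurableT) => i _; exact: fi.
by apply/funext => z /=; rewrite sumEFin.
Qed.

Lemma Rintegral_rect (x0 x1 y0 y1 : R) (b0 b1 b2 b3 : bool) : x0 <= x1 -> y0 <= y1 ->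
  \int[mu2]_z (\1_([set` Interval (BSide b0 x0) (BSide b1 x1)] `*`
     [set` Interval (BSide b2 y0) (BSide b3 y1)]) z : R) = (x1 - x0) * (y1 - y0).
Proof.
move=> x01 y01; rewrite /Rintegral integral_indic//; last by apply: measurableX; exact: measurable_itv.
by rewrite setIT [X in fine X]rect_measure.
Qed.

(** The rightward half-line from z crosses the edge when z lies to its left at a height in ]a.2,
    b.2]. Within the box such points form the rectangle [Rg], up to points of [Re], a rectangle of
    width 2 |b.1 - a.1| around the abscissa of [a]. *)
Lemma crossing_edge_up (M : R) a b : 0 <= M -> `|a| <= M -> `|b| <= M -> a.2 <= b.2 ->
  `|\int[mu2]_z ((crossing (a - z) (b - z))%:~R * \1_(box 0 M) z) - (b.2 - a.2) * (a.1 + M)|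
  <= 2 * `|b - a| ^+ 2.
Proof.
move=> M0 aM bM ab.
have [a1M a2M] : `|a.1| <= M /\ `|a.2| <= M.
  by split; [exact: le_trans (norm_fst_le _) aM|exact: le_trans (norm_snd_le _) aM].
have [b1M b2M] : `|b.1| <= M /\ `|b.2| <= M.
  by split; [exact: le_trans (norm_fst_le _) bM|exact: le_trans (norm_snd_le _) bM].
move: a1M a2M b1M b2M; rewrite !ler_norml => /andP[a1 a1'] /andP[a2 a2'] /andP[b1 b1'] /andP[b2 b2'].
pose D1 := `|b.1 - a.1|.
pose f z : R := (crossing (a - z) (b - z))%:~R * \1_(box 0 M) z.
pose Rg := `[- M, a.1[%classic `*` `]a.2, b.2]%classic : set (R * R).
pose Re := `[a.1 - D1, a.1 + D1]%classic `*` `]a.2, b.2]%classic : set (R * R).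
have D10 : 0 <= D1 by rewrite normr_ge0.
have mRg : measurable Rg by apply: measurableX; exact: measurable_itv.
have mRe : measurable Re by apply: measurableX; exact: measurable_itv.
have mf : measurable_fun setT f.
  apply: measurable_funM; first exact: measurable_crossing.
  by apply: measurable_indic; exact: measurable_box.
have indbox (x : R * R) (S : set (R * R)) (r : R) : (forall y, S y -> box 0 r y) -> `|\1_S x| <= 1 * \1_(box 0 r) x :> R.
  move=> Sb; rewrite mul1r !indicE; have [/set_mem/Sb Sx|_] := boolP (x \in S).
    by rewrite normr1 mem_set.
  by rewrite normr0.
have fi : mu2.-integrable setT (EFin \o f).
  apply: (@integrable_supp _ 0 M 1) => // z; rewrite mul1r /f normrM [`|\1__ z|]ger0_norm//.
  rewrite ler_piMl// -intr_norm -[leRHS]/(1%:~R : R) ler_int; exact: crossing_le1.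
have gi : mu2.-integrable setT (EFin \o (\1_Rg : R * R -> R)).
  apply: (@integrable_supp _ 0 M 1) => //.
  move=> z; apply: indbox => y [] /=; rewrite !in_itv /= => /andP[? ?] /andP[? ?].
  by apply/boxP; rewrite subr0 prod_normE ge_max !ler_norml; apply/andP; split; apply/andP; split; lra.
have ei : mu2.-integrable setT (EFin \o (\1_Re : R * R -> R)).
  apply: (@integrable_supp _ 0 (M + D1) 1) => //; first lra.
  move=> z; apply: indbox => y [] /=; rewrite !in_itv /= => /andP[? ?] /andP[? ?].
  by apply/boxP; rewrite subr0 prod_normE ge_max !ler_norml; apply/andP; split; apply/andP; split; lra.
have key z : `|f z - \1_Rg z| <= \1_Re z.
  have inRg : \1_Rg z = ((- M <= z.1) && (z.1 < a.1) && ((a.2 < z.2) && (z.2 <= b.2)))%:R :> R.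
    rewrite indicE; congr (_%:R); congr nat_of_bool; apply/idP/idP.
      by move=> /set_mem[]; rewrite /= !in_itv /= => -> ->.
    by move=> /andP[h1 h2]; apply/mem_set; split; rewrite /= in_itv.
  have inRe : \1_Re z = ((a.1 - D1 <= z.1) && (z.1 <= a.1 + D1) && ((a.2 < z.2) && (z.2 <= b.2)))%:R :> R.
    rewrite indicE; congr (_%:R); congr nat_of_bool; apply/idP/idP.
      by move=> /set_mem[]; rewrite /= !in_itv /= => -> ->.
    by move=> /andP[h1 h2]; apply/mem_set; split; rewrite /= in_itv.
  have inD : \1_(box 0 M) z = ((- M <= z.1) && (z.1 <= M) && ((- M <= z.2) && (z.2 <= M)))%:R :> R.
    rewrite indicE; congr (_%:R); congr nat_of_bool; apply/idP/idP.
      by move=> /set_mem/boxP; rewrite subr0 prod_normE ge_max !ler_norml.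
    by move=> h; apply/mem_set/boxP; rewrite subr0 prod_normE ge_max !ler_norml.
  have sub2 : (a.2 - z.2 < 0) = (a.2 < z.2) by rewrite subr_lt0.
  have sub2' : (0 <= b.2 - z.2) = (z.2 <= b.2) by rewrite subr_ge0.
  have fE : f z = ([&& a.2 < z.2, z.2 <= b.2 & 0 < cross (a - z) (b - z)])%:R * \1_(box 0 M) z.
    rewrite /f /crossing /= sub2 sub2' subr_lt0 subr_ge0 rmorphB /=.
    have -> : [&& b.2 < z.2, z.2 <= a.2 & cross (a - z) (b - z) < 0] = false.
      by apply/negP => /and3P[h1 h2 _]; lra.
    by rewrite subr0; case: [&& _, _ & _].
  have cE : cross (a - z) (b - z) = (a.1 - z.1) * (b.2 - z.2) + (z.2 - a.2) * (b.1 - z.1).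
    by rewrite /cross /=; ring.
  rewrite fE inRg inRe inD.
  have [h1|h1] := ltP a.2 z.2; last by rewrite !andbF !mul0r subrr normr0.
  have [h2|h2] := leP z.2 b.2; last by rewrite !andbF !mul0r subrr normr0.
  rewrite /= !andbT.
  have -> : (- M <= z.2) = true by lra.
  have -> : (z.2 <= M) = true by lra.
  rewrite !andbT.
  have n1 := ler_norm (b.1 - a.1); have := ler_norm (a.1 - b.1); rewrite distrC -/D1 => n2.
  rewrite -/D1 in n1.
  have [h3|h3] := leP (a.1 - D1) z.1; last first.
    have pos : 0 < cross (a - z) (b - z).
      rewrite cE ltr_wpDl//; first by rewrite mulr_ge0//; lra.
      by rewrite mulr_gt0//; lra.
    have -> : (z.1 < a.1) = true by lra.
    have -> : (z.1 <= M) = true by lra.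
    by rewrite pos /= !andbT mul1r subrr normr0.
  have [h4|h4] := leP z.1 (a.1 + D1); last first.
    have -> : (0 < cross (a - z) (b - z)) = false.
      apply/negbTE; rewrite -leNgt cE.
      have : (a.1 - z.1) * (b.2 - z.2) <= 0 by rewrite mulr_le0_ge0//; lra.
      have : (z.2 - a.2) * (b.1 - z.1) <= 0 by rewrite mulr_ge0_le0//; lra.
      by lra.
    have -> : (z.1 < a.1) = false by apply/negP; lra.
    by rewrite !andbF mul0r subrr normr0.
  case: (0 < cross _ _); case: (_ && (z.1 <= M)); case: (_ && (z.1 < a.1));
    rewrite /= ?mul0r ?mul1r ?subr0 ?sub0r ?subrr ?normrN ?normr0 ?normr1 ?ler01 ?lexx//.
have -> : (b.2 - a.2) * (a.1 + M) = \int[mu2]_z (\1_Rg z : R).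
  rewrite /Rg Rintegral_rect//; last lra.
rewrite -ler_norml -RintegralB//.
apply: (le_trans (le_normr_Rintegral _ _)) => //; first exact: (integrableB _ fi gi).
apply: (@le_trans _ _ (\int[mu2]_z (\1_Re z : R))).
  apply: le_Rintegral => //.
  have := integrable_abse (integrableB measurableT fi gi); apply: eq_integrable => // z _.
  by move=> z _; exact: key.
rewrite /Re Rintegral_rect//; last lra.
have -> : a.1 + D1 - (a.1 - D1) = 2 * D1 by ring.
rewrite expr2 -mulrA; rewrite ler_wpM2l//; apply: ler_pM => //; first lra.
  exact: (norm_fst_le (b - a)).
have := norm_snd_le (b - a); apply: le_trans; rewrite ger0_norm//=; lra.
Qed.

End CrossingIntegral.

(** * Green formula for the winding number of a Hölder loop *)

Section WindingIntegral.
Context {R : realType}.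
Implicit Types (a b z : R * R).
Local Notation leb := (@lebesgue_measure R).
Local Notation mu2 := (leb \x leb)%E.
Local Notation I := (`[0, 1]%classic : set R).

(** A descending edge is reversed; moving the reference point from [b] to [a] costs one more |b -
    a|^2, whence the constant 3. *)
Lemma crossing_edge (M : R) a b : 0 <= M -> `|a| <= M -> `|b| <= M ->
  `|\int[mu2]_z ((crossing (a - z) (b - z))%:~R * \1_(box 0 M) z) - (b.2 - a.2) * (a.1 + M)|
  <= 3 * `|b - a| ^+ 2.
Proof.
move=> M0 aM bM; have [ab|/ltW ab] := leP a.2 b.2.
  apply: (le_trans (crossing_edge_up M0 aM bM ab)).
  by rewrite ler_wpM2r ?sqr_ge0//; lra.
have h := crossing_edge_up M0 bM aM ab.
have -> : \int[mu2]_z ((crossing (a - z) (b - z))%:~R * \1_(box 0 M) z) =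
   - \int[mu2]_z ((crossing (b - z) (a - z))%:~R * \1_(box 0 M) z).
  rewrite -mulN1r -RintegralZl//.
    by apply: eq_Rintegral => z _; rewrite crossingN rmorphN /= mulN1r mulNr.
  apply: (@integrable_supp _ _ 0 M 1) => // [|z].
    apply: measurable_funM; first exact: measurable_crossing.
    by apply: measurable_indic; exact: measurable_box.
  rewrite mul1r normrM [`|\1__ z|]ger0_norm//.
  by rewrite ler_piMl// -intr_norm -[leRHS]/(1%:~R : R) ler_int; exact: crossing_le1.
set J := \int[mu2]_z _ in h *.
have -> : - J - (b.2 - a.2) * (a.1 + M) =
   - (J - (a.2 - b.2) * (b.1 + M)) + (a.2 - b.2) * (a.1 - b.1) by ring.
apply: (le_trans (ler_normD _ _)); rewrite normrN normrM.
have h1 := norm_fst_le (b - a); have h2 := norm_snd_le (b - a).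
have : `|a.2 - b.2| * `|a.1 - b.1| <= `|b - a| * `|b - a|.
  by apply: ler_pM => //; rewrite distrC.
by rewrite (distrC a b) in h; rewrite expr2 in h *; lra.
Qed.

Variables (gamma : R -> R * R) (C rho : R).
Hypotheses (C0 : 0 <= C) (rho0 : 0 <= rho) (rho1 : 2 * rho ^+ 2 < 1).
Hypothesis gammaP : forall k s t, I s -> I t -> `|s - t| <= (2 ^ k)%:R^-1 ->
  `|gamma s - gamma t| <= C * rho ^+ k.
Hypothesis gamma01 : gamma 0 = gamma 1.

Let p k i := gamma (i%:R / (2 ^ k)%:R).
Let dk k := C * rho ^+ k.

Lemma dk_ge0 k : 0 <= dk k.
Proof. by rewrite mulr_ge0// exprn_ge0. Qed.

Lemma rho_lt1 : rho < 1.
Proof.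
rewrite ltNge; apply/negP => h; have h' : 1 <= rho ^+ 2 by rewrite exprn_ege1.
by have := rho1; lra.
Qed.

Lemma dk_small (e : R) : 0 < e -> exists k, dk k < e.
Proof.
move=> e0.
have /cvgrPdist_lt : geometric C rho k @[k --> \oo] --> 0.
  by apply: cvg_geometric; rewrite ger0_norm// rho_lt1.
move=> /(_ e e0)[N _ NP]; exists N; have := NP N (leqnn _).
by rewrite /= sub0r normrN /geometric /= ger0_norm ?dk_ge0.
Qed.

Lemma gamma_unif_cont : unif_cont_on I gamma.
Proof.
move=> e /dk_small[k kP]; exists ((2 ^ k)%:R^-1); first by rewrite invr_gt0 ltr0n expn_gt0.
move=> s t Is It st; apply: le_lt_trans kP; apply: gammaP => //; exact: ltW.
Qed.

Lemma dyadic_in k i : (i <= 2 ^ k)%N -> I (i%:R / (2 ^ k)%:R).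
Proof. by move=> ik; apply: itv01 => //; rewrite expn_gt0. Qed.

Lemma step_le k i : (i < 2 ^ k)%N -> `|p k i.+1 - p k i| <= dk k.
Proof.
move=> ik; apply: gammaP; [exact: dyadic_in|exact/dyadic_in/ltnW|].
by rewrite -mulrBl -natr1 addrC addKr mul1r ger0_norm.
Qed.

Let F k z : R := (turns (2 ^ k) (fun s => gamma s - z))%:~R.

Lemma FE k z : F k z = \sum_(0 <= i < 2 ^ k) (crossing (p k i - z) (p k i.+1 - z))%:~R.
Proof. by rewrite /F /turns rmorph_sum. Qed.

Lemma measurable_F k : measurable_fun setT (F k).
Proof.
rewrite (_ : F k = fun z => \sum_(0 <= i < 2 ^ k) (crossing (p k i - z) (p k i.+1 - z))%:~R).
  by apply: measurable_sum => i; exact: measurable_crossing.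
by apply/funext => z; exact: FE.
Qed.

Lemma turns_half_plane n (v : R * R) z : (0 < n)%N ->
  (forall s, I s -> 0 < dotp v (gamma s - z)) -> turns n (fun s => gamma s - z) = 0.
Proof.
move=> n0 h; rewrite /turns.
rewrite (@crossing_path _ (fun i => gamma (i%:R / n%:R) - z) 0 n v)//.
  by rewrite mul0r divff ?pnatr_eq0 -?lt0n// gamma01 crossingxx.
by move=> i /andP[_ ik]; apply: h; apply: itv01.
Qed.

(** Seen from a point outside the box, the whole curve lies in an open half-plane. *)
Lemma F_outside (M : R) k z : (forall s, I s -> `|gamma s| < M) -> ~ box 0 M z -> F k z = 0.
Proof.
move=> gM nb; rewrite /F.
have lim s : I s -> [/\ (gamma s).1 < M, - M < (gamma s).1, (gamma s).2 < M & - M < (gamma s).2].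
  move=> /gM; rewrite prod_normE gt_max !ltr_norml => /andP[/andP[? ?] /andP[? ?]].
  by split.
suff [v vP] : exists v : R * R, forall s, I s -> 0 < dotp v (gamma s - z).
  by rewrite (turns_half_plane _ vP)// expn_gt0.
have : (M < z.1) || (z.1 < - M) || (M < z.2) || (z.2 < - M).
  apply: contrapT => /negP; rewrite !negb_or -!leNgt => /andP[/andP[/andP[h1 h2] h3] h4].
  by apply: nb; split; rewrite /= in_itv /=; apply/andP; split; lra.
move=> /orP[/orP[/orP[]|]|] h; [exists (-1, 0)|exists (1, 0)|exists (0, -1)|exists (0, 1)] => s /lim[? ? ? ?];
  rewrite /dotp /=; lra.
Qed.

(** [crossing_edge] is summed over the 2^k edges; the terms in [M] telescope to 0 on a closed
    polygon, and the errors add up to 3 C^2 (2 rho^2)^k. *)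
Lemma F_integral k (M : R) : (forall s, I s -> `|gamma s| < M) ->
  `|\int[mu2]_z F k z - \sum_(0 <= i < 2 ^ k) ((p k i.+1).2 - (p k i).2) * (p k i).1|
  <= 3 * C ^+ 2 * (2 * rho ^+ 2) ^+ k.
Proof.
move=> gM.
have M0 : 0 <= M.
  by apply/ltW/(le_lt_trans (normr_ge0 (gamma 0)))/gM; rewrite /= in_itv /= lexx ler01.
have pM i : (i <= 2 ^ k)%N -> `|p k i| <= M by move=> ik; apply/ltW/gM; exact: dyadic_in.
pose f i z : R := (crossing (p k i - z) (p k i.+1 - z))%:~R * \1_(box 0 M) z.
have fint i : mu2.-integrable setT (EFin \o f i).
  apply: (@integrable_supp _ _ 0 M 1) => // [|z].
    apply: measurable_funM; first exact: measurable_crossing.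
    by apply: measurable_indic; exact: measurable_box.
  rewrite mul1r normrM [`|\1__ z|]ger0_norm//.
  by rewrite ler_piMl// -intr_norm -[leRHS]/(1%:~R : R) ler_int; exact: crossing_le1.
have -> : \int[mu2]_z F k z = \sum_(0 <= i < 2 ^ k) \int[mu2]_z f i z.
  rewrite -Rintegral_sum_nat//; apply: eq_Rintegral => z _.
  rewrite /f -mulr_suml -FE indicE; have [|nb] := boolP (z \in _); first by rewrite mulr1.
  by rewrite mulr0; apply: F_outside gM _; move: nb; rewrite notin_setE.
have -> : \sum_(0 <= i < 2 ^ k) ((p k i.+1).2 - (p k i).2) * (p k i).1 =
   \sum_(0 <= i < 2 ^ k) ((p k i.+1).2 - (p k i).2) * ((p k i).1 + M).
  under [RHS]eq_bigr do rewrite mulrDr.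
  rewrite big_split /= -mulr_suml (telescope_sumr (fun i => (p k i).2))//.
  by rewrite /p mul0r divff ?pnatr_eq0 -?lt0n ?expn_gt0// gamma01 subrr mul0r addr0.
rewrite -sumrB; apply: (le_trans (ler_norm_sum _ _ _)).
apply: (@le_trans _ _ (\sum_(0 <= i < 2 ^ k) 3 * (dk k) ^+ 2)).
  rewrite !big_nat; apply: ler_sum => i /andP[_ ik].
  apply: (le_trans (crossing_edge M0 (pM i (ltnW ik)) (pM i.+1 ik))).
  by rewrite ler_wpM2l//; apply: lerXn2r; rewrite ?nnegrE ?dk_ge0//; exact: step_le.
rewrite sumr_const_nat subn0 -[_ *+ (2 ^ k)]mulr_natr /dk natrX le_eqVlt; apply/orP; left; apply/eqP.
by rewrite exprMn -exprM mulnC exprMn -exprM; ring.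
Qed.

(** Refinement replaces each edge by two sides of a triangle. If z is farther than [3 * dk k] from
    the first vertex, it sees the triangle in a half-plane and the count is unchanged; otherwise
    three crossing numbers, each at most 1 in absolute value, are involved. *)
Lemma F_step k z :
  `|F k.+1 z - F k z| <= \sum_(0 <= i < 2 ^ k) 3 * \1_(box (p k i) (3 * dk k)) z.
Proof.
have n0 : (2 ^ k)%:R != 0 :> R by rewrite pnatr_eq0 -lt0n expn_gt0.
rewrite !FE expnSr (sum_blocks (fun i => (crossing (p k.+1 i - z) (p k.+1 i.+1 - z))%:~R)) -sumrB.
apply: (le_trans (ler_norm_sum _ _ _)); rewrite !big_nat; apply: ler_sum => i /andP[_ ik].
rewrite big_nat_recr//= big_nat1 addn0.
have pE : p k.+1 (i * 2) = p k i.
  by rewrite /p expnSr !natrM; congr (gamma _); field.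
have pE' : p k.+1 (i * 2 + 1).+1 = p k i.+1.
  rewrite /p expnSr (_ : (i * 2 + 1).+1 = (i.+1 * 2)%N); last by lia.
  by rewrite !natrM; congr (gamma _); field.
rewrite pE' pE -[(i * 2).+1]addn1.
set a := p k i; set b := p k.+1 (i * 2 + 1); set c := p k i.+1.
have ba : `|b - a| <= dk k.
  apply: gammaP.
  - by apply: dyadic_in; rewrite expnSr; move: (2 ^ k)%N ik => m ik; lia.
  - exact/dyadic_in/ltnW.
  - rewrite expnSr !natrM natrD natrM.
    have -> : (i%:R * 2 + 1) / ((2 ^ k)%:R * 2) - i%:R / (2 ^ k)%:R = 2^-1 / (2 ^ k)%:R :> R by field.
    by rewrite ger0_norm ?divr_ge0// ler_piMl ?invr_ge0//; lra.
have ca : `|c - a| <= dk k by exact: step_le.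
have d0 := dk_ge0 k.
rewrite indicE; have [zin|zout] := boolP (z \in _).
  rewrite mulr1.
  have := crossing_le1 (a - z) (b - z); have := crossing_le1 (b - z) (c - z); have := crossing_le1 (a - z) (c - z).
  rewrite -!(ler_int R) !intr_norm !ler_norml => /andP[? ?] /andP[? ?] /andP[? ?].
  by apply/andP; split; lra.
have far : 3 * dk k < `|a - z|.
  by rewrite ltNge; apply/negP => h; move: zout; rewrite notin_setE; apply; apply/boxP; rewrite distrC.
have va x : `|x - a| <= dk k -> 0 < dotp (a - z) (x - z).
  move=> xa; have -> : x - z = (a - z) + (x - a) by rewrite [RHS]addrC subrKA.
  rewrite dotpDr -(opprK (dotp _ (x - a))) subr_gt0; apply: lt_le_trans (dotp_ge _).
  apply: (le_lt_trans (ler_norm _)); rewrite normrN; apply: (le_lt_trans (dotp_le _ _)).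
  rewrite expr2 -mulrA mulrCA ltr_pM2l; first by lra.
  lra.
have aa : `|a - a| <= dk k by rewrite subrr normr0.
have := crossing_triangle (va a aa) (va b ba) (va c ca); rewrite (crossingN (a - z) (c - z)).
move=> /eqP; rewrite subr_eq0 => /eqP e.
by rewrite -rmorphD /= e subrr normr0 mulr0.
Qed.

(** The image of the curve ([in_E]), written as a countable intersection of finite unions of boxes
    so that measurability is immediate. *)
Let E := \bigcap_k \bigcup_(i in [set i | (i < 2 ^ k)%N]) box (p k i) (dk k).

Lemma measurable_E : measurable E.
Proof.
apply: bigcap_measurableType => k _; apply: bigcup_measurable => i _; exact: measurable_box.
Qed.

Lemma in_E z : E z <-> exists2 s, I s & gamma s = z.
Proof.
split => [Ez|[s Is <-] k _].
  apply: contrapT => nex.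
  have gz s : I s -> gamma s != z by move=> Is; apply/eqP => e; apply: nex; exists s.
  have [d d0 dP] := dist_curve_gt0 gamma_unif_cont gz.
  have [k kd] := dk_small d0.
  have [i ik] := Ez k Logic.I; move=> /boxP; rewrite distrC => h.
  by have := dP _ (dyadic_in (ltnW ik)); rewrite -/(p k i); lra.
have n0 : 0 < (2 ^ k)%:R :> R by rewrite ltr0n expn_gt0.
move: (Is); rewrite /= in_itv /= => /andP[s0 s1].
have [->|sn1] := eqVneq s 1.
  exists 0%N; first by rewrite /= expn_gt0.
  by apply/boxP; rewrite /p mul0r gamma01 subrr normr0 dk_ge0.
have {}s1 : s < 1 by rewrite lt_neqAle sn1.
have h0 : 0 <= (2 ^ k)%:R * s by rewrite mulr_ge0// ltW.
have /andP[h1 h2] := truncn_itv h0.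
set i := Num.truncn _ in h1 h2.
have ik : (i < 2 ^ k)%N.
  by rewrite -(ltr_nat R); apply: le_lt_trans h1 _; rewrite gtr_pMr.
exists i => //; apply/boxP; apply: gammaP => //; first exact/dyadic_in/ltnW.
rewrite -natr1 in h2.
have -> : s - i%:R / (2 ^ k)%:R = ((2 ^ k)%:R * s - i%:R) / (2 ^ k)%:R by field; rewrite gt_eqF.
by rewrite ger0_norm ?divr_ge0 ?subr_ge0// ler_piMl ?invr_ge0//; lra.
Qed.

(** The 2^k boxes of level k have total area 4 C^2 (2 rho^2)^k, which tends to 0. *)
Lemma E_null : mu2 E = 0%E.
Proof.
apply/eqP; rewrite eq_le measure_ge0 andbT.
apply/lee_addgt0Pr => e e0; rewrite add0e.
have q1 : `|2 * rho ^+ 2| < 1 by rewrite ger0_norm ?mulr_ge0 ?sqr_ge0.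
have /cvgrPdist_lt : geometric (4 * C ^+ 2) (2 * rho ^+ 2) k @[k --> \oo] --> 0 by exact: cvg_geometric.
move=> /(_ e e0)[k _ /(_ k (leqnn _))]; rewrite /= sub0r normrN /geometric /=.
rewrite ger0_norm ?mulr_ge0 ?sqr_ge0 ?exprn_ge0 ?mulr_ge0 ?sqr_ge0// => h.
have := @measure_union_le R _ _ mu2 nat (iota 0 (2 ^ k)) (fun i => box (p k i) (dk k)) (4 * dk k ^+ 2) E.
move=> /(_ _ _ measurable_E)/wrap[]//.
- by move=> i; exact: measurable_box.
- by move=> i; rewrite [X in (X <= _)%E]box_measure ?dk_ge0.
move=> /(_ _)/wrap[].
  move=> z /(_ k Logic.I)[i ik zi]; apply/List.Exists_exists; exists i; split => //.
  have : i \in iota 0 (2 ^ k) by rewrite mem_iota.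
  elim: (iota _ _) => // a t IH; rewrite in_cons => /predU1P[->|yt]; first by left.
  by right; exact: IH.
move=> hle; apply: (le_trans hle); rewrite size_iota lee_fin.
apply: le_trans (ltW h); rewrite natrX le_eqVlt; apply/orP; left; apply/eqP.
rewrite /dk [(C * _) ^+ 2]exprMn [(2 * _) ^+ k]exprMn -!exprM mulnC; ring.
Qed.

(** Off the curve the winding number is the eventual value of [F k]. [F_step] makes the integrals of
    the increments geometrically small, and [F_integral] identifies the integral of [F k] with a
    left sum of x dy up to an error tending to 0. *)
Lemma winding_integral :
  (\sum_(0 <= i < 2 ^ k) (p k i).1 * ((p k i.+1).2 - (p k i).2)) @[k --> \oo] -->
  \int[mu2]_(z in [set: R * R]) (winding gamma z)%:~R.
Proof.
(* Cutting off the curve, where [winding] is 0 by default, makes the convergence hold at every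
   point. *)
pose G k z : R := F k z * \1_(~` E) z.
have q0 : 0 <= 2 * rho ^+ 2 by rewrite mulr_ge0// sqr_ge0.
have mG k : measurable_fun setT (G k).
  apply: measurable_funM; first exact: measurable_F.
  by apply: measurable_indic; apply: measurableC; exact: measurable_E.
have cvG : (\int[mu2]_z G k z) @[k --> \oo] --> \int[mu2]_z (winding gamma z)%:~R.
  (* 108 = 3 * 4 * 3^2: jumps of at most 3 on each of 2^k boxes of area 4 (3 [dk k])^2. *)
  apply: (@Rintegral_telescoping _ _ _ mu2 G _ (108 * C ^+ 2) (2 * rho ^+ 2)) => //.
  - move=> z; rewrite /G /F expn0 /turns big_nat1 divr1 divr1 gamma01.
    by rewrite crossingxx mul0r.
  - by rewrite q0.
  - by rewrite mulr_ge0// sqr_ge0.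
  - move=> k.
    pose f i z : \bar R := (3%:E * (\1_(box (p k i) (3 * dk k)) z)%:E)%E.
    have mf i : measurable_fun setT (f i).
      apply: measurable_funeM; apply/measurable_EFinP; apply: measurable_indic; exact: measurable_box.
    apply: (@le_trans _ _ (\int[mu2]_z (\sum_(0 <= i < 2 ^ k) f i z))%E).
      apply: ge0_le_integral => //.
      + by apply/measurable_EFinP; apply: measurableT_comp => //; apply: measurable_funB; exact: mG.
      + exact: emeasurable_sum.
      + move=> z _; rewrite /f; under eq_bigr do rewrite -EFinM.
        rewrite sumEFin lee_fin; apply: le_trans (F_step k z).
        rewrite /G -mulrBl normrM ler_piMr// indicE; case: (_ \in _); by rewrite ?normr1 ?normr0.
    rewrite ge0_integral_sum//; last by move=> i z _; rewrite /f -EFinM lee_fin mulr_ge0.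
    apply: (@le_trans _ _ (\sum_(0 <= i < 2 ^ k) (3 * (4 * (3 * dk k) ^+ 2))%:E)%E).
      apply: lee_sum => i _; rewrite /f ge0_integralZl_EFin//; last first.
        by apply/measurable_EFinP; apply: measurable_indic; exact: measurable_box.
      rewrite integral_indic//; last exact: measurable_box.
      by rewrite setIT [X in (_ * X <= _)%E]box_measure; [rewrite EFinM|apply: mulr_ge0 => //; exact: dk_ge0].
    rewrite sumEFin lee_fin sumr_const_nat subn0 -[_ *+ (2 ^ k)]mulr_natr natrX.
    rewrite le_eqVlt; apply/orP; left; apply/eqP.
    rewrite /dk [(3 * _) ^+ 2]exprMn [(C * _) ^+ 2]exprMn [(2 * _) ^+ k]exprMn -!exprM mulnC; ring.
  - move=> z; have [/in_E[s Is gs]|nE] := pselect (E z).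
      rewrite (winding_on_curve gamma_unif_cont gamma01 Is gs).
      have -> : (fun k => G k z) = (fun=> 0); last exact: cvg_cst.
      apply/funext => k; rewrite /G indicE (_ : (z \in _) = false) ?mulr0//.
      by apply/negP => /set_mem; apply; apply/in_E; exists s.
    have gz s : I s -> gamma s != z by move=> Is; apply/eqP => e; apply: nE; apply/in_E; exists s.
    have [N NP] := winding_turns gamma_unif_cont gamma01 gz.
    apply: cvg_near_cst; exists N => // k /= Nk.
    rewrite /G indicE mem_set// mulr1 /F -(NP (2 ^ k)%N)//.
    by apply: (leq_trans Nk); apply/ltnW/ltn_expl.
have GF k : \int[mu2]_z G k z = \int[mu2]_z F k z.
  rewrite /Rintegral; congr fine; apply: ae_eq_integral => //.
  - by apply/measurable_EFinP; exact: mG.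
  - by apply/measurable_EFinP; exact: measurable_F.
  - exists E; split; [exact: measurable_E|exact: E_null|].
    move=> z /= nz; apply: contrapT => nE; apply: nz => _.
    by rewrite /G indicE mem_set// mulr1.
have [M0 M00 M0P] := unif_cont_bounded (@segment_compact R 0 1) gamma_unif_cont.
have gM s : I s -> `|gamma s| < M0 + 1 by move=> /M0P; lra.
have dF : (\sum_(0 <= i < 2 ^ k) ((p k i.+1).2 - (p k i).2) * (p k i).1 - \int[mu2]_z F k z)
    @[k --> \oo] --> (0 : R).
  apply/cvgrPdist_lt => e e0.
  have q1 : `|2 * rho ^+ 2| < 1 by rewrite ger0_norm.
  have /cvgrPdist_lt : geometric (3 * C ^+ 2) (2 * rho ^+ 2) k @[k --> \oo] --> 0 by exact: cvg_geometric.
  move=> /(_ e e0); apply: filterS => k; rewrite !sub0r !normrN => h.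
  rewrite distrC; apply: (le_lt_trans (F_integral k gM)).
  by apply: le_lt_trans h; exact: ler_norm.
set l := Rintegral _ _ _; rewrite -[l]add0r.
rewrite (_ : (fun k => _) = (fun k => \sum_(0 <= i < 2 ^ k) ((p k i.+1).2 - (p k i).2) * (p k i).1 -
  \int[mu2]_z F k z) \+ (fun k => \int[mu2]_z G k z)); first exact: cvgD.
by apply/funext => k; rewrite /= GF subrK; apply: eq_bigr => i _; rewrite mulrC.
Qed.

End WindingIntegral.

(** * Changing an integrand on a null set *)

Section IntegralOffNull.
Import HBNNSimple.
Local Open Scope ereal_scope.
Context (d : measure_display) (T : measurableType d) (R : realType).
Variable mu : {measure set T -> \bar R}.

(* No measurability assumption on the integrands. *)
Lemma ge0_integral_off_null (D N : set T) (f g : T -> \bar R) :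
  measurable N -> mu N = 0 -> (forall x, D x -> 0 <= f x) -> (forall x, D x -> 0 <= g x) ->
  (forall x, D x -> ~ N x -> f x = g x) ->
  \int[mu]_(x in D) f x = \int[mu]_(x in D) g x.
Proof.
move=> mN N0.
suff le (f1 f2 : T -> \bar R) : (forall x, D x -> 0 <= f1 x) -> (forall x, D x -> 0 <= f2 x) ->
    (forall x, D x -> ~ N x -> f1 x = f2 x) -> \int[mu]_(x in D) f1 x <= \int[mu]_(x in D) f2 x.
  move=> f0 g0 fg; apply/eqP; rewrite eq_le !le// => x Dx nN.
  by rewrite fg.
move=> f0 g0 fg; rewrite !ge0_integralE//.
apply: ge_ereal_sup => _ [h /= hf <-].
have mNC : measurable (~` N) by exact: measurableC.
(* Killing the simple function on [N] preserves its integral and puts it below the second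
   integrand. *)
pose h' := proj_nnsfun h mNC.
have h'E x : h' x = (h x * \1_(~` N) x)%R by [].
have -> : sintegral mu h = sintegral mu h'.
  rewrite -!integralT_nnsfun; apply: ae_eq_integral => //.
  - exact/measurable_EFinP.
  - exact/measurable_EFinP.
  - exists N; split => // x nz; apply: contrapT => nN; apply: nz => _.
    by rewrite h'E indicE mem_set// mulr1.
apply: ereal_sup_ubound; exists h' => // x; rewrite h'E indicE.
have [xN|xN] := boolP (x \in ~` N).
  rewrite mulr1; apply: (le_trans (hf x)); rewrite /patch; case: ifPn => // xD.
  by rewrite fg//; [exact: set_mem|exact: set_mem xN].
rewrite mulr0 /patch; case: ifPn => // xD; apply: g0; exact: set_mem.
Qed.

(** Lets [derive1 v] be replaced by an integrable density without first proving it measurable. *)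
Lemma integral_off_null (D N : set T) (f g : T -> \bar R) :
  measurable N -> mu N = 0 -> (forall x, D x -> ~ N x -> f x = g x) ->
  \int[mu]_(x in D) f x = \int[mu]_(x in D) g x.
Proof.
move=> mN N0 fg; rewrite integralE [RHS]integralE.
congr (_ - _); apply: (ge0_integral_off_null mN N0) => // x Dx nN.
  by rewrite !funeposE fg.
by rewrite !funenegE fg.
Qed.

End IntegralOffNull.

(** * Fundamental theorem of calculus for Lipschitz functions *)

Section LipschitzFTC.
Context {R : realType}.
Local Notation leb := (@lebesgue_measure R).

(** The projection onto [0, 1]; composing with it extends functions to the line without enlarging
    their moduli of continuity. *)
Definition clamp (x : R) : R := Num.min 1 (Num.max 0 x).

Lemma clamp_in x : 0 <= clamp x <= 1.
Proof. by rewrite /clamp le_min ge_min lexx le_max lexx ler01. Qed.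

Lemma clampE x : 0 <= x <= 1 -> clamp x = x.
Proof. by move=> /andP[x0 x1]; rewrite /clamp (max_r x0) min_r. Qed.

Lemma clamp_lip x y : `|clamp x - clamp y| <= `|x - y|.
Proof.
have A := ler_norm (x - y); have := ler_norm (y - x); rewrite distrC => B.
rewrite /clamp /Num.min /Num.max; rewrite ler_norml; apply/andP.
by case: (ltP 0 x) => h1; case: (ltP 0 y) => h2; case: ltP => h3; case: ltP => h4; split; lra.
Qed.

Lemma stieltjes_itv (F : cumulative R R) (a b : R) : a <= b ->
  lebesgue_stieltjes_measure F `]a, b]%classic = (F b - F a)%:E.
Proof.
move=> ab; rewrite /lebesgue_stieltjes_measure /= /measure_extension measurable_mu_extE/=; last exact: is_ocitv.
by rewrite wlength_itv_bnd.
Qed.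

(** K x + v and K x - v are nondecreasing on [0, 1], and after extension their Stieltjes measures
    add up to 2K times Lebesgue measure. The first one is therefore absolutely continuous; its
    density minus [K] is the derivative of [v] almost everywhere, by Lebesgue differentiation, and
    integrates to the increments of [v]. *)
Lemma lipschitz_FTC (v : R -> R) (K : R) : 0 < K ->
  (forall x y, 0 <= x <= 1 -> 0 <= y <= 1 -> `|v x - v y| <= K * `|x - y|) ->
  exists h : R -> R, exists N : set R,
    [/\ measurable N, leb N = 0%E, leb.-integrable setT (EFin \o h),
        forall x, 0 < x < 1 -> ~ N x -> derive1 v x = h x &
        forall s t, 0 <= s -> s <= t -> t <= 1 ->
          \int[leb]_(x in `]s, t]) h x = v t - v s].
Proof.
move=> K0 lv.
pose w x := v (clamp x).
have lw x y : `|w x - w y| <= K * `|x - y|.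
  apply: (le_trans (lv _ _ (clamp_in x) (clamp_in y))).
  by rewrite ler_pM2l// clamp_lip.
pose F0 x := K * x + w x; pose G0 x := K * x - w x.
have contK (f : R -> R) : (forall x y, `|f x - f y| <= 2 * K * `|x - y|) -> right_continuous f.
  move=> lf; apply: right_continuousW => x; apply/cvgrPdist_lt => e e0.
  apply/nbhs_ballP; exists (e / (2 * K)); first by rewrite /= divr_gt0// mulr_gt0.
  move=> y /= xy; apply: (le_lt_trans (lf x y)).
  by rewrite mulrC -ltr_pdivlMr// mulr_gt0.
have lb x y : x <= y -> - (K * (y - x)) <= w y - w x <= K * (y - x).
  by move=> xy; rewrite -ler_norml; apply: le_trans (lw _ _) _; rewrite ger0_norm ?subr_ge0.
have ndF : {homo F0 : x y / x <= y}.
  by move=> x y /lb /andP[h1 h2]; rewrite /F0; lra.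
have ndG : {homo G0 : x y / x <= y}.
  by move=> x y /lb /andP[h1 h2]; rewrite /G0; lra.
have rcF : right_continuous F0.
  apply: contK => x y; have -> : F0 x - F0 y = K * (x - y) + (w x - w y) by rewrite /F0; ring.
  apply: (le_trans (ler_normD _ _)); rewrite normrM (gtr0_norm K0).
  by have := lw x y; lra.
have rcG : right_continuous G0.
  apply: contK => x y; have -> : G0 x - G0 y = K * (x - y) - (w x - w y) by rewrite /G0; ring.
  apply: (le_trans (ler_normB _ _)); rewrite normrM (gtr0_norm K0).
  by have := lw x y; lra.
pose F : cumulative R R := HB.pack F0 (isCumulative.Build R _ R F0 ndF rcF).
pose G : cumulative R R := HB.pack G0 (isCumulative.Build R _ R G0 ndG rcG).
pose muF := lebesgue_stieltjes_measure F; pose muG := lebesgue_stieltjes_measure G.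
have K2 : 0 <= (2 * K)^-1 by rewrite invr_ge0 mulr_ge0// ltW.
have muFE (a b : R) : a <= b -> muF `]a, b]%classic = (F0 b - F0 a)%:E by exact: stieltjes_itv.
have muGE (a b : R) : a <= b -> muG `]a, b]%classic = (G0 b - G0 a)%:E by exact: stieltjes_itv.
pose mu0 := mscale (NngNum K2) (measure_add muF muG).
have mu0E A : mu0 A = ((2 * K)^-1%:E * (muF A + muG A))%E.
  by congr (_ * _)%E; exact: measure_addE.
(* It suffices to compare the two measures on half-open intervals, where the contributions of [w]
   cancel. *)
have lebE (A : set R) : measurable A -> leb A = ((2 * K)^-1%:E * (muF A + muG A))%E.
  move=> mA; rewrite -mu0E; apply: lebesgue_measure_unique => // X [[a b] _ <-] /=.
  rewrite [RHS]mu0E.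
  have [ab|ba] := leP a b; last first.
    rewrite set_itv_ge ?bnd_simp -?leNgt ?ltW// measure0. have -> : muF set0 = 0%E by exact: measure0. have -> : muG set0 = 0%E by exact: measure0. by rewrite adde0 mule0.
  rewrite muFE// muGE// lebesgue_measure_itv /= lte_fin.
  rewrite -EFinD -EFinM /F0 /G0.
  have -> : (2 * K)^-1 * (K * b + w b - (K * a + w a) + (K * b - w b - (K * a - w a))) = b - a.
    by field; rewrite gt_eqF.
  case: ltP => // ba; have -> : a = b by apply/eqP; rewrite eq_le ab.
  by rewrite subrr.
pose D : set R := `]0, 1]%classic.
have mD : measurable D by exact: measurable_itv.
have Doo : (muF D < +oo)%E by rewrite muFE// ltry.
(* Restriction to ]0, 1] makes the measure finite for the Radon-Nikodym theorem. *)
pose nu : {finite_measure set (measurableTypeR R) -> \bar R} := @mfrestr _ (measurableTypeR R) R D muF mD Doo.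
have nudom : nu `<< leb.
  apply/null_content_dominatesP => A mA A0; have := lebE A mA.
  rewrite [X in X = _]A0 => /esym/eqP.
  rewrite mule_eq0 => /orP[|/eqP B0]; first by rewrite eqe invr_eq0 mulf_eq0 pnatr_eq0 (gt_eqF K0).
  apply/eqP; rewrite eq_le measure_ge0 andbT -B0.
  apply: (@le_trans _ _ (muF A)); last by rewrite leeDl.
  rewrite /nu /mfrestr /= /mrestr; apply: (@le_measure _ _ _ muF); rewrite ?inE//; exact: measurableI.
have [f [f0 ffin fint fE]] := @radon_nikodym_sigma_finite _ _ R leb nu nudom.
pose g (x : R) : R := fine (f x).
have gf : EFin \o g = f by apply/funext => x; rewrite /= fineK.
have gint : leb.-integrable setT (EFin \o g) by rewrite gf.
have gintS (A : set R) : measurable A -> leb.-integrable A (EFin \o g).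
  by move=> mA; apply: integrableS gint.
have gloc : locally_integrable setT g by apply: open_integrable_locally => //; exact: openT.
have [N [mN N0 dN]] := FTC1Ny (fun y => gintS _ (measurable_itv _)) gloc.
pose Ft (x : R) : R := \int[leb]_(t in `]-oo, x]) g t.
have gI (s t : R) : 0 <= s -> s <= t -> t <= 1 -> \int[leb]_(x in `]s, t]) g x = F0 t - F0 s.
  move=> s0 st t1; rewrite /Rintegral.
  have -> : (\int[leb]_(x in `]s, t]) (g x)%:E)%E = nu `]s, t]%classic.
    by rewrite fE// -gf.
  have -> : nu `]s, t]%classic = muF (`]s, t]%classic `&` D) by [].
  rewrite setIidl ?muFE//.
  by apply: subset_itv; rewrite bnd_simp.
have FtE (s t : R) : 0 <= s -> s <= t -> t <= 1 -> Ft t = Ft s + (F0 t - F0 s).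
  move=> s0 st t1; rewrite -gI// /Ft.
  have -> : `]-oo, t]%classic = (`]-oo, s]%classic `|` `]s, t]%classic).
    by rewrite -itv_bndbnd_setU.
  rewrite Rintegral_setU//; first by apply: gintS; exact: measurableU.
  rewrite disj_set2E; apply/eqP/seteqP; split => x //= [].
  by rewrite !in_itv/= => xs /andP[sx _]; lra.
pose h (x : R) : R := (g x - K) * \1_D x.
have KD (A : set R) : measurable A -> (leb A < +oo)%E -> leb.-integrable A (EFin \o (cst K)).
  move=> mA Aoo; apply: measurable_bounded_integrable => //.
  exists `|K|; split => // x Kx y _ /=; exact: ltW.
have gKI (A : set R) : measurable A -> (leb A < +oo)%E ->
    leb.-integrable A (EFin \o (fun x => g x - K)).
  move=> mA Aoo; have := @integrableB _ _ R leb A mA _ _ (gintS A mA) (KD _ mA Aoo).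
  by apply: eq_integrable => // x _; rewrite /= EFinB.
have itvoo (a b : R) : (leb `]a, b]%classic < +oo)%E.
  by rewrite lebesgue_measure_itv/=; case: ifP => _; rewrite ?ltry.
have hint : leb.-integrable setT (EFin \o h).
  have -> : EFin \o h = (EFin \o (fun x => g x - K)) \_ D.
    apply/funext => x; rewrite /= /h !patchE indicE; case: (x \in D) => /=.
      by rewrite mulr1.
    by rewrite mulr0.
  by have /(@integrable_mkcond _ _ R leb D _ mD) := gKI _ mD (itvoo 0 1).
exists h, N; split => //.
- move=> x0 /andP[x00 x01] nN; move: x0 x00 x01 nN => x x0 x1 nN.
  have Dx : derivable Ft x 1 /\ derive1 Ft x = g x by apply: contrapT => /dN.
  have dv : is_derive x 1 Ft (g x).
    by case: Dx => d1 d2; apply: DeriveDef => //; rewrite -derive1E.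
  (* On ]0, 1[ this function coincides with [v], since the primitive of the density is K x + v up to
     a constant. *)
  have dv2 : is_derive x 1 (fun y => Ft y - K * y + (F0 0 - Ft 0)) (g x - K).
    apply: is_derive_eq.
    by rewrite addr0 [_ *: _]mulr1.
  have -> : h x = g x - K by rewrite /h indicE mem_set ?mulr1// /D /= in_itv/= x0 ltW.
  rewrite derive1E; case: (@near_eq_is_derive _ _ _ _ v x 1 _ _ dv2) => //.
  near=> y.
  have y0 : 0 < y by near: y; exact: lt_nbhsr.
  have y1 : y < 1 by near: y; exact: lt_nbhsl.
  rewrite (FtE 0 y)// ?ltW// /F0 /w [clamp y]clampE ?ltW//; first ring.
- move=> s t s0 st t1.
  have -> : \int[leb]_(x in `]s, t]) h x = \int[leb]_(x in `]s, t]) (g x - K).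
    apply: eq_Rintegral => x /set_mem /=; rewrite in_itv/= => /andP[sx xt].
    rewrite /h indicE mem_set ?mulr1// /D /= in_itv/=; apply/andP; split; lra.
  rewrite RintegralB//; last 2 first.
  + exact: gintS.
  + by apply: KD => //; exact: itvoo.
  have mst : fine (leb `]s, t]%classic) = t - s.
    rewrite lebesgue_measure_itv/= lte_fin; case: ltP => // ts.
    by have -> : s = t; [apply/eqP; rewrite eq_le st ts|rewrite subrr].
  rewrite gI//; transitivity (F0 t - F0 s - K * (t - s)).
    by congr (_ - _); rewrite -[in RHS]mst; apply: Rintegral_cst.
  by rewrite /F0 /w !clampE ?s0 ?t1 ?(le_trans s0)// ?(le_trans st)//; ring.
Unshelve. all: by end_near. Qed.

End LipschitzFTC.

(** * Young integrals as limits of dyadic sums *)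

Section YoungIntegral.
Context {R : realType}.
Implicit Types (g h : R -> R) (A B rho : R).

(** Hölder continuity of exponent alpha appears as the rate rho = 2^(-alpha) at dyadic scales; the
    condition alpha > 1/2 gives 2 rho^2 < 1 ([dyadic_rate]). *)
Definition dyadic_holder (V : normedModType R) C rho (g : R -> V) : Prop :=
  forall k s t, `[0, 1]%classic s -> `[0, 1]%classic t -> `|s - t| <= (2 ^ k)%:R^-1 ->
    `|g s - g t| <= C * rho ^+ k.

Definition left_sum g h k : R :=
  \sum_(0 <= i < 2 ^ k) g (i%:R / (2 ^ k)%:R) * (h (i.+1%:R / (2 ^ k)%:R) - h (i%:R / (2 ^ k)%:R)).

Definition young_integral g h : R := lim (left_sum g h k @[k --> \oo]).

Lemma left_sum0 g h : left_sum g h 0 = g 0 * (h 1 - h 0).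
Proof. by rewrite /left_sum expn0 big_nat1 !divr1. Qed.

Lemma dyadic01 k i : (i <= 2 ^ k)%N -> `[0, 1]%classic (i%:R / (2 ^ k)%:R : R).
Proof. by move=> ik; apply: itv01 => //; rewrite expn_gt0. Qed.

(** Inserting the midpoint m between t0 and t1 adds (g m - g t0)(h t1 - h m), at most A B rho^(2k),
    in each of the 2^k intervals. *)
Lemma left_sum_step A B rho g h k : dyadic_holder A rho g -> dyadic_holder B rho h ->
  `|left_sum g h k.+1 - left_sum g h k| <= A * B * (2 * rho ^+ 2) ^+ k.
Proof.
move=> gH hH; rewrite /left_sum expnSr.
rewrite (sum_blocks (fun i => g (i%:R / (2 ^ k * 2)%:R) *
  (h (i.+1%:R / (2 ^ k * 2)%:R) - h (i%:R / (2 ^ k * 2)%:R)))) -sumrB.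
apply: (le_trans (ler_norm_sum _ _ _)).
have -> : A * B * (2 * rho ^+ 2) ^+ k =
    \sum_(0 <= i < 2 ^ k) ((A * rho ^+ k) * (B * rho ^+ k)).
  rewrite sumr_const_nat subn0 -[_ *+ (2 ^ k)]mulr_natr natrX exprMn -exprM mulnC exprM expr2; ring.
rewrite !big_nat; apply: ler_sum => i /andP[_ ik].
rewrite big_nat_recl// big_nat1 addn0 addn1.
have n0 : (2 ^ k)%:R != 0 :> R by rewrite pnatr_eq0 expn_eq0.
have e0 : (i * 2)%:R / (2 ^ k * 2)%:R = i%:R / (2 ^ k)%:R :> R by rewrite !natrM; field.
have e2 : (i * 2).+2%:R / (2 ^ k * 2)%:R = i.+1%:R / (2 ^ k)%:R :> R.
  rewrite (_ : (i * 2).+2 = (i.+1 * 2)%N); last by rewrite mulSn.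
  by rewrite !natrM; field.
rewrite e0 e2; set t0 := i%:R / _; set t1 := i.+1%:R / _; set m := (i * 2).+1%:R / _.
have d1 : m - t0 = (2 * (2 ^ k)%:R)^-1 by rewrite /m /t0 -[(i * 2).+1%:R]natr1 !natrM; field.
have d2 : t1 - m = (2 * (2 ^ k)%:R)^-1 by rewrite /m /t1 -[(i * 2).+1%:R]natr1 -[i.+1%:R]natr1 !natrM; field.
have half : (2 * (2 ^ k)%:R)^-1 <= (2 ^ k)%:R^-1 :> R.
  by rewrite lef_pV2 ?posrE ?mulr_gt0 ?ltr0n ?expn_gt0// ler_peMl ?ler1n.
have I0 : `[0, 1]%classic t0 by exact/dyadic01/ltnW.
have I2 : `[0, 1]%classic t1 by exact: dyadic01.
have Im : `[0, 1]%classic m.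
  by rewrite /m -expnSr; apply: dyadic01; rewrite expnSr; move: (2 ^ k)%N ik => M ik; lia.
have -> : g t0 * (h m - h t0) + g m * (h t1 - h m) - g t0 * (h t1 - h t0) =
  (g m - g t0) * (h t1 - h m) by ring.
rewrite normrM; apply: ler_pM => //.
  by apply: gH => //; rewrite d1 ger0_norm// invr_ge0 mulr_ge0.
by apply: hH => //; rewrite d2 ger0_norm// invr_ge0 mulr_ge0.
Qed.

Variables (rho : R).
Hypotheses (rho1 : 2 * rho ^+ 2 < 1).
Let q := 2 * rho ^+ 2.

Let q0 : 0 <= q. Proof. by rewrite mulr_ge0// sqr_ge0. Qed.

Lemma left_sum_cvg A B g h : 0 <= A -> 0 <= B -> dyadic_holder A rho g -> dyadic_holder B rho h ->
  cvg (left_sum g h k @[k --> \oo]).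
Proof.
move=> A0 B0 gH hH.
have -> : left_sum g h = (fun n => left_sum g h 0 + series (telescope (left_sum g h)) n).
  by apply/funext => n; rewrite -eq_sum_telescope.
apply: is_cvgD; first exact: is_cvg_cst.
apply: normed_cvg; apply: (@series_le_cvg _ _ (geometric (A * B) q)) => //.
- by move=> n /=.
- by move=> n; rewrite /geometric /=; apply: mulr_ge0; [exact: mulr_ge0|exact: exprn_ge0 q0].
- by move=> n /=; exact: left_sum_step.
- by apply: is_cvg_geometric_series; rewrite ger0_norm.
Qed.

(** The Love-Young estimate: the geometric bounds of [left_sum_step] are summed from the
    one-interval sum upwards. *)
Lemma young_integral_bound A B g h : 0 <= A -> 0 <= B ->
  dyadic_holder A rho g -> dyadic_holder B rho h ->
  `|young_integral g h - g 0 * (h 1 - h 0)| <= A * B / (1 - 2 * rho ^+ 2).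
Proof.
move=> A0 B0 gH hH; have cv := left_sum_cvg A0 B0 gH hH.
rewrite -left_sum0.
have cv2 : `|left_sum g h k - left_sum g h 0| @[k --> \oo] -->
    `|young_integral g h - left_sum g h 0|.
  by apply: cvg_norm; apply: cvgB => //; exact: cvg_cst.
rewrite -(cvg_lim (@Rhausdorff R) cv2); apply: limr_le; first by apply/cvg_ex; eexists; exact: cv2.
apply: nearW => n; rewrite [left_sum g h n]eq_sum_telescope addrC addKr /series /=.
apply: (le_trans (ler_norm_sum _ _ _)).
apply: (@le_trans _ _ (\sum_(0 <= k < n) A * B * q ^+ k)).
  by apply: ler_sum => k _; exact: left_sum_step.
have q1 : 0 < 1 - q by rewrite subr_gt0.
have -> : \sum_(0 <= k < n) A * B * q ^+ k = A * B * (1 - q ^+ n) / (1 - q).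
  have := @geometric_seriesE R (A * B) q; rewrite lt_eqF// => /(_ isT) /(congr1 (@^~ n)).
  by rewrite /series /geometric /=.
rewrite ler_pM2r ?invr_gt0// ler_piMr ?mulr_ge0//.
by rewrite lerBlDr lerDl exprn_ge0.
Qed.

Lemma young_integralBl A A' B g g' h : 0 <= A -> 0 <= A' -> 0 <= B ->
  dyadic_holder A rho g -> dyadic_holder A' rho g' -> dyadic_holder B rho h ->
  young_integral (g \- g') h = young_integral g h - young_integral g' h.
Proof.
move=> A0 A'0 B0 gH g'H hH; apply: cvg_lim => //.
have -> : left_sum (g \- g') h = (fun k => left_sum g h k - left_sum g' h k).
  by apply/funext => k; rewrite /left_sum -sumrB; apply: eq_bigr => i _; rewrite /= mulrBl.
by apply: cvgB; [exact: left_sum_cvg A0 B0 gH hH|exact: left_sum_cvg A'0 B0 g'H hH].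
Qed.

Lemma young_integralBr A B B' g h h' : 0 <= A -> 0 <= B -> 0 <= B' ->
  dyadic_holder A rho g -> dyadic_holder B rho h -> dyadic_holder B' rho h' ->
  young_integral g (h \- h') = young_integral g h - young_integral g h'.
Proof.
move=> A0 B0 B'0 gH hH h'H; apply: cvg_lim => //.
have -> : left_sum g (h \- h') = (fun k => left_sum g h k - left_sum g h' k).
  by apply/funext => k; rewrite /left_sum -sumrB; apply: eq_bigr => i _; rewrite /=; ring.
by apply: cvgB; [exact: left_sum_cvg A0 B0 gH hH|exact: left_sum_cvg A0 B'0 gH h'H].
Qed.

(* Split S(u,v) - S(g,h) = S(u - g, v) + S(g, v - h). *)
Lemma young_integral_near A B e g h u v : 0 <= A -> 0 <= B -> 0 <= e ->
  dyadic_holder A rho g -> dyadic_holder B rho h ->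
  dyadic_holder e rho (u \- g) -> dyadic_holder e rho (v \- h) ->
  `|u 0 - g 0| <= e -> `|v 0 - h 0| <= e -> `|v 1 - h 1| <= e ->
  `|young_integral u v - young_integral g h| <=
    e * (`|h 1 - h 0| + 2 * e + 2 * `|g 0| + (A + B + e) / (1 - 2 * rho ^+ 2)).
Proof.
move=> A0 B0 e0 gH hH ugH vhH u0 v0 v1.
have add (w z : R -> R) (E : R) : dyadic_holder e rho (w \- z) -> dyadic_holder E rho z ->
    dyadic_holder (e + E) rho w.
  move=> wz zH k s t Is It st.
  have -> : w s - w t = ((w \- z) s - (w \- z) t) + (z s - z t) by rewrite /=; ring.
  by rewrite mulrDl; apply: le_trans (ler_normD _ _) _; apply: lerD; [exact: wz|exact: zH].
have uH := add _ _ _ ugH gH; have vH := add _ _ _ vhH hH.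
have eA0 : 0 <= e + A by lra. have eB0 : 0 <= e + B by lra.
have -> : young_integral u v - young_integral g h =
    young_integral (u \- g) v + young_integral g (v \- h).
  rewrite (young_integralBl eA0 A0 eB0 uH gH vH) (young_integralBr A0 eB0 B0 gH vH hH).
  by ring.
have b1 := young_integral_bound e0 eB0 ugH vH.
have b2 := young_integral_bound A0 e0 gH vhH.
set X := young_integral _ _ in b1 *; set Y := young_integral g _ in b2 *.
set D := 1 - _ in b1 b2 *.
have n1 := ler_normD (X - (u \- g) 0 * (v 1 - v 0)) ((u \- g) 0 * (v 1 - v 0)).
have n2 := ler_normD (Y - g 0 * ((v \- h) 1 - (v \- h) 0)) (g 0 * ((v \- h) 1 - (v \- h) 0)).
rewrite !subrK !normrM in n1 n2.
have n3 := ler_normD X Y.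
have c1 : `|(u \- g) 0| * `|v 1 - v 0| <= e * (`|h 1 - h 0| + 2 * e).
  apply: ler_pM => //.
  have -> : v 1 - v 0 = (h 1 - h 0) + ((v 1 - h 1) - (v 0 - h 0)) by ring.
  apply: (le_trans (ler_normD _ _)); rewrite lerD2l.
  by apply: (le_trans (ler_normB _ _)); lra.
have c2 : `|g 0| * `|(v \- h) 1 - (v \- h) 0| <= `|g 0| * (2 * e).
  by apply: ler_wpM2l => //; apply: (le_trans (ler_normB _ _)); rewrite /=; lra.
have -> : e * (`|h 1 - h 0| + 2 * e + 2 * `|g 0| + (A + B + e) / D) =
  (e * (e + B) / D + e * (`|h 1 - h 0| + 2 * e)) + (A * e / D + `|g 0| * (2 * e)) by rewrite !mulrDr; ring.
lra.
Qed.

End YoungIntegral.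

(** * Young and Lebesgue integrals agree on Lipschitz functions *)

Section LipschitzYoung.
Context {R : realType}.
Local Notation leb := (@lebesgue_measure R).

(** On a mesh interval [s, t], freezing [u] at s costs at most K (t - s) times the integral of |h|,
    with [h] the density of [v]; the total error is O(2^(-k)). *)
Lemma lipschitz_young (u v : R -> R) (K : R) : 0 < K ->
  (forall x y, 0 <= x <= 1 -> 0 <= y <= 1 -> `|u x - u y| <= K * `|x - y|) ->
  (forall x y, 0 <= x <= 1 -> 0 <= y <= 1 -> `|v x - v y| <= K * `|x - y|) ->
  \int[leb]_(t in `[0, 1]) (u t * derive1 v t) = young_integral u v.
Proof.
move=> K0 lu lv; have [h [N [mN N0 hint dv hI]]] := lipschitz_FTC K0 lv.
pose U x := u (clamp x).
have lU x y : `|U x - U y| <= K * `|x - y|.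
  by apply: (le_trans (lu _ _ (clamp_in x) (clamp_in y))); rewrite ler_pM2l// clamp_lip.
have cU : continuous U.
  move=> x; apply/cvgrPdist_lt => e e0.
  apply/nbhs_ballP; exists (e / K); first by rewrite /= divr_gt0.
  move=> y /= xy; apply: (le_lt_trans (lU x y)).
  by rewrite mulrC -ltr_pdivlMr.
have bU x : `|U x| <= `|u 0| + K.
  have -> : U x = u 0 + (U x - u 0) by ring.
  apply: (le_trans (ler_normD _ _)); rewrite lerD2l.
  have /andP[c0 c1] := clamp_in x.
  apply: (le_trans (lu _ _ (clamp_in x) _)); first by rewrite lexx ler01.
  by rewrite subr0 ger0_norm// ler_piMr// ltW.
have mU : measurable_fun setT U by exact: continuous_measurable_fun.
pose Uh x := U x * h x.
have Uhint (A : set R) : measurable A -> leb.-integrable A (EFin \o Uh).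
  move=> mA; apply: (@integrableS _ _ _ _ setT) => //.
  have := @integrableMr _ _ R leb setT measurableT U (EFin \o h) mU _ hint.
  apply; exists (`|u 0| + K); split; first exact: num_real.
  by move=> x Kx y _; apply/ltW/(le_lt_trans (bU y)).
have habs (A : set R) : measurable A -> leb.-integrable A (EFin \o (fun x => `|h x|)).
  move=> mA; apply: (@integrableS _ _ _ _ setT) => //; exact: integrable_norm.
have hS (A : set R) : measurable A -> leb.-integrable A (EFin \o h).
  by move=> mA; apply: (@integrableS _ _ _ _ setT).
pose Phi (t : R) : R := \int[leb]_(x in `]0, t]) Uh x.
pose H (t : R) : R := \int[leb]_(x in `]0, t]) `|h x|.
have split (k : R -> R) (s t : R) : 0 <= s -> s <= t -> (forall A : set R, measurable A -> leb.-integrable A (EFin \o k)) ->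
    \int[leb]_(x in `]0, t]) k x = \int[leb]_(x in `]0, s]) k x + \int[leb]_(x in `]s, t]) k x.
  move=> s0 st ki.
  have -> : `]0, t]%classic = (`]0, s]%classic `|` `]s, t]%classic).
    by rewrite -itv_bndbnd_setU// bnd_simp.
  rewrite Rintegral_setU//; first by apply: ki; exact: measurableU.
  rewrite disj_set2E; apply/eqP/seteqP; split => x //= [].
  by rewrite !in_itv/= => /andP[_ xs] /andP[sx _]; lra.
have Zint (k : R -> R) (c : R) (A : set R) : measurable A -> leb.-integrable A (EFin \o k) ->
    leb.-integrable A (EFin \o (fun x => c * k x)).
  move=> mA ki; have := @integrableZl _ _ R leb A mA c _ ki.
  by apply: eq_integrable => // x _; rewrite /= EFinM.
have Bint (c : R) (A : set R) : measurable A ->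
    leb.-integrable A (EFin \o (fun x => Uh x - c * h x)).
  move=> mA; have := @integrableB _ _ R leb A mA _ _ (Uhint A mA) (Zint h c A mA (hS A mA)).
  by apply: eq_integrable => // x _; rewrite /= EFinB.
have step (s t : R) : 0 <= s -> s <= t -> t <= 1 ->
    `|(Phi t - Phi s) - U s * (v t - v s)| <= K * (t - s) * (H t - H s).
  move=> s0 st t1; rewrite /Phi /H (split Uh s t)// (split (fun x => `|h x|) s t)//.
  rewrite !(addrC _ (\int[leb]_(x in `]s, t]) _)) !addrK -hI//.
  rewrite -!RintegralZl//; [|exact: habs|exact: hS].
  rewrite -RintegralB//; [|exact: Uhint|by apply: Zint => //; exact: hS].
  apply: (le_trans (le_normr_Rintegral _ _)) => //; first exact: Bint.
  apply: le_Rintegral => //.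
  - by apply: integrable_norm; exact: Bint.
  - by apply: Zint => //; exact: habs.
  - move=> x; rewrite /= in_itv/= => /andP[sx xt].
    rewrite /Uh -mulrBl normrM ler_wpM2r//.
    apply: (le_trans (lU x s)); rewrite ler_pM2l// ger0_norm; lra.
have -> : \int[leb]_(t in `[0, 1]) (u t * derive1 v t) = Phi 1.
  (* At 0 and 1, [derive1 v] depends on values of [v] outside [0, 1], so the endpoints join the null
     set. *)
  pose N' := N `|` [set 0; 1].
  have m01 : measurable ([set 0; 1] : set R) by exact: measurableU.
  have mN' : measurable N' by exact: measurableU.
  have N'0 : leb N' = 0%E.
    apply: null_set_setU => //; apply: null_set_setU => //; exact: lebesgue_measure_set1.
  rewrite /Phi /Rintegral; congr fine.
  rewrite integral_mkcond [RHS]integral_mkcond.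
  apply: (@integral_off_null _ _ R leb setT N' _ _ mN' N'0) => x _ nN'; rewrite !patchE.
  have x0 : x != 0 by apply/eqP => xE; apply: nN'; right; left.
  have x1 : x != 1 by apply/eqP => xE; apply: nN'; right; right.
  have nN : ~ N x by move=> Nx; apply: nN'; left.
  have [xI|xI] := boolP (x \in `[0, 1]%classic); last first.
    rewrite ifF//; apply/negP => /set_mem /=; rewrite in_itv/= => /andP[h0 h1].
    by move/negP: xI; apply; apply/mem_set; rewrite /= in_itv/= h1 ltW.
  move: xI => /set_mem /=; rewrite in_itv/= => /andP[h0 h1].
  rewrite ifT; last by apply/mem_set; rewrite /= in_itv/= h1 lt_neqAle eq_sym x0 h0.
  rewrite dv//; last by rewrite !lt_neqAle eq_sym x0 h0 x1 h1.
  by rewrite /Uh /U clampE// h0 h1.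
apply/esym/cvg_lim => //; apply/cvgrPdist_lt => e e0.
have H00 : H 0 = 0 by rewrite /H set_itvoc0 Rintegral_set0.
have P00 : Phi 0 = 0 by rewrite /Phi set_itvoc0 Rintegral_set0.
have H0 : 0 <= H 1 by apply: Rintegral_ge0.
have : geometric (K * H 1 + 1) 2^-1 k @[k --> \oo] --> 0.
  apply: cvg_geometric; rewrite ger0_norm; lra.
move=> /cvgrPdist_lt /(_ _ e0); apply: filterS => k; rewrite sub0r normrN => hk.
apply: le_lt_trans hk; rewrite /geometric /= [leRHS]ger0_norm; last first.
  by rewrite mulr_ge0 ?exprn_ge0 ?addr_ge0// mulr_ge0// ltW.
pose n := (2 ^ k)%N; have n0 : (0 < n)%N by rewrite expn_gt0.
pose t i : R := i%:R / n%:R.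
have ends (w : R -> R) : \sum_(0 <= i < n) (w (t i.+1) - w (t i)) = w 1 - w 0.
  rewrite (telescope_sumr (fun i => w (t i)))// /t mul0r divff// pnatr_eq0; lia.
have tI i : (i <= n)%N -> 0 <= t i <= 1.
  by move=> ile; have := @dyadic01 R k i ile; rewrite /= in_itv.
have tS i : t i.+1 - t i = 2^-1 ^+ k.
  rewrite /t -mulrBl -natr1 addrC addKr mul1r /n natrX exprVn //.
have -> : Phi 1 - left_sum u v k =
    \sum_(0 <= i < n) ((Phi (t i.+1) - Phi (t i)) - U (t i) * (v (t i.+1) - v (t i))).
  rewrite sumrB ends P00 subr0; congr (_ - _); rewrite /left_sum !big_nat.
  by apply: eq_bigr => i /andP[_ ik]; rewrite /U clampE//; exact/tI/ltnW.
apply: (le_trans (ler_norm_sum _ _ _)).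
apply: (@le_trans _ _ (\sum_(0 <= i < n) (K * 2^-1 ^+ k * (H (t i.+1) - H (t i))))).
  rewrite !big_nat; apply: ler_sum => i /andP[_ ik]; rewrite -(tS i).
  have /andP[a0 a1] := tI _ (ltnW ik); have /andP[b0 b1] := tI _ ik.
  by apply: step => //; rewrite -subr_ge0 tS exprn_ge0.
rewrite -mulr_sumr ends H00 subr0 mulrAC ler_wpM2r ?exprn_ge0//.
by rewrite lerDl.
Qed.

End LipschitzYoung.

(** * Hölder norms and the generalized integral *)

Section HolderUnit.
Context {R : realType}.
Implicit Types (g h : R -> R) (a C : R).

Definition holder01 C a g := forall s t, 0 <= s <= 1 -> 0 <= t <= 1 ->
  `|g s - g t| <= C * `|s - t| `^ a.

Lemma powR_mono a (x y : R) : 0 <= a -> 0 <= x -> x <= y -> x `^ a <= y `^ a.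
Proof. by move=> a0 x0 xy; apply: ge0_ler_powR => //; rewrite nnegrE// (le_trans x0). Qed.

Lemma small_powR a e : 0 < a -> 0 < e -> exists2 d : R, 0 < d & d `^ a = e.
Proof.
move=> a0 e0; exists (e `^ a^-1); first exact: powR_gt0.
by rewrite -powRrM mulVf ?gt_eqF// powRr1// ltW.
Qed.

Lemma dyadic_rate a : 2^-1 < a -> 2 * ((2 : R) `^ (- a)) ^+ 2 < 1.
Proof.
move=> a2; have b0 : 0 < a + a - 1 by lra.
have : 1 `^ (a + a - 1) < (2 : R) `^ (a + a - 1) by apply: gt0_ltr_powR; rewrite ?nnegrE//; lra.
rewrite powR1 powRD ?pnatr_eq0 ?implybT// powRD ?pnatr_eq0 ?implybT// powR_inv1// powRN.
have A0 : 0 < (2 : R) `^ a by exact: powR_gt0.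
by rewrite ltr_pdivlMr// mul1r => h; rewrite exprVn ltr_pdivrMr ?exprn_gt0// mul1r expr2.
Qed.

Lemma dyadic_holderW a a' C (V : normedModType R) (g : R -> V) : 0 <= C -> a' <= a ->
  dyadic_holder C (2 `^ (- a)) g -> dyadic_holder C (2 `^ (- a')) g.
Proof.
move=> C0 aa gH k s t Is It st; apply: (le_trans (gH k s t Is It st)).
by rewrite ler_wpM2l// lerXn2r ?nnegrE ?powR_ge0//; apply: ler_powR; lra.
Qed.

Lemma powR_dyadic a k (x : R) : 0 <= a -> 0 <= x -> x <= (2 ^ k)%:R^-1 ->
  x `^ a <= (2 `^ (- a)) ^+ k.
Proof.
move=> a0 x0 xk; apply: (le_trans (powR_mono a0 x0 xk)).
rewrite le_eqVlt; apply/orP; left; apply/eqP.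
rewrite natrX -(powR_mulrn k (ler0n R 2)) -powR_inv1 ?powR_ge0// -powR_mulrn ?powR_ge0//.
by rewrite -!powRrM; congr (_ `^ _); ring.
Qed.

Lemma dyadic_holder01 C a g : 0 <= C -> 0 <= a -> holder01 C a g ->
  dyadic_holder C (2 `^ (- a)) g.
Proof.
move=> C0 a0 gH k s t; rewrite /= !in_itv/= => Is It st; apply: (le_trans (gH s t Is It)).
by rewrite ler_wpM2l// powR_dyadic.
Qed.

Lemma holder_norm_le a (e : R) g : (holder_norm a g <= e%:E)%E ->
  (forall t, 0 <= t <= 1 -> `|g t| <= e) /\ holder01 e a g.
Proof.
rewrite /holder_norm; set S1 := ereal_sup _; set S2 := ereal_sup _ => h.
have u1 t : 0 <= t <= 1 -> (`|g t|%:E <= S1)%E.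
  by move=> It; apply: ereal_sup_ubound; exists t => //=; rewrite in_itv.
have u2 s t : 0 <= s <= 1 -> 0 <= t <= 1 -> s != t ->
    ((`|g s - g t| / `|s - t| `^ a)%:E <= S2)%E.
  by move=> Is It st; apply: ereal_sup_ubound; exists (s, t).
have i0 : 0 <= (0 : R) <= 1 by rewrite lexx ler01.
have i1 : 0 <= (1 : R) <= 1 by rewrite lexx ler01.
have S10 : (0 <= S1)%E by apply: le_trans (u1 0 i0); rewrite lee_fin.
have n01 : (0 : R) != 1 by rewrite eq_sym oner_eq0.
have S20 : (0 <= S2)%E.
  by apply: le_trans (u2 0 1 i0 i1 n01); rewrite lee_fin divr_ge0 ?powR_ge0.
split=> [t It|s t Is It].
  by rewrite -lee_fin; apply: le_trans h; apply: (le_trans (u1 t It)); rewrite leeDl.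
have [->|st] := eqVneq s t.
  have e0 : 0 <= e by rewrite -lee_fin (le_trans _ h)// adde_ge0.
  by rewrite !subrr normr0 mulr_ge0 ?powR_ge0.
rewrite -ler_pdivrMr ?powR_gt0 ?normr_gt0 ?subr_eq0//.
by rewrite -lee_fin; apply: le_trans h; apply: (le_trans (u2 s t Is It st)); rewrite leeDr.
Qed.

Lemma le_holder_norm a (e1 e2 : R) g : (forall t, 0 <= t <= 1 -> `|g t| <= e1) -> holder01 e2 a g ->
  (holder_norm a g <= (e1 + e2)%:E)%E.
Proof.
move=> h1 h2; rewrite /holder_norm EFinD; apply: leeD.
  by apply: ge_ereal_sup => _ [t /= It <-]; rewrite lee_fin h1//; move: It; rewrite in_itv.
apply: ge_ereal_sup => _ [[s t] /= [Is It st] <-].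
have d0 : 0 < `|s - t| `^ a by rewrite powR_gt0 ?normr_gt0 ?subr_eq0.
by rewrite lee_fin ler_pdivrMr//; exact: h2.
Qed.

Lemma holder_norm_ge0 a g : (0 <= holder_norm a g)%E.
Proof.
rewrite /holder_norm adde_ge0//.
  apply: (@le_trans _ _ (`|g 0|%:E)); first by rewrite lee_fin.
  by apply: ereal_sup_ubound; exists 0 => //=; rewrite in_itv/= lexx ler01.
apply: (@le_trans _ _ (`|g 0 - g 1| / `|0 - 1| `^ a)%:E).
  by rewrite lee_fin divr_ge0 ?powR_ge0.
apply: ereal_sup_ubound; exists (0, 1) => //=.
by split; rewrite ?lexx ?ler01// eq_sym oner_eq0.
Qed.

Lemma lipschitz_approxP a g geps :
  lipschitz_approx a g geps <->
  (forall eps, 0 < eps -> exists k : R, k.-lipschitz_(`[0, 1]) (geps eps)) /\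
  (forall e : R, 0 < e -> \forall eps \near 0^'+, (holder_norm a (geps eps \- g)%R <= e%:E)%E).
Proof.
rewrite /lipschitz_approx; split=> -[lip cv]; split=> //.
  move=> e e0; have : nbhs (0%:E : \bar R) [set x | (x <= e%:E)%E].
    change (nbhs (0 : R) [set x : R | (x%:E <= e%:E)%E]).
    by near=> x; rewrite /= lee_fin; apply: ltW; near: x; exact: lt_nbhsl.
  by move=> /cv.
move=> A A0; have {}A0 : nbhs (0 : R) [set x : R | A x%:E] by [].
have [e /= e0 eA] := (nbhs_ballP _ _).1 A0.
have e20 : 0 < e / 2 by rewrite divr_gt0.
have := cv _ e20; apply: filterS => eps he.
have := holder_norm_ge0 a (geps eps \- g); move: he; rewrite /=.
case: (holder_norm _ _) => // r; rewrite !lee_fin => re r0; apply: eA.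
by rewrite /ball /= sub0r normrN ger0_norm//; lra.
Unshelve. all: by end_near. Qed.

(** The integrals of Lipschitz approximants are Young integrals, and [young_integral_near] compares
    them with that of [g] and [h] at the exponent [a], where both functions are Hölder as well
    because a <= alpha. *)
Lemma is_gen_integral_young alpha C C' g h : 0 <= C -> 0 <= C' ->
  holder01 C alpha g -> holder01 C' alpha h -> is_gen_integral alpha g h (young_integral g h).
Proof.
move=> C0 C'0 gH hH a geps heps /andP[a2 aalpha] /lipschitz_approxP[glip gcv] /lipschitz_approxP[hlip hcv].
have a0 : 0 < a by lra.
have rho1 := dyadic_rate a2; set rho := _ `^ _ in rho1.
have gd : dyadic_holder C rho g by apply: (@dyadic_holderW alpha) => //; apply: dyadic_holder01 => //; lra.
have hd : dyadic_holder C' rho h by apply: (@dyadic_holderW alpha) => //; apply: dyadic_holder01 => //; lra.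
apply/cvgrPdist_lt => e e0.
have D0 : 0 < 1 - 2 * rho ^+ 2 by rewrite subr_gt0.
(* The bracket in [young_integral_near] when its error is at most 1. *)
pose c := `|h 1 - h 0| + 2 + 2 * `|g 0| + (C + C' + 1) / (1 - 2 * rho ^+ 2).
have c0 : 0 <= c by rewrite /c !addr_ge0 ?divr_ge0 ?mulr_ge0 ?(ltW D0)// !addr_ge0.
pose d := Num.min 1 (e / (c + 1)).
have d0 : 0 < d by rewrite /d lt_min ltr01 divr_gt0// ltr_wpDl.
have d1 : d <= 1 by rewrite /d ge_min lexx.
have dc : d * c < e.
  have : d <= e / (c + 1) by rewrite /d ge_min lexx orbT.
  rewrite ler_pdivlMr ?ltr_wpDl// mulrDr mulr1; lra.
near=> eps.
have eps0 : 0 < eps by near: eps; exact: nbhs_right_gt.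
have [k1 k1P] := glip eps eps0; have [k2 k2P] := hlip eps eps0.
have lip (w : R -> R) k : k.-lipschitz_(`[0, 1]) w -> forall x y, 0 <= x <= 1 -> 0 <= y <= 1 ->
    `|w x - w y| <= (`|k1| + `|k2| + 1 + `|k|) * `|x - y|.
  move=> kP x y Ix Iy; apply: (le_trans (kP (x, y) _)); first by split; rewrite /= in_itv.
  by rewrite ler_wpM2r//=; have := ler_norm k; have := normr_ge0 k1; have := normr_ge0 k2; lra.
rewrite (@lipschitz_young _ (geps eps) (heps eps) (`|k1| + `|k2| + 1 + `|k1| + `|k2|)); last 3 first.
- by rewrite ltr_wpDr// ltr_wpDr// ltr_wpDl// addr_ge0.
- move=> x y Ix Iy; apply: (le_trans (lip _ _ k1P x y Ix Iy)).
  by rewrite ler_wpM2r// lerDl.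
- move=> x y Ix Iy; apply: (le_trans (lip _ _ k2P x y Ix Iy)).
  by rewrite ler_wpM2r// lerD2r lerDl.
have /holder_norm_le[g1 g2] : (holder_norm a (geps eps \- g)%R <= d%:E)%E by near: eps; exact: gcv.
have /holder_norm_le[h1 h2] : (holder_norm a (heps eps \- h)%R <= d%:E)%E by near: eps; exact: hcv.
have g2d : dyadic_holder d rho (geps eps \- g) by apply: dyadic_holder01 => //; exact: ltW.
have h2d : dyadic_holder d rho (heps eps \- h) by apply: dyadic_holder01 => //; exact: ltW.
have i0 : 0 <= (0 : R) <= 1 by rewrite lexx ler01.
have i1 : 0 <= (1 : R) <= 1 by rewrite lexx ler01.
have := young_integral_near rho1 C0 C'0 (ltW d0) gd hd g2d h2d (g1 _ i0) (h1 _ i0) (h1 _ i1).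
rewrite distrC => /le_lt_trans; apply; apply: le_lt_trans dc.
rewrite ler_pM2l// /c lerD ?lerD2r//; first by rewrite lerD2l; lra.
by rewrite ler_pM2r ?invr_gt0//; lra.
Unshelve. all: by end_near. Qed.

End HolderUnit.

(** * Lipschitz regularisation by inf-convolution *)

Section InfConvolution.
Context {R : realType}.
Implicit Types (a C : R).
Variables (g : R -> R) (C alpha : R).
Hypotheses (C0 : 0 <= C) (alpha0 : 0 < alpha) (gH : holder01 C alpha g).

Let G s := g (clamp s).

(** The Pasch-Hausdorff envelope, taken over the whole line with the clamped extension of [g] so
    that competitors can be translated freely. *)
Definition inf_convolution (k t : R) : R := inf [set G s + k * `|t - s| | s in setT].

Lemma clamp_holder s t : `|G s - G t| <= C * `|s - t| `^ alpha.
Proof.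
apply: (le_trans (gH (clamp_in s) (clamp_in t))); rewrite ler_wpM2l//.
by apply: powR_mono => //; [exact: ltW|exact: clamp_lip].
Qed.

Lemma clamp_bounded s : `|G s| <= `|g 0| + C.
Proof.
have -> : G s = g 0 + (G s - g 0) by ring.
apply: (le_trans (ler_normD _ _)); rewrite lerD2l.
have i0 : 0 <= (0 : R) <= 1 by rewrite lexx ler01.
apply: (le_trans (gH (clamp_in s) i0)); rewrite ler_piMr//.
have /andP[c0 c1] := clamp_in s.
rewrite -[leRHS](congr1 (@^~ alpha) (powR1 R)); apply: powR_mono => //; first exact: ltW.
by rewrite subr0 ger0_norm.
Qed.

Variable k : R.
Hypothesis k0 : 0 < k.
Let Gk := inf_convolution k.

Lemma inf_convolution_le s t : Gk t <= G s + k * `|t - s|.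
Proof.
apply: ge_inf; last by exists s.
exists (- (`|g 0| + C)) => _ [x _ <-].
have := clamp_bounded x; rewrite ler_norml => /andP[h _].
have : 0 <= k * `|t - x| by rewrite mulr_ge0// ltW.
lra.
Qed.

Lemma le_inf_convolution t (x : R) : (forall s, x <= G s + k * `|t - s|) -> x <= Gk t.
Proof.
move=> h; apply: lb_le_inf; first by exists (G 0 + k * `|t - 0|); exists 0.
by move=> _ [s _ <-]; exact: h.
Qed.

Lemma inf_convolution_lip s t : `|Gk s - Gk t| <= k * `|s - t|.
Proof.
have half x y : Gk x - k * `|x - y| <= Gk y.
  apply: le_inf_convolution => z; have h := inf_convolution_le z x.
  have : `|x - z| <= `|x - y| + `|y - z| by rewrite -{1}(subrK y x) -addrA ler_normD.
  by rewrite -(ler_pM2l k0) mulrDr; lra.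
have h1 := half s t; have h2 := half t s; rewrite distrC in h2.
by rewrite ler_norml; apply/andP; split; lra.
Qed.

(** A competitor z for y becomes the competitor z + (x - y) for x with the same penalty. *)
Lemma inf_convolution_holder s t : `|Gk s - Gk t| <= C * `|s - t| `^ alpha.
Proof.
have half x y : Gk x - C * `|x - y| `^ alpha <= Gk y.
  apply: le_inf_convolution => z; have h := inf_convolution_le (z + (x - y)) x.
  have e : x - (z + (x - y)) = y - z by ring.
  have := clamp_holder (z + (x - y)) z; rewrite addrAC subrr add0r => h2.
  have := ler_norm (G (z + (x - y)) - G z); rewrite e in h; lra.
have h1 := half s t; have h2 := half t s; rewrite distrC in h2.
by rewrite ler_norml; apply/andP; split; lra.
Qed.

(** Competitors farther than [r] pay more than the oscillation of the function; nearer ones change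
    its value by at most C r^alpha. *)
Lemma inf_convolution_close (r : R) t : 0 < r -> 2 * (`|g 0| + C) <= k * r ->
  `|Gk t - G t| <= C * r `^ alpha.
Proof.
move=> r0 kr; have r1 : 0 <= C * r `^ alpha by rewrite mulr_ge0// powR_ge0.
have up := inf_convolution_le t t; rewrite subrr normr0 mulr0 addr0 in up.
have low : G t - C * r `^ alpha <= Gk t.
  apply: le_inf_convolution => s; have [ts|ts] := leP `|t - s| r.
    have h1 := clamp_holder t s; have h2 := ler_norm (G t - G s).
    have : C * `|t - s| `^ alpha <= C * r `^ alpha.
      by rewrite ler_wpM2l//; apply: powR_mono => //; exact: ltW.
    have : 0 <= k * `|t - s| by rewrite mulr_ge0// ltW.
    lra.
  have h1 := clamp_bounded t; have h2 := clamp_bounded s.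
  rewrite ler_norml in h1; rewrite ler_norml in h2; move/andP: h1 => [_ h1]; move/andP: h2 => [h2 _].
  have : k * r <= k * `|t - s| by rewrite ler_pM2l// ltW.
  lra.
by rewrite ler_norml; apply/andP; split; lra.
Qed.

End InfConvolution.

(** * The generalized integral is the Young integral *)

Section GenIntegralYoung.
Context {R : realType}.
Implicit Types (g h : R -> R) (a C : R).

(** The error is uniformly small and alpha-Hölder with constant 2C, hence small in the norm of any
    lower exponent [a]: up to distance [d] one gains d^(alpha - a), and beyond it the sup bound
    suffices. *)
Lemma lipschitz_approx_exists a alpha C g : 0 < a -> a < alpha -> 0 <= C -> holder01 C alpha g ->
  lipschitz_approx a g (fun eps => inf_convolution g eps^-1).
Proof.
move=> a0 aalpha C0 gH; have alpha0 : 0 < alpha by lra.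
apply/lipschitz_approxP; split=> [eps eps0|e e0].
  exists eps^-1 => -[x y] _ /=; apply: (inf_convolution_lip C0 alpha0 gH).
  by rewrite invr_gt0.
have e2 : 0 < e / 2 by lra.
have b0 : 0 < alpha - a by lra.
have [d d0 dE] : exists2 d : R, 0 < d & 2 * C * d `^ (alpha - a) <= e / 2.
  have C1 : 0 < 2 * C + 1 by lra.
  have [|d d0 dE] := @small_powR R (alpha - a) (e / 2 / (2 * C + 1)) b0; first exact: divr_gt0.
  by exists d => //; rewrite dE mulrCA ler_piMr ?(ltW e2)// ler_pdivrMr//; lra.
(* The first bound serves the sup norm, the second the Hölder quotients at distances larger than
   [d]. *)
pose eta := Num.min (e / 2) (e / 4 * d `^ a).
have eta0 : 0 < eta by rewrite /eta lt_min e2 mulr_gt0 ?powR_gt0//; lra.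
have eta1 : eta <= e / 2 by rewrite /eta ge_min lexx.
have eta2 : eta <= e / 4 * d `^ a by rewrite /eta ge_min lexx orbT.
have [r r0 rE] : exists2 r : R, 0 < r & C * r `^ alpha <= eta.
  have C1 : 0 < C + 1 by lra.
  have [|r r0 rE] := @small_powR R alpha (eta / (C + 1)) alpha0; first exact: divr_gt0.
  by exists r => //; rewrite rE mulrCA ler_piMr ?(ltW eta0)// ler_pdivrMr//; lra.
pose M := 2 * (`|g 0| + C) + 1.
have M0 : 0 < M by rewrite /M ltr_wpDl// mulr_ge0// addr_ge0.
near=> eps.
have eps0 : 0 < eps by near: eps; exact: nbhs_right_gt.
have epsM : eps < r / M by near: eps; apply: nbhs_right_lt; exact: divr_gt0.
have k0 : 0 < eps^-1 by rewrite invr_gt0.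
have kr : 2 * (`|g 0| + C) <= eps^-1 * r.
  apply: (@le_trans _ _ M); first by rewrite /M lerDl.
  by rewrite ler_pdivlMl// -ler_pdivlMr// ltW.
pose D : R -> R := (inf_convolution g eps^-1 \- g)%R; rewrite -/D.
have Dsmall t : 0 <= t <= 1 -> `|D t| <= eta.
  move=> It; apply: le_trans rE.
  have := inf_convolution_close C0 alpha0 gH k0 t r0 kr.
  by rewrite clampE.
rewrite (_ : e = e / 2 + e / 2); last by field.
apply: le_holder_norm => [t It|s t Is It]; first exact: le_trans (Dsmall t It) eta1.
have [st|st] := leP `|s - t| d; last first.
  have : `|D s - D t| <= 2 * eta.
    by apply: (le_trans (ler_normB _ _)); have := Dsmall s Is; have := Dsmall t It; lra.
  move=> /le_trans; apply.
  have : d `^ a <= `|s - t| `^ a by apply: powR_mono; apply: ltW.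
  by move=> h; have := ler_wpM2l (ltW e2) h; lra.
have [->|nst] := eqVneq s t; first by rewrite !subrr normr0 mulr_ge0 ?powR_ge0// ltW.
have st0 : 0 < `|s - t| by rewrite normr_gt0 subr_eq0.
have : `|D s - D t| <= 2 * C * `|s - t| `^ alpha.
  have -> : D s - D t = (inf_convolution g eps^-1 s - inf_convolution g eps^-1 t) - (g s - g t).
    by rewrite /D /=; ring.
  apply: (le_trans (ler_normB _ _)).
  have := inf_convolution_holder C0 alpha0 gH k0 s t; have := gH s t Is It; lra.
move=> /le_trans; apply.
rewrite -(subrK a alpha) powRD; last by rewrite (gt_eqF st0) implybT.
rewrite mulrA ler_wpM2r ?powR_ge0//; apply: le_trans dE.
by rewrite ler_wpM2l ?mulr_ge0//; apply: powR_mono => //; exact: ltW.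
Unshelve. all: by end_near. Qed.

(** Uniqueness of the value picked by [xget] needs at least one pair of approximations, provided at
    the exponent halfway between 1/2 and alpha. *)
Lemma gen_integral_young alpha C C' g h : 2^-1 < alpha -> 0 <= C -> 0 <= C' ->
  holder01 C alpha g -> holder01 C' alpha h -> gen_integral alpha g h = young_integral g h.
Proof.
move=> al C0 C'0 gH hH; apply: xget_unique; first exact: is_gen_integral_young C0 C'0 gH hH.
move=> l lP; pose a := (2^-1 + alpha) / 2.
have a1 : 2^-1 < a <= alpha by rewrite /a; apply/andP; split; lra.
have a0 : 0 < a by rewrite /a; lra.
have aal : a < alpha by rewrite /a; lra.
have ag := lipschitz_approx_exists a0 aal C0 gH.
have ah := lipschitz_approx_exists a0 aal C'0 hH.
exact: (cvg_unique _ (lP _ _ _ a1 ag ah) (is_gen_integral_young C0 C'0 gH hH a1 ag ah)).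
Qed.

End GenIntegralYoung.

(** * The integral of x dy - y dx along Hölder curves *)

Section SymplecticArea.
Context {R : realType}.
Variable n : nat.
Implicit Types (u v : 'rV[R]_(2 * n)) (gamma : R -> 'rV[R]_(2 * n)).

(** The standard symplectic form; [symp q.1 p.1] is the sum occurring in [koranyi p q]. *)
Definition symp u v : R := \sum_(j < n) (u 0 (xidx j) * v 0 (yidx j) - v 0 (xidx j) * u 0 (yidx j)).

Lemma sympxx u : symp u u = 0.
Proof. by rewrite /symp; apply: big1 => j _; rewrite subrr. Qed.

Lemma symp_diff u v : symp u v = symp u (v - u).
Proof. by rewrite /symp; apply: eq_bigr => j _; rewrite !mxE; ring. Qed.

Lemma symp_bound u v (A B : R) : (forall i, `|u 0 i| <= A) -> (forall i, `|v 0 i| <= B) ->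
  `|symp u v| <= n%:R * (2 * A * B).
Proof.
move=> uA vB; apply: (le_trans (ler_norm_sum _ _ _)).
apply: (@le_trans _ _ (\sum_(j < n) (2 * A * B))); last by rewrite sumr_const card_ord -[leLHS]mulr_natl.
apply: ler_sum => j _; apply: (le_trans (ler_normB _ _)); rewrite !normrM.
have h1 := ler_pM (normr_ge0 _) (normr_ge0 _) (uA (xidx j)) (vB (yidx j)).
have h2 := ler_pM (normr_ge0 _) (normr_ge0 _) (vB (xidx j)) (uA (yidx j)).
lra.
Qed.

Definition symp_sum gamma k : R :=
  \sum_(0 <= i < 2 ^ k) symp (gamma (i%:R / (2 ^ k)%:R)) (gamma (i.+1%:R / (2 ^ k)%:R)).

(** The Young form of the sum in (b). *)
Definition area gamma : R :=
  \sum_(j < n) (young_integral (fun t => gamma t 0 (xidx j)) (fun t => gamma t 0 (yidx j))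
                - young_integral (fun t => gamma t 0 (yidx j)) (fun t => gamma t 0 (xidx j))).

(** The diagonal terms cancel: x (y' - y) - y (x' - x) = x y' - x' y. *)
Lemma symp_sumE gamma k : symp_sum gamma k =
  \sum_(j < n) (left_sum (fun t => gamma t 0 (xidx j)) (fun t => gamma t 0 (yidx j)) k
                - left_sum (fun t => gamma t 0 (yidx j)) (fun t => gamma t 0 (xidx j)) k).
Proof.
rewrite /symp_sum /symp exchange_big; apply: eq_bigr => j _ /=.
by rewrite /left_sum -sumrB; apply: eq_bigr => i _; ring.
Qed.

Variable rho : R.
Hypothesis rho1 : 2 * rho ^+ 2 < 1.

Definition dyadic_holder_coords C gamma := forall i, dyadic_holder C rho (fun t => gamma t 0 i).

Lemma symp_sum_cvg C gamma : 0 <= C -> dyadic_holder_coords C gamma ->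
  symp_sum gamma k @[k --> \oo] --> area gamma.
Proof.
move=> C0 gH; have -> : symp_sum gamma = (fun k => \sum_(j < n)
    (left_sum (fun t => gamma t 0 (xidx j)) (fun t => gamma t 0 (yidx j)) k
     - left_sum (fun t => gamma t 0 (yidx j)) (fun t => gamma t 0 (xidx j)) k)).
  by apply/funext => k; exact: symp_sumE.
rewrite /area; apply: cvg_big => [|j _]; first exact: add_continuous.
by apply: cvgB; apply: (left_sum_cvg rho1 C0 C0).
Qed.

Lemma area_bound C gamma : 0 <= C -> dyadic_holder_coords C gamma ->
  `|area gamma - symp (gamma 0) (gamma 1)| <= n%:R * (2 * C ^+ 2 / (1 - 2 * rho ^+ 2)).
Proof.
move=> C0 gH.
have -> : symp (gamma 0) (gamma 1) = \sum_(j < n)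
    (gamma 0 0 (xidx j) * (gamma 1 0 (yidx j) - gamma 0 0 (yidx j))
     - gamma 0 0 (yidx j) * (gamma 1 0 (xidx j) - gamma 0 0 (xidx j))).
  by apply: eq_bigr => j _; ring.
rewrite -sumrB; apply: (le_trans (ler_norm_sum _ _ _)).
apply: (@le_trans _ _ (\sum_(j < n) (2 * C ^+ 2 / (1 - 2 * rho ^+ 2)))); last first.
  by rewrite sumr_const card_ord -[leLHS]mulr_natl.
apply: ler_sum => j _.
have h1 := young_integral_bound rho1 C0 C0 (gH (xidx j)) (gH (yidx j)).
have h2 := young_integral_bound rho1 C0 C0 (gH (yidx j)) (gH (xidx j)).
rewrite (_ : 2 * C ^+ 2 / _ = C * C / (1 - 2 * rho ^+ 2) + C * C / (1 - 2 * rho ^+ 2)); last by ring.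
set X := young_integral _ _ in h1 *; set Y := young_integral _ _ in h2 *.
have -> : X - Y - (gamma 0 0 (xidx j) * (gamma 1 0 (yidx j) - gamma 0 0 (yidx j))
     - gamma 0 0 (yidx j) * (gamma 1 0 (xidx j) - gamma 0 0 (xidx j))) =
   (X - gamma 0 0 (xidx j) * (gamma 1 0 (yidx j) - gamma 0 0 (yidx j))) -
   (Y - gamma 0 0 (yidx j) * (gamma 1 0 (xidx j) - gamma 0 0 (xidx j))) by ring.
by apply: (le_trans (ler_normB _ _)); apply: lerD.
Qed.

Lemma symp_sum_concat gamma (gam : nat -> R -> 'rV[R]_(2 * n)) K k :
  (forall i t, (i < 2 ^ K)%N -> 0 <= t <= 1 -> gamma ((i%:R + t) / (2 ^ K)%:R) = gam i t) ->
  symp_sum gamma (K + k) = \sum_(0 <= i < 2 ^ K) symp_sum (gam i) k.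
Proof.
move=> gE; rewrite /symp_sum expnD.
rewrite (sum_blocks (fun i => symp (gamma (i%:R / (2 ^ K * 2 ^ k)%:R))
  (gamma (i.+1%:R / (2 ^ K * 2 ^ k)%:R)))).
have K0 : (2 ^ K)%:R != 0 :> R by rewrite pnatr_eq0 expn_eq0.
have k0 : (2 ^ k)%:R != 0 :> R by rewrite pnatr_eq0 expn_eq0.
rewrite !big_nat; apply: eq_bigr => i /andP[_ iK]; rewrite !big_nat; apply: eq_bigr => l /andP[_ lk].
have e (l' : nat) : (l' <= 2 ^ k)%N ->
    gamma ((i * 2 ^ k + l')%:R / (2 ^ K * 2 ^ k)%:R) = gam i (l'%:R / (2 ^ k)%:R).
  move=> lk'; rewrite -gE//; last by have := @dyadic01 R k l' lk'; rewrite /= in_itv.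
  by congr gamma; rewrite natrD !natrM; field; rewrite K0 k0.
by rewrite -addnS !e// ltnW.
Qed.

(** The number of pieces is a power of two, so that the dyadic partitions of the pieces assemble
    into a dyadic partition of the whole. *)
Lemma area_concat C gamma (gam : nat -> R -> 'rV[R]_(2 * n)) K : 0 <= C ->
  dyadic_holder_coords C gamma ->
  (forall i, (i < 2 ^ K)%N -> dyadic_holder_coords C (gam i)) ->
  (forall i t, (i < 2 ^ K)%N -> 0 <= t <= 1 -> gamma ((i%:R + t) / (2 ^ K)%:R) = gam i t) ->
  area gamma = \sum_(0 <= i < 2 ^ K) area (gam i).
Proof.
move=> C0 gH gamH gE.
have c1 : symp_sum gamma (K + k) @[k --> \oo] --> area gamma.
  have := symp_sum_cvg C0 gH; rewrite -(cvg_shiftn K).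
  by under eq_fun do rewrite addnC.
apply: (cvg_unique (@Rhausdorff R) c1).
rewrite (_ : (fun k => _) = (fun k => \sum_(0 <= i < 2 ^ K) symp_sum (gam i) k)); last first.
  by apply/funext => k; exact: symp_sum_concat.
rewrite !big_mkord (_ : (fun k => _) = (fun k => \sum_(i < 2 ^ K) symp_sum (gam i) k)); last first.
  by apply/funext => k; rewrite big_mkord.
apply: cvg_big => [|i _]; first exact: add_continuous.
exact: symp_sum_cvg C0 (gamH _ (ltn_ord i)).
Qed.

(** The two left sums differ from the telescoping sum of g h by the sum of the products of
    increments, at most C^2 (2 rho^2)^k. *)
Lemma young_by_parts C (g h : R -> R) : 0 <= C -> dyadic_holder C rho g -> dyadic_holder C rho h ->
  young_integral g h + young_integral h g = g 1 * h 1 - g 0 * h 0.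
Proof.
move=> C0 gH hH.
have q1 : `|2 * rho ^+ 2| < 1 by rewrite ger0_norm// mulr_ge0// sqr_ge0.
have c1 : (left_sum g h k + left_sum h g k) @[k --> \oo] --> young_integral g h + young_integral h g.
  by apply: cvgD; apply: (left_sum_cvg rho1 C0 C0).
apply: (cvg_unique (@Rhausdorff R) c1); apply/cvgrPdist_lt => e e0.
have /cvgrPdist_lt/(_ _ e0) : geometric (C * C) (2 * rho ^+ 2) k @[k --> \oo] --> 0 by exact: cvg_geometric.
apply: filterS => k; rewrite sub0r normrN => hk; apply: le_lt_trans hk.
pose t i : R := i%:R / (2 ^ k)%:R.
have -> : g 1 * h 1 - g 0 * h 0 = \sum_(0 <= i < 2 ^ k) (g (t i.+1) * h (t i.+1) - g (t i) * h (t i)).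
  rewrite (telescope_sumr (fun i => g (t i) * h (t i)))// /t mul0r divff// pnatr_eq0 expn_eq0//.
rewrite /left_sum -big_split -sumrB; apply: (le_trans (ler_norm_sum _ _ _)).
rewrite /geometric /= [leRHS]ger0_norm; last first.
  by apply: mulr_ge0; [exact: mulr_ge0|rewrite exprn_ge0// mulr_ge0// sqr_ge0].
have -> : C * C * (2 * rho ^+ 2) ^+ k =
    \sum_(0 <= i < 2 ^ k) ((C * rho ^+ k) * (C * rho ^+ k)).
  rewrite sumr_const_nat subn0 -[_ *+ (2 ^ k)]mulr_natr natrX exprMn -exprM mulnC exprM expr2; ring.
rewrite !big_nat; apply: ler_sum => i /andP[_ ik]; rewrite -/(t i) -/(t i.+1) /=.
have I1 : `[0, 1]%classic (t i.+1) by exact: dyadic01.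
have I0 : `[0, 1]%classic (t i) by exact/dyadic01/ltnW.
have st : `|t i.+1 - t i| <= (2 ^ k)%:R^-1.
  by rewrite /t -mulrBl -natr1 addrC addKr mul1r ger0_norm.
rewrite (_ : _ - _ = (g (t i.+1) - g (t i)) * (h (t i.+1) - h (t i))); last by ring.
by rewrite normrM; apply: ler_pM => //; [exact: gH|exact: hH].
Qed.

End SymplecticArea.

(** * Comparison of the Euclidean distance with the sup norm *)

Section EuclidDist.
Context {R : realType}.
Variable m : nat.
Implicit Types (u v w : 'rV[R]_m) (B : R).

Lemma euclid_dist_ge0 u v : 0 <= euclid_dist u v. Proof. exact: sqrtr_ge0. Qed.

Lemma coord_le_euclid u v i : `|u 0 i - v 0 i| <= euclid_dist u v.
Proof.
rewrite /euclid_dist -sqrtr_sqr ler_wsqrtr// (bigD1 i)//= lerDl.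
by apply: sumr_ge0 => k _; exact: sqr_ge0.
Qed.

Lemma euclid_le u v B : 0 <= B -> (forall i, `|u 0 i - v 0 i| <= B) -> euclid_dist u v <= m%:R * B.
Proof.
move=> B0 uvB; have mB0 : 0 <= m%:R * B by rewrite mulr_ge0.
rewrite /euclid_dist -(ger0_norm mB0) -sqrtr_sqr ler_wsqrtr//.
apply: (@le_trans _ _ (\sum_(i < m) B ^+ 2)).
  apply: ler_sum => i _; rewrite -[X in X <= _]real_normK ?num_real//.
  by rewrite lerXn2r ?nnegrE.
rewrite sumr_const card_ord -[leLHS]mulr_natl exprMn ler_wpM2r ?sqr_ge0//.
by rewrite -natrX ler_nat; case: (m) => // k; rewrite expnS expn1 leq_pmull.
Qed.

Lemma coord_le_norm u i : `|u 0 i| <= `|u|.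
Proof.
rewrite [leRHS]/Num.norm /= mx_normrE.
exact: (le_bigmax _ (fun ij : 'I_1 * 'I_m => `|u ij.1 ij.2|) (0, i)).
Qed.

Lemma norm_le_coord u B : 0 <= B -> (forall i, `|u 0 i| <= B) -> `|u| <= B.
Proof.
move=> B0 uB; rewrite [leLHS]/Num.norm /= mx_normrE; apply: bigmax_le => // -[i j] _ /=.
by rewrite (ord1 i).
Qed.

Lemma euclid_le_norm u v : euclid_dist u v <= m%:R * `|u - v|.
Proof.
by apply: euclid_le => // i; have := coord_le_norm (u - v) i; rewrite !mxE.
Qed.

Lemma norm_le_euclid u v : `|u - v| <= euclid_dist u v.
Proof.
apply: norm_le_coord => [|i]; first exact: euclid_dist_ge0.
by rewrite !mxE; exact: coord_le_euclid.
Qed.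

End EuclidDist.

(** * Piecewise smooth curves are Lipschitz *)

Section PiecewiseSmooth.
Context {R : realType}.
Local Notation I := (`[0, 1]%classic : set R).

Lemma smooth_lipschitz (g : R -> R) : smooth g ->
  exists2 M : R, 0 <= M & forall s t, 0 <= s <= 1 -> 0 <= t <= 1 -> `|g s - g t| <= M * `|s - t|.
Proof.
move=> sg.
have cd : continuous (derive1 g).
  by move=> x; apply: differentiable_continuous; apply/derivable1_diffP; exact: (sg 1%N).
(* [lipschitz_of_derive] needs a bound on an interval centred at one of the two points, which may
   reach -1 or 2. *)
have cI : compact (`[-1, 2]%classic : set R) by exact: segment_compact.
have ud : unif_cont_on (`[-1, 2]%classic : set R) (derive1 g).
  by apply: heine_cantor => //; exact: continuous_subspaceT.
have [M M0 MP] := unif_cont_bounded cI ud.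
exists M; first exact: ltW.
move=> s t /andP[s0 s1] /andP[t0 t1]; apply: (@lipschitz_of_derive _ g (derive1 g)).
  by move=> x; apply: DeriveDef; [exact: (sg 0%N)|rewrite derive1E].
move=> x xt; apply: MP; rewrite /= in_itv/=.
have : `|s - t| <= 1 by rewrite ler_norml; apply/andP; split; lra.
by move: xt => /le_trans h /h; rewrite ler_norml => /andP[h1 h2]; apply/andP; split; lra.
Qed.

(** Induction on the breakpoints: a constant valid up to [T k] plus the constant of the next piece
    is valid up to [T k.+1]. *)
Lemma piecewise_smooth_lipschitz m (eta : R -> 'rV[R]_m) : piecewise_smooth eta ->
  exists2 L : R, 0 <= L &
    forall s t, 0 <= s <= 1 -> 0 <= t <= 1 -> euclid_dist (eta s) (eta t) <= L * `|s - t|.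
Proof.
move=> [s sP sg]; pose T k := nth 0 (0 :: s) k.
have T1 : T (size s) = 1 by exact: itv_partition_nth_size sP.
have TS k : (k < size s)%N -> T k <= T k.+1.
  by case: sP => /(pathP 0) h _ ks; apply/ltW/h.
have T01 k : (k <= size s)%N -> 0 <= T k <= 1.
  move=> ks; have ks' : (k < (size s).+1)%N by [].
  have -> : T k = nth 1 (0 :: s) k by exact: set_nth_default.
  by rewrite (itv_partition_nth_ge ks' sP) (itv_partition_nth_le ks' sP).
have coord (i : 'I_m) k : (k <= size s)%N -> exists2 L : R, 0 <= L &
    forall u v, 0 <= u -> u <= v -> v <= T k -> `|eta u 0 i - eta v 0 i| <= L * `|u - v|.
  elim: k => [_|k IH ks].
    exists 0 => // u v u0 uv vT; have -> : u = v by rewrite /T /= in vT; lra.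
    by rewrite !subrr normr0 mulr0.
  have [L L0 LP] := IH (ltnW ks).
  have [g /smooth_lipschitz[M M0 MP] gE] := sg k i ks.
  have /andP[a0 a1] := T01 _ (ltnW ks); have /andP[b0 b1] := T01 _ ks.
  have piece u v : T k <= u -> u <= v -> v <= T k.+1 -> `|eta u 0 i - eta v 0 i| <= M * `|u - v|.
    move=> ku uv vk; rewrite (gE u) ?(gE v).
    - by apply: MP; apply/andP; split; lra.
    - by apply/andP; split => //; exact: le_trans ku uv.
    - by apply/andP; split => //; exact: le_trans uv vk.
  exists (L + M); first exact: addr_ge0.
  move=> u v u0 uv vT; rewrite mulrDl.
  have d0 : 0 <= `|u - v| by [].
  have [vk|kv] := leP v (T k).
    by apply: (le_trans (LP u v u0 uv vk)); rewrite lerDl mulr_ge0.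
  have [ku|uk] := leP (T k) u.
    by apply: (le_trans (piece u v ku uv vT)); rewrite lerDr mulr_ge0.
  have -> : eta u 0 i - eta v 0 i = (eta u 0 i - eta (T k) 0 i) + (eta (T k) 0 i - eta v 0 i) by ring.
  apply: (le_trans (ler_normD _ _)); apply: lerD.
    apply: (le_trans (LP u _ u0 (ltW uk) (lexx _))); rewrite ler_wpM2l// !ler0_norm; lra.
  apply: (le_trans (piece _ v (lexx _) (ltW kv) vT)); rewrite ler_wpM2l// !ler0_norm; lra.
have /choice[L LP] : forall i : 'I_m, exists L : R, 0 <= L /\
    forall u v, 0 <= u -> u <= v -> v <= 1 -> `|eta u 0 i - eta v 0 i| <= L * `|u - v|.
  by move=> i; have [L L0 LP] := coord i _ (leqnn _); rewrite T1 in LP; exists L.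
pose M := \sum_i L i.
have LM i : L i <= M.
  by rewrite /M (bigD1 i)//= lerDl sumr_ge0// => k _; case: (LP k).
have M0 : 0 <= M by apply: sumr_ge0 => k _; case: (LP k).
exists (m%:R * M); first exact: mulr_ge0.
move=> u v Iu Iv; rewrite -mulrA; apply: euclid_le => [|i]; first exact: mulr_ge0.
wlog uv : u v Iu Iv / u <= v.
  move=> h; have [|/ltW] := leP u v; first exact: h.
  by rewrite distrC (distrC u); exact: h.
move: Iu Iv => /andP[u0 _] /andP[_ v1].
by case: (LP i) => _ h; apply: (le_trans (h u v u0 uv v1)); rewrite ler_wpM2r.
Qed.

Lemma lipschitz_unif_cont m (eta : R -> 'rV[R]_m) (L : R) :
  (forall s t, 0 <= s <= 1 -> 0 <= t <= 1 -> euclid_dist (eta s) (eta t) <= L * `|s - t|) ->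
  unif_cont_on I eta.
Proof.
move=> eL e e0; have L0 : 0 < `|L| + 1 by rewrite ltr_wpDl.
exists (e / (`|L| + 1)); first exact: divr_gt0.
move=> s t; rewrite /= !in_itv/= => Is It; rewrite ltr_pdivlMr// => st.
apply: (le_lt_trans (norm_le_euclid _ _)); apply: (le_lt_trans (eL s t Is It)).
apply: le_lt_trans st; rewrite mulrC ler_wpM2l//.
by have := ler_norm L; lra.
Qed.

End PiecewiseSmooth.

(** * Hölder maps along Lipschitz curves *)

Section HolderComposition.
Context {R : realType}.
Variables (m d : nat) (f : 'rV[R]_m -> 'rV[R]_d) (alpha : R).
Hypothesis alpha0 : 0 < alpha.
Implicit Types (eta : R -> 'rV[R]_m) (C L : R).

Lemma holder01_comp (S : set 'rV[R]_m) C L eta i : 0 <= C -> 0 <= L ->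
  (forall p q, S p -> S q -> euclid_dist (f p) (f q) <= C * euclid_dist p q `^ alpha) ->
  (forall t, 0 <= t <= 1 -> S (eta t)) ->
  (forall s t, 0 <= s <= 1 -> 0 <= t <= 1 -> euclid_dist (eta s) (eta t) <= L * `|s - t|) ->
  holder01 (C * L `^ alpha) alpha (fun t => f (eta t) 0 i).
Proof.
move=> C0 L0 fH eS eL s t Is It.
apply: (le_trans (coord_le_euclid _ _ i)); apply: (le_trans (fH _ _ (eS s Is) (eS t It))).
rewrite -mulrA ler_wpM2l// -powRM//.
by apply: powR_mono; [exact: ltW|exact: euclid_dist_ge0|exact: eL].
Qed.

(** The image of the curve is a compact subset of [Omega], so one local Hölder constant serves along
    it. *)
Lemma holder_loc_curve (Omega : set 'rV[R]_m) eta L : 0 <= L ->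
  holder_loc (@euclid_dist R _) alpha Omega f ->
  (forall t, 0 <= t <= 1 -> Omega (eta t)) ->
  (forall s t, 0 <= s <= 1 -> 0 <= t <= 1 -> euclid_dist (eta s) (eta t) <= L * `|s - t|) ->
  exists2 C, 0 <= C & forall i, holder01 C alpha (fun t => f (eta t) 0 i).
Proof.
move=> L0 fH eO eL.
have cK : compact (eta @` `[0, 1]%classic).
  apply: continuous_compact; last exact: segment_compact.
  by apply: unif_cont_within; exact: lipschitz_unif_cont eL.
have KO : eta @` `[0, 1]%classic `<=` Omega.
  by move=> _ [t /= It <-]; apply: eO; rewrite in_itv in It.
have [C CP] := fH _ cK KO.
exists (`|C| * L `^ alpha); first by rewrite mulr_ge0 ?powR_ge0.
move=> i; apply: (@holder01_comp (eta @` `[0, 1]%classic)) => //.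
move=> p q Kp Kq; apply: (le_trans (CP p q Kp Kq)).
by rewrite ler_wpM2r ?powR_ge0// ler_norm.
Qed.

End HolderComposition.

(** * Polygonal curves *)

Section Polygon.
Context {R : realType}.
Variable m : nat.
Implicit Types (p q : 'rV[R]_m) (P : nat -> 'rV[R]_m).

Definition seg p q (t : R) : 'rV[R]_m := p + t *: (q - p).

(** Each clamped coefficient grows from 0 to 1 on its own interval [i/N, (i+1)/N] and is constant
    elsewhere, which gives one formula for all [t]. *)
Definition polygon N P (t : R) : 'rV[R]_m :=
  P 0%N + \sum_(0 <= i < N) clamp (N%:R * t - i%:R) *: (P i.+1 - P i).

Lemma clamp_le0 (x : R) : x <= 0 -> clamp x = 0.
Proof. by move=> x0; rewrite /clamp (max_l x0) min_r. Qed.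

Lemma clamp_ge1 (x : R) : 1 <= x -> clamp x = 1.
Proof. by move=> x1; rewrite /clamp max_r ?(le_trans _ x1)// min_l. Qed.

Lemma polygonE N P i (t : R) : (i < N)%N -> 0 <= t <= 1 ->
  polygon N P ((i%:R + t) / N%:R) = seg (P i) (P i.+1) t.
Proof.
move=> iN /andP[t0 t1]; have N0 : N%:R != 0 :> R by rewrite pnatr_eq0; case: N iN.
rewrite /polygon (_ : N%:R * ((i%:R + t) / N%:R) = i%:R + t); last by field.
rewrite (big_cat_nat (n := i)) ?(ltnW iN)//= (big_ltn iN).
rewrite (_ : \sum_(0 <= j < i) _ = P i - P 0%N); last first.
  rewrite -telescope_sumr// !big_nat; apply: eq_bigr => j /andP[_ ji].
  rewrite clamp_ge1 ?scale1r//.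
  have : j.+1%:R <= i%:R :> R by rewrite ler_nat.
  by rewrite -natr1; lra.
rewrite (_ : \sum_(i.+1 <= j < N) _ = 0); last first.
  rewrite big_nat; apply: big1 => j /andP[ij _]; rewrite clamp_le0 ?scale0r//.
  have : i.+1%:R <= j%:R :> R by rewrite ler_nat.
  by rewrite -natr1; lra.
rewrite (_ : i%:R + t - i%:R = t); last by ring.
rewrite clampE ?t0 ?t1// addr0 addrA; congr (_ + _).
by rewrite addrC subrK.
Qed.

Lemma unit_piece N (t : R) : (0 < N)%N -> 0 <= t <= 1 ->
  exists i (u : R), [/\ (i < N)%N, 0 <= u <= 1 & t = (i%:R + u) / N%:R].
Proof.
move=> N0 /andP[t0 t1].
have Nn : 0 < N%:R :> R by rewrite ltr0n.
suff [i [u [iN u01 e]]] : exists i (u : R), [/\ (i < N)%N, 0 <= u <= 1 & N%:R * t = i%:R + u].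
  by exists i, u; split => //; rewrite -e mulrC mulKf// gt_eqF.
have x0 : 0 <= N%:R * t by rewrite mulr_ge0.
have xN : N%:R * t <= N%:R by rewrite ler_piMr.
move: (N%:R * t) x0 xN => x x0; elim: N N0 {Nn} => // N IH _ xN.
have [Nx|xN'] := leP N%:R x.
  exists N, (x - N%:R); split=> //; last by ring.
  by move: xN; rewrite -natr1 => xN; apply/andP; split; lra.
have N0 : (0 < N)%N by case: N {IH xN} xN' => // h; lra.
have [i [u [iN u01 e]]] := IH N0 (ltW xN').
by exists i, u; split => //; exact: ltnW.
Qed.

Lemma affine_smooth (a b : R) : smooth (fun t => a + t * b).
Proof.
move=> k; have [a' [b' ->]] : exists a' b', derive1n k (fun t => a + t * b) = (fun t => a' + t * b').
  elim: k => [|k [a' [b' IH]]]; first by exists a, b.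
  exists b', 0; apply/funext => t; rewrite derive1nS IH derive1E mulr0 addr0.
  apply: (@derive_val _ _ _ _ _ _ _ _).
  by apply: is_derive_eq; rewrite add0r mul1r scaler0 add0r [_ *: _]mulr1.
by move=> x; exact: ex_derive.
Qed.

Lemma polygon_piecewise_smooth N P : (0 < N)%N -> piecewise_smooth (polygon N P).
Proof.
move=> N0; have Nn : 0 < N%:R :> R by rewrite ltr0n.
pose s : seq R := mkseq (fun i => i.+1%:R / N%:R) N.
have nthE k : (k <= N)%N -> nth 0 (0 :: s) k = k%:R / N%:R.
  by case: k => [_|k kN]; rewrite /= ?mul0r// nth_mkseq.
exists s.
  split; last by rewrite -nth_last size_mkseq nth_mkseq ?prednK// divff// gt_eqF.
  apply/(pathP 0) => i; rewrite size_mkseq => iN; rewrite nthE ?(ltnW iN)// nth_mkseq//.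
  by rewrite ltr_pM2r ?invr_gt0// ltr_nat.
move=> k i; rewrite size_mkseq => kN.
exists (fun t => (P k 0 i - k%:R * (P k.+1 0 i - P k 0 i)) + t * (N%:R * (P k.+1 0 i - P k 0 i))).
  exact: affine_smooth.
move=> t; rewrite nthE ?(ltnW kN)// nthE// => /andP[kt tk].
have u01 : 0 <= N%:R * t - k%:R <= 1.
  move: kt tk; rewrite ler_pdivrMr// ler_pdivlMr// -natr1 mulrC => h1 h2; apply/andP; split; lra.
have tE : t = (k%:R + (N%:R * t - k%:R)) / N%:R by field; rewrite gt_eqF.
by rewrite {1}tE polygonE// /seg !mxE; ring.
Qed.

End Polygon.

(** * Polygonal chains and the potential *)

Section Chains.
Context {R : realType}.
Variables (m n : nat) (Omega : set 'rV[R]_m) (alpha : R) (f : 'rV[R]_m -> 'rV[R]_(2 * n)).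
Hypotheses (oO : open Omega) (cO : connected Omega).
Hypothesis alpha12 : 2^-1 < alpha.
Hypothesis fH : holder_loc (@euclid_dist R _) alpha Omega f.
Implicit Types (p q : 'rV[R]_m) (P : nat -> 'rV[R]_m).
Local Notation rho := ((2 : R) `^ (- alpha)).

Definition segment_in p q := forall t : R, 0 <= t <= 1 -> Omega (seg p q t).
Definition chain N P := forall i, (i < N)%N -> segment_in (P i) (P i.+1).
Definition segment_area p q := area (fun t => f (seg p q t)).

Lemma segment_in_sym p q : segment_in p q -> segment_in q p.
Proof.
move=> pq t /andP[t0 t1]; have -> : seg q p t = seg p q (1 - t).
  by apply/rowP => i; rewrite /seg !mxE; ring.
by apply: pq; apply/andP; split; lra.
Qed.

Lemma curve_holder eta : piecewise_smooth eta -> (forall t, 0 <= t <= 1 -> Omega (eta t)) ->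
  exists2 C, 0 <= C & forall i, holder01 C alpha (fun t => f (eta t) 0 i).
Proof.
move=> /piecewise_smooth_lipschitz[L L0 eL] eO.
have alpha0 : 0 < alpha by apply: lt_trans alpha12; rewrite invr_gt0.
by have := holder_loc_curve alpha0 L0 fH eO eL.
Qed.

Lemma segment_area_const p : segment_area p p = 0.
Proof.
have cst0 : dyadic_holder_coords rho 0 (fun t => f (seg p p t)).
  by move=> i k s t _ _ _; rewrite /seg subrr !scaler0 subrr normr0 mul0r.
have := area_bound (dyadic_rate alpha12) (lexx 0) cst0.
rewrite expr2 !mulr0 mul0r mulr0 normr_le0 subr_eq0 => /eqP; rewrite /segment_area => ->.
by rewrite /seg subrr !scaler0 sympxx.
Qed.

Hypothesis loops : forall eta, closed_curve_in Omega eta -> area (fun t => f (eta t)) = 0.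

(** A closed chain parametrises a piecewise smooth loop in [Omega], and [area_concat] splits its
    area into those of the edges. *)
Lemma closed_chain_area N P : chain N P -> P 0%N = P N ->
  \sum_(0 <= i < N) segment_area (P i) (P i.+1) = 0.
Proof.
case: N => [_ _|N]; first by rewrite big_geq.
set M := N.+1 => cP P0M.
(* Repeating the last vertex brings the number of edges to a power of two; the added constant
   segments have area 0. *)
pose Q i := P (minn i M); have M2 : (M <= 2 ^ M)%N by exact/ltnW/ltn_expl.
have n2 : (0 < 2 ^ M)%N by rewrite expn_gt0.
have QE i : (i <= M)%N -> Q i = P i by rewrite /Q => /minn_idPl ->.
have QM i : (M <= i)%N -> Q i = P M by rewrite /Q => /minn_idPr ->.
have OPM : Omega (P M).
  have h : 0 <= (1 : R) <= 1 by rewrite lexx ler01.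
  by have := cP N (leqnn _) 1 h; rewrite /seg scale1r addrC subrK.
have cQ : chain (2 ^ M) Q.
  move=> i _; have [iM|Mi] := ltnP i M; first by rewrite !QE//; [exact: cP|exact: ltnW].
  by rewrite !QM// ?(leqW Mi)// => t _; rewrite /seg subrr scaler0 addr0.
have sm := polygon_piecewise_smooth Q n2.
have inO (t : R) : 0 <= t <= 1 -> Omega (polygon (2 ^ M) Q t).
  by move=> /(unit_piece n2)[i [u [iM u01 ->]]]; rewrite polygonE//; exact: cQ.
have i0 : 0 <= (0 : R) <= 1 by rewrite lexx ler01.
have i1 : 0 <= (1 : R) <= 1 by rewrite lexx ler01.
have n2R : (2 ^ M)%:R != 0 :> R by rewrite pnatr_eq0 -lt0n.
have closed : polygon (2 ^ M) Q 0 = polygon (2 ^ M) Q 1.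
  have := polygonE Q n2 i0; rewrite addr0 mul0r /seg scale0r addr0 => ->.
  have ltp : ((2 ^ M).-1 < 2 ^ M)%N by rewrite prednK.
  have := polygonE Q ltp i1; rewrite natr1 prednK// divff// /seg scale1r addrC subrK => ->.
  by rewrite QE// QM.
have := loops (And3 sm inO closed).
have [C C0 CH] := curve_holder sm inO.
have alpha0 : 0 <= alpha by apply/ltW/(lt_trans _ alpha12); rewrite invr_gt0.
have gH : dyadic_holder_coords rho C (fun t => f (polygon (2 ^ M) Q t)).
  by move=> i; apply: dyadic_holder01.
rewrite (@area_concat _ _ _ (dyadic_rate alpha12) C _ (fun i t => f (seg (Q i) (Q i.+1) t)) M)//.
- rewrite (big_cat_nat (n := M))//= [X in _ + X](_ : _ = 0) ?addr0.
    move=> h; rewrite -[RHS]h !big_nat; apply: eq_bigr => i /andP[_ iM].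
    by rewrite !QE// ltnW.
  rewrite big_nat; apply: big1 => i /andP[Mi _].
  by rewrite !QM ?(leqW Mi)//; exact: segment_area_const.
- move=> i iM l k s t; rewrite /= !in_itv/= => Is It st; rewrite -!(polygonE Q iM)//.
  have inI (u : R) : 0 <= u <= 1 -> `[0, 1]%classic ((i%:R + u) / (2 ^ M)%:R).
    move=> /andP[u0 u1]; rewrite /= in_itv/= divr_ge0 ?addr_ge0//= ler_pdivrMr ?ltr0n// mul1r.
    have : i.+1%:R <= (2 ^ M)%:R :> R by rewrite ler_nat.
    by rewrite -natr1; lra.
  apply: gH; [exact: inI|exact: inI|apply: le_trans st].
  rewrite -mulrBl opprD addrACA subrr add0r normrM ler_piMr//.
  by rewrite normfV ger0_norm// invf_le1 ?ltr0n// ler1n.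
- by move=> i t iM It; rewrite polygonE.
Qed.

Lemma segment_areaN p q : segment_in p q -> segment_area q p = - segment_area p q.
Proof.
move=> pq; pose P i := if odd i then q else p.
have qp := segment_in_sym pq.
have cP : chain 2 P by move=> [|[|//]] _.
have := closed_chain_area cP erefl.
by rewrite !big_nat_recr//= big_geq// add0r => /eqP; rewrite addrC addr_eq0 => /eqP.
Qed.

(** The set of points reachable from [p0] is open, and closed in [Omega], because a small ball in
    [Omega] is joined to its centre by segments. *)
Lemma chain_exists p0 p : Omega p0 -> Omega p ->
  exists N P, [/\ chain N P, P 0%N = p0 & P N = p].
Proof.
move=> O0 Op.
pose S := [set x | Omega x /\ exists N P, [/\ chain N P, P 0%N = p0 & P N = x]].
have ext x y : S x -> segment_in x y -> S y.
  move=> [Ox [N [P [cP P0 PN]]]] xy.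
  have h : 0 <= (1 : R) <= 1 by rewrite lexx ler01.
  split; first by have := xy 1 h; rewrite /seg scale1r addrC subrK.
  exists N.+1, (fun i => if (i <= N)%N then P i else y); split=> /=.
  - move=> i; rewrite ltnS => iN; rewrite iN; have [iN'|Ni] := ltnP i N; first exact: cP.
    have -> : i = N by apply/eqP; rewrite eqn_leq iN Ni.
    by rewrite PN.
  - by [].
  - by rewrite ltnn.
have ballO x : Omega x -> exists2 r : R, 0 < r & forall y, `|x - y| < r -> segment_in x y /\ segment_in y x.
  move=> Ox; have [r /= r0 rP] := (nbhs_ballP _ _).1 (open_nbhs_nbhs (conj oO Ox)).
  exists r => // y xy; split=> t /andP[t0 t1]; apply: rP; rewrite -ball_normE /= /seg.
    rewrite opprD addrA subrr sub0r normrN normrZ ger0_norm// distrC.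
    by apply: le_lt_trans xy; rewrite ler_piMl.
  have -> : x - (y + t *: (x - y)) = (1 - t) *: (x - y).
    by apply/rowP => i; rewrite !mxE; ring.
  rewrite normrZ ger0_norm ?subr_ge0//; apply: le_lt_trans xy; rewrite ler_piMl//; lra.
suff SO : S = Omega by move: Op; rewrite -SO => -[].
apply: cO.
- exists p0; split => //; exists 0%N, (fun=> p0); by split.
- exists S; last by apply/seteqP; split => [x Sx|x []//]; split => //; case: Sx.
  rewrite openE => x Sx; have [r r0 rP] := ballO x (proj1 Sx).
  apply/nbhs_ballP; exists r => //= y; rewrite -ball_normE /= => xy.
  by have [h1 _] := rP y xy; exact: ext Sx h1.
- exists (~` (Omega `\` S)); last first.
    apply/seteqP; split => [x Sx|x [Ox h]]; first by split; [case: Sx|move=> []].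
    by apply: contrapT => nS; apply: h.
  rewrite closedC openE => x [Ox nS]; have [r r0 rP] := ballO x Ox.
  apply/nbhs_ballP; exists r => //= y; rewrite -ball_normE /= => xy.
  have [h1 h2] := rP y xy; split.
    have h : 0 <= (1 : R) <= 1 by rewrite lexx ler01.
    by have := h1 1 h; rewrite /seg scale1r addrC subrK.
  by move=> Sy; apply: nS; exact: ext Sy h2.
Qed.

(** A chain from a base point is chosen for each point, and the potential is -2 times its area. Its
    increment over a segment is read off from a closed chain of area 0. *)
Lemma potential_exists : Omega !=set0 -> exists tau : 'rV[R]_m -> R,
  forall p q, Omega p -> Omega q -> segment_in q p -> tau p - tau q = - 2 * segment_area q p.
Proof.
move=> [p0 O0].
have /choice[h hP] : forall p, exists NP : nat * (nat -> 'rV[R]_m),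
    Omega p -> [/\ chain NP.1 NP.2, NP.2 0%N = p0 & NP.2 NP.1 = p].
  move=> p; have [Op|nO] := pselect (Omega p); last by exists (0%N, fun=> p0).
  by have [N [P NP]] := chain_exists O0 Op; exists (N, P).
pose A p := \sum_(0 <= i < (h p).1) segment_area ((h p).2 i) ((h p).2 i.+1).
exists (fun p => - 2 * A p) => p q Op Oq qp; rewrite -mulrBr; congr (_ * _).
have [cp p00 pN] := hP p Op; have [cq q00 qN] := hP q Oq.
rewrite /A; move: (h p).1 (h p).2 (h q).1 (h q).2 cp p00 pN cq q00 qN => N P M Q cp p00 pN cq q00 qN.
(* The closed chain follows the chain of [q], then the segment from [q] to [p], then the chain of
   [p] backwards. *)
pose W i := if (i <= M)%N then Q i else P (N - (i - M.+1))%N.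
have W1 i : (i <= M)%N -> W i = Q i by rewrite /W => ->.
have W2 i : (i <= N)%N -> W (M.+1 + i)%N = P (N - i)%N.
  by move=> iN; rewrite /W leqNgt ltn_addr//= addKn.
have cW : chain (M.+1 + N) W.
  move=> i; have [iM|] := ltnP i M; first by rewrite !W1 ?(ltnW iM)// => _; exact: cq.
  rewrite leq_eqVlt => /orP[/eqP <- _|Mi iMN].
    by rewrite W1// -[M.+1]addn0 W2// subn0 pN qN.
  rewrite -(subnKC Mi) -addnS !W2; [|lia|lia].
  by rewrite (_ : N - (i - M.+1) = (N - (i - M.+1).+1).+1)%N; [apply/segment_in_sym/cp; lia|lia].
have W0N : W 0%N = W (M.+1 + N)%N by rewrite W1// W2// subnn q00 p00.
have := closed_chain_area cW W0N.
rewrite (big_cat_nat (n := M.+1)) ?leq_addr//= big_nat_recr//=.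
rewrite (_ : \sum_(M.+1 <= i < M.+1 + N) segment_area (W i) (W i.+1) =
    \sum_(0 <= i < N) segment_area (W (i + M.+1)%N) (W (i + M.+1).+1)); last first.
  by rewrite -{1}[M.+1]add0n big_addn addKn.
rewrite (_ : \sum_(0 <= i < M) segment_area (W i) (W i.+1) =
    \sum_(0 <= i < M) segment_area (Q i) (Q i.+1)); last first.
  by rewrite !big_nat; apply: eq_bigr => i /andP[_ iM]; rewrite !W1// ltnW.
rewrite (_ : \sum_(0 <= i < N) _ = - \sum_(0 <= i < N) segment_area (P i) (P i.+1)); last first.
  rewrite big_nat_rev /= add0n -sumrN !big_nat; apply: eq_bigr => i /andP[_ iN].
  rewrite addnC -addnS !W2; [|lia|lia].
  rewrite -segment_areaN; last exact: cp.
  by congr segment_area; congr P; lia.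
rewrite W1// -[M.+1]addn0 W2// subn0 pN qN.
set X := \sum_(0 <= i < M) _; set Y := \sum_(0 <= i < N) _ => e; lra.
Qed.

End Chains.

(** * Hölder maps into the Heisenberg group and areas of loops *)

Section HorizontalLift.
Context {R : realType}.
Variables (m n : nat) (Omega : set 'rV[R]_m) (alpha : R) (f : 'rV[R]_m -> 'rV[R]_(2 * n)).
Hypotheses (oO : open Omega) (alpha12 : 2^-1 < alpha).
Hypothesis fH : holder_loc (@euclid_dist R _) alpha Omega f.
Implicit Types (p q : 'rV[R]_m) (K : set 'rV[R]_m) (tau : 'rV[R]_m -> R).
Local Notation rho := ((2 : R) `^ (- alpha)).

Let alpha0 : 0 < alpha. Proof. by apply: lt_trans alpha12; rewrite invr_gt0. Qed.

(** As [K] need not be convex, segments between nearby points of [K] are kept in a larger compact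
    set, which has its own Hölder constant. *)
Lemma compact_thickening K : compact K -> K `<=` Omega ->
  exists (r : R) (K' : set 'rV[R]_m), [/\ 0 < r, compact K', K' `<=` Omega &
    forall p q, K p -> `|p - q| <= r -> K' q].
Proof.
move=> cK KO; have /compact_near_coveringP ncK := cK.
have [|d /= d0 dP] := ncK R (0^'+) (fun e x => forall q, `|x - q| <= e -> Omega q) _.
  move=> x Kx.
  have [r /= r0 rP] := (nbhs_ballP _ _).1 (open_nbhs_nbhs (conj oO (KO x Kx))).
  exists (ball x (r / 2), [set e : R | e < r / 2]) => /=.
    split; first by apply: nbhsx_ballx; rewrite divr_gt0.
    by apply: nbhs_right_lt; rewrite divr_gt0.
  move=> [p e] [/= xp er] q pq; apply: rP; move: xp; rewrite -!ball_normE /= => xp.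
  have := ler_distD p x q; lra.
pose r := d / 4; have r0 : 0 < r by rewrite divr_gt0.
have rd : r + r < d by rewrite /r; lra.
have rP p q : K p -> `|p - q| <= r + r -> Omega q.
  move=> Kp; apply: (dP (r + r)) => //=; last by lra.
  by rewrite sub0r normrN gtr0_norm//; lra.
have [M [_ MP]] := compact_bounded cK.
have KM p : K p -> `|p| <= `|M| + 1.
  by apply: MP; have := ler_norm M; lra.
(* Being at distance at least [r] from the complement of [Omega] is a closed condition; it holds
   within [r] of [K] because 2r < d. *)
exists r, [set x | `|x| <= `|M| + 1 + r /\ forall y, ~ Omega y -> r <= `|x - y|]; split => //.
- have cn (V : normedModType R) (y : V) : continuous (fun x : V => `|x - y|).
    move=> x; apply/cvgrPdist_lt => e e0; apply/nbhs_ballP; exists e => // z.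
    rewrite -ball_normE /= => xz; apply: (le_lt_trans (ler_dist_dist _ _)).
    by rewrite opprB addrA subrK.
  apply: bounded_closed_compact.
    exists (`|M| + 1 + r); split; first exact: num_real.
    by move=> N MN x [/= h _]; apply: (le_trans h); exact: ltW.
  have -> : [set x : 'rV[R]_m | `|x| <= `|M| + 1 + r /\ forall y, ~ Omega y -> r <= `|x - y|] =
      [set x | `|x| <= `|M| + 1 + r] `&` \bigcap_(y in ~` Omega) [set x | r <= `|x - y|].
    by apply/seteqP; split => x [h1 h2].
  apply: closedI.
    apply: (@closed_comp _ _ (fun x : 'rV[R]_m => `|x|) [set t | t <= _]); last exact: closed_le.
    by move=> x _; exact: norm_continuous.
  apply: closed_bigI => y _.
  apply: (@closed_comp _ _ (fun x : 'rV[R]_m => `|x - y|) [set t | r <= t]); last exact: closed_ge.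
  by move=> x _; exact: (@cn _ y).
- move=> x [_ h]; apply: contrapT => /h; rewrite subrr normr0; lra.
- move=> p q Kp pq; split.
    have -> : q = p - (p - q) by rewrite opprB addrC subrK.
    by apply: (le_trans (ler_normB _ _)); have := KM p Kp; lra.
  move=> y nO; rewrite leNgt; apply/negP => qy; apply: nO; apply: (rP p) => //.
  by have := ler_distD q p y; lra.
Qed.

Lemma euclid_seg p q (s t : R) : euclid_dist (seg p q s) (seg p q t) = `|s - t| * euclid_dist p q.
Proof.
rewrite -sqrtr_sqr /euclid_dist -sqrtrM ?sqr_ge0// mulr_sumr; congr Num.sqrt.
by apply: eq_bigr => i _; rewrite /seg !mxE; ring.
Qed.

(** [area_bound] on the segment, where [f] composed with the parametrisation has Hölder constant C
    |p - q|^alpha. *)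
Lemma segment_area_bound (S : set 'rV[R]_m) (C : R) p q : 0 <= C ->
  (forall x y, S x -> S y -> euclid_dist (f x) (f y) <= C * euclid_dist x y `^ alpha) ->
  (forall t : R, 0 <= t <= 1 -> S (seg p q t)) ->
  `|segment_area f p q - symp (f p) (f q)| <=
    n%:R * (2 * C ^+ 2 / (1 - 2 * rho ^+ 2)) * (euclid_dist p q `^ alpha) ^+ 2.
Proof.
move=> C0 fC pqS; set u := euclid_dist p q `^ alpha.
have u0 : 0 <= u by exact: powR_ge0.
have gH : dyadic_holder_coords rho (C * u) (fun t => f (seg p q t)).
  move=> i; apply: dyadic_holder01 => //; [exact: mulr_ge0|exact: ltW|].
  apply: (holder01_comp alpha0 i C0 (euclid_dist_ge0 p q) fC pqS) => s t _ _.
  by rewrite euclid_seg mulrC.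
have := area_bound (dyadic_rate alpha12) (mulr_ge0 C0 u0) gH.
rewrite /seg scale0r scale1r addr0 (addrC p (q - p)) subrK => /le_trans; apply.
by rewrite exprMn le_eqVlt; apply/orP; left; apply/eqP; ring.
Qed.

Lemma koranyi_le (P Q : heisenberg n) (v : R) : 0 <= v -> euclid_dist P.1 Q.1 <= v ->
  `|P.2 - Q.2 + 2 * symp Q.1 P.1| <= v ^+ 2 -> @koranyi R n P Q <= 2 * v.
Proof.
move=> v0 h1 h2; rewrite /koranyi -/(symp Q.1 P.1).
have v20 : 0 <= 2 * v by rewrite mulr_ge0.
have -> : 2 * v = ((2 * v) ^+ 4) `^ 4^-1.
  by rewrite -powR_mulrn// -powRrM divff ?pnatr_eq0// powRr1.
apply: powR_mono.
- by rewrite invr_ge0.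
- by rewrite addr_ge0 ?exprn_ge0 ?euclid_dist_ge0.
- have e1 : euclid_dist P.1 Q.1 ^+ 4 <= v ^+ 4.
    by rewrite lerXn2r// nnegrE ?euclid_dist_ge0.
  have e2 : `|P.2 - Q.2 + 2 * symp Q.1 P.1| ^+ 2 <= (v ^+ 2) ^+ 2.
    by rewrite lerXn2r// nnegrE ?sqr_ge0.
  rewrite -exprM in e2; rewrite exprMn.
  by have : 0 <= v ^+ 4 by [exact: exprn_ge0]; move: e1 e2 => /=; lra.
Qed.

Lemma le_koranyi (P Q : heisenberg n) : `|P.2 - Q.2 + 2 * symp Q.1 P.1| <= @koranyi R n P Q ^+ 2.
Proof.
rewrite /koranyi -/(symp Q.1 P.1); set D := _ ^+ 4; set X := `|_|.
have X0 : 0 <= X ^+ 2 by exact: sqr_ge0.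
have D0 : 0 <= D by rewrite exprn_ge0// euclid_dist_ge0.
rewrite -powR_mulrn ?powR_ge0// -powRrM.
have -> : (4^-1 * 2%:R : R) = 2^-1 by field.
rewrite powR12_sqrt ?addr_ge0//; apply: (@le_trans _ _ (Num.sqrt (X ^+ 2))).
  by rewrite sqrtr_sqr ler_norm.
by rewrite ler_wsqrtr// lerDr.
Qed.

Lemma holder_unif_cont (V : normedModType R) K (g : 'rV[R]_m -> V) (M r : R) : 0 < r ->
  (forall p q, K p -> K q -> `|p - q| <= r -> `|g p - g q| <= M * euclid_dist p q `^ alpha) ->
  unif_cont_on K g.
Proof.
move=> r0 gH e e0; have M0 : 0 < `|M| + 1 by rewrite ltr_wpDl.
have [|d d0 dE] := @small_powR R alpha (e / (`|M| + 1)) alpha0; first exact: divr_gt0.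
have m0 : 0 < m%:R + 1 :> R by rewrite ltr_wpDl.
exists (Num.min r (d / (m%:R + 1))); first by rewrite lt_min r0 divr_gt0.
move=> p q Kp Kq; rewrite lt_min => /andP[/ltW pr]; rewrite ltr_pdivlMr// => pd.
apply: (le_lt_trans (gH p q Kp Kq pr)).
have ud : euclid_dist p q `^ alpha <= d `^ alpha.
  apply: powR_mono; [exact: ltW|exact: euclid_dist_ge0|].
  apply: (le_trans (euclid_le_norm _ _)); apply: le_trans (ltW pd).
  by rewrite mulrC ler_wpM2l//; lra.
have u0 : 0 <= euclid_dist p q `^ alpha by exact: powR_ge0.
apply: (@le_lt_trans _ _ (`|M| * d `^ alpha)).
  by apply: (@le_trans _ _ (`|M| * euclid_dist p q `^ alpha)); [rewrite ler_wpM2r// ler_norm|rewrite ler_wpM2l].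
by rewrite dE mulrCA gtr_pMr// ltr_pdivrMr// mul1r; lra.
Qed.

(** For nearby points the segment lies in [Omega], and the vertical term is -2 times the quantity
    estimated in [segment_area_bound]. For points more than [r] apart, boundedness on [K] is
    enough. *)
Lemma potential_holder tau :
  (forall p q, Omega p -> Omega q -> segment_in Omega q p ->
    tau p - tau q = - 2 * segment_area f q p) ->
  holder_loc (@koranyi R n) alpha Omega (fun p => (f p, tau p)).
Proof.
move=> tauE K cK KO; have [r [K' [r0 cK' K'O KK']]] := compact_thickening cK KO.
have [C0 C0P] := fH cK' K'O; pose C := `|C0|.
have CP p q : K' p -> K' q -> euclid_dist (f p) (f q) <= C * euclid_dist p q `^ alpha.
  move=> Kp Kq; apply: (le_trans (C0P p q Kp Kq)).
  by rewrite ler_wpM2r ?powR_ge0// ler_norm.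
have C_ge0 : 0 <= C by exact: normr_ge0.
have subK p : K p -> K' p by move=> Kp; apply: (KK' p) => //; rewrite subrr normr0 ltW.
pose E := 2 * (n%:R * (2 * C ^+ 2 / (1 - 2 * rho ^+ 2))).
have E0 : 0 <= E.
  rewrite /E !mulr_ge0// ?sqr_ge0// invr_ge0 subr_ge0 ltW//; exact: dyadic_rate.
pose X p q := tau p - tau q + 2 * symp (f q) (f p).
have near_bound p q : K p -> K q -> `|p - q| <= r -> `|X p q| <= E * (euclid_dist p q `^ alpha) ^+ 2.
  move=> Kp Kq pq.
  have qpK' (t : R) : 0 <= t <= 1 -> K' (seg q p t).
    move=> /andP[t0 t1]; apply: (KK' q) => //; rewrite /seg opprD addNKr normrN normrZ ger0_norm//.
    by apply: le_trans pq; rewrite ler_piMl.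
  have qpO : segment_in Omega q p by move=> t It; apply/K'O/qpK'.
  have h := segment_area_bound C_ge0 CP qpK'.
  rewrite /X tauE//; [|exact: KO|exact: KO].
  have -> : - 2 * segment_area f q p + 2 * symp (f q) (f p) =
    - (2 * (segment_area f q p - symp (f q) (f p))) by ring.
  rewrite normrN normrM ger0_norm// /E -mulrA ler_pM2l//.
  by rewrite (_ : euclid_dist p q = euclid_dist q p)// /euclid_dist; congr Num.sqrt; apply: eq_bigr => i _; ring.
have fuc : unif_cont_on K f.
  apply: (@holder_unif_cont _ K f C r r0) => p q Kp Kq _.
  by apply: (le_trans (norm_le_euclid _ _)); apply: CP; exact: subK.
have [F F0 FP] := unif_cont_bounded cK fuc.
have coordF p i : K p -> `|f p 0 i| <= F by move=> /FP; apply: le_trans; exact: coord_le_norm.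
(* The bound for nearby points makes [tau] continuous, hence bounded on the compact [K], as is
   needed for distant points. *)
have tuc : unif_cont_on K tau.
  pose U := (m%:R * r) `^ alpha.
  apply: (@holder_unif_cont _ K tau (2 * (n%:R * (2 * F * C)) + E * U) r r0) => p q Kp Kq pq.
  set u := euclid_dist p q `^ alpha.
  have u0 : 0 <= u by exact: powR_ge0.
  have uU : u <= U.
    apply: powR_mono; [exact: ltW|exact: euclid_dist_ge0|].
    by apply: (le_trans (euclid_le_norm _ _)); rewrite ler_wpM2l.
  have h1 := near_bound p q Kp Kq pq; rewrite -/u in h1.
  have h2 : `|symp (f q) (f p)| <= n%:R * (2 * F * (C * u)).
    rewrite symp_diff; apply: symp_bound => i; first exact: coordF.
    rewrite !mxE; apply: (le_trans (coord_le_euclid _ _ i)); apply: CP; exact: subK.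
  have -> : tau p - tau q = X p q - 2 * symp (f q) (f p) by rewrite /X; ring.
  apply: (le_trans (ler_normB _ _)); rewrite normrM (ger0_norm (ler0n R 2)).
  have h3 : E * u ^+ 2 <= E * U * u by rewrite expr2 mulrA ler_wpM2r// ler_wpM2l.
  have -> : (2 * (n%:R * (2 * F * C)) + E * U) * u = 2 * (n%:R * (2 * F * (C * u))) + E * U * u by ring.
  by lra.
have [T T0 TP] := unif_cont_bounded cK tuc.
pose X0 := 2 * T + 2 * (n%:R * (2 * F * F)); pose ra := r `^ alpha.
have ra0 : 0 < ra by exact: powR_gt0.
have X00 : 0 <= X0 by rewrite /X0 addr_ge0// ?mulr_ge0// ltW.
have XX0 p q : K p -> K q -> `|X p q| <= X0.
  move=> Kp Kq; apply: (le_trans (ler_normD _ _)); rewrite normrM (ger0_norm (ler0n R 2)).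
  apply: lerD; first by apply: (le_trans (ler_normB _ _)); have := TP p Kp; have := TP q Kq; lra.
  by rewrite ler_pM2l//; apply: symp_bound => i; exact: coordF.
(* [koranyi_le] takes the same v for both components. Since A >= 1 one has A u^2 <= (A u)^2, so [A]
   can collect all the constants. *)
pose A := C + E + 1 + X0 / ra ^+ 2.
have Z0 : 0 <= X0 / ra ^+ 2 by rewrite divr_ge0// sqr_ge0.
have A1 : 1 <= A by rewrite /A; lra.
have A0 : 0 <= A by lra.
have A2 : A <= A ^+ 2 by rewrite expr2 ler_peMr.
exists (2 * A) => p q Kp Kq; rewrite -mulrA; set u := euclid_dist p q `^ alpha.
have u0 : 0 <= u by exact: powR_ge0.
have u20 : 0 <= u ^+ 2 by exact: sqr_ge0.
apply: koranyi_le; first exact: mulr_ge0.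
  by apply: (le_trans (CP p q (subK _ Kp) (subK _ Kq))); rewrite ler_wpM2r// /A; lra.
rewrite /= -/(X p q) exprMn; apply: (@le_trans _ _ (A * u ^+ 2)); last by rewrite ler_wpM2r.
have [pq|pq] := leP `|p - q| r.
  by apply: (le_trans (near_bound p q Kp Kq pq)); rewrite ler_wpM2r// /A; lra.
apply: (le_trans (XX0 p q Kp Kq)).
have rau : ra ^+ 2 <= u ^+ 2.
  rewrite lerXn2r ?nnegrE ?(ltW ra0)//; apply: powR_mono; [exact: ltW|exact: ltW|].
  by apply: (le_trans (ltW pq)); exact: norm_le_euclid.
apply: (@le_trans _ _ (X0 / ra ^+ 2 * u ^+ 2)); last by rewrite ler_wpM2r// /A; lra.
by rewrite mulrAC ler_pdivlMr ?exprn_gt0// ler_wpM2l.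
Qed.

(** By [le_koranyi], each dyadic step has |delta tau + 2 omega| <= B rho^(2k). The increments of
    [tau] sum to 0 around the loop, so the 2^k terms omega sum to at most B (2 rho^2)^k in absolute
    value, which tends to 0. *)
Lemma horizontal_area tau eta :
  holder_loc (@koranyi R n) alpha Omega (fun p => (f p, tau p)) ->
  closed_curve_in Omega eta -> area (fun t => f (eta t)) = 0.
Proof.
move=> tauH [sm eO e01].
have [L L0 eL] := piecewise_smooth_lipschitz sm.
have [Cf Cf0 CfH] := curve_holder alpha12 fH sm eO.
have gH : dyadic_holder_coords rho Cf (fun t => f (eta t)).
  by move=> i; apply: dyadic_holder01 => //; exact: ltW.
have cK : compact (eta @` `[0, 1]%classic).
  apply: continuous_compact; last exact: segment_compact.
  by apply: unif_cont_within; exact: lipschitz_unif_cont eL.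
have KO : eta @` `[0, 1]%classic `<=` Omega.
  by move=> _ [t /= It <-]; apply: eO; rewrite in_itv in It.
have [C CP] := tauH _ cK KO.
have rho1 := dyadic_rate alpha12.
apply: (cvg_unique (@Rhausdorff R) (symp_sum_cvg rho1 Cf0 gH)).
pose B := (`|C| * L `^ alpha) ^+ 2; have B0 : 0 <= B by exact: sqr_ge0.
pose q := 2 * rho ^+ 2.
apply/cvgrPdist_lt => e e0.
have q1 : `|q| < 1 by rewrite ger0_norm// mulr_ge0// sqr_ge0.
have /cvgrPdist_lt/(_ _ e0) : geometric B q k @[k --> \oo] --> 0 by exact: cvg_geometric.
apply: filterS => k; rewrite !sub0r !normrN => hk; apply: le_lt_trans hk.
rewrite /geometric /= [leRHS]ger0_norm; last first.
  by rewrite mulr_ge0// exprn_ge0// mulr_ge0// sqr_ge0.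
pose t i : R := i%:R / (2 ^ k)%:R.
have tele : \sum_(0 <= i < 2 ^ k) (tau (eta (t i.+1)) - tau (eta (t i))) = 0.
  rewrite (telescope_sumr (fun i => tau (eta (t i))))//.
  have -> : t (2 ^ k)%N = 1 by rewrite /t divff// pnatr_eq0 expn_eq0.
  by rewrite /t mul0r e01 subrr.
have step i : (i < 2 ^ k)%N ->
    `|tau (eta (t i.+1)) - tau (eta (t i)) + 2 * symp (f (eta (t i))) (f (eta (t i.+1)))| <=
    B * (rho ^+ k) ^+ 2.
  move=> ik.
  have I1 : `[0, 1]%classic (t i.+1) by exact: dyadic01.
  have I0 : `[0, 1]%classic (t i) by exact/dyadic01/ltnW.
  have K1 : (eta @` `[0, 1]%classic) (eta (t i.+1)) by exists (t i.+1).
  have K0 : (eta @` `[0, 1]%classic) (eta (t i)) by exists (t i).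
  apply: (le_trans (le_koranyi (f (eta (t i.+1)), tau (eta (t i.+1))) (f (eta (t i)), tau (eta (t i))))).
  rewrite /B -exprMn; rewrite lerXn2r ?nnegrE ?powR_ge0 ?mulr_ge0 ?exprn_ge0 ?powR_ge0//.
  apply: (le_trans (CP _ _ K1 K0)).
  apply: (@le_trans _ _ (`|C| * euclid_dist (eta (t i.+1)) (eta (t i)) `^ alpha)).
    by rewrite ler_wpM2r ?powR_ge0// ler_norm.
  rewrite -mulrA ler_wpM2l//.
  rewrite /= !in_itv/= in I1 I0.
  apply: (@le_trans _ _ ((L * `|t i.+1 - t i|) `^ alpha)).
    by apply: powR_mono; [exact: ltW|exact: euclid_dist_ge0|exact: eL].
  rewrite powRM// ler_wpM2l ?powR_ge0//; apply: powR_dyadic => //; first exact: ltW.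
  by rewrite /t -mulrBl -natr1 addrC addKr mul1r ger0_norm.
have -> : symp_sum (fun t => f (eta t)) k = 2^-1 * \sum_(0 <= i < 2 ^ k)
    (tau (eta (t i.+1)) - tau (eta (t i)) + 2 * symp (f (eta (t i))) (f (eta (t i.+1)))).
  by rewrite big_split /= tele add0r -mulr_sumr mulrA mulVf ?pnatr_eq0// mul1r.
rewrite normrM.
apply: (@le_trans _ _ (1 * \sum_(0 <= i < 2 ^ k) (B * (rho ^+ k) ^+ 2))).
  apply: ler_pM => //; first by rewrite ger0_norm ?invr_ge0//; lra.
  by apply: (le_trans (ler_norm_sum _ _ _)); rewrite !big_nat; apply: ler_sum => i /andP[_ ik]; exact: step.
rewrite mul1r sumr_const_nat subn0 -[_ *+ (2 ^ k)]mulr_natr natrX /q [(2 * _) ^+ k]exprMn.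
by rewrite -!exprM [(k * 2)%N]mulnC le_eqVlt; apply/orP; left; apply/eqP; ring.
Qed.

End HorizontalLift.

(** * Winding integrals and symplectic area *)

Section PlaneAreas.
Context {R : realType}.
Variable n : nat.

(** On a closed curve, integration by parts makes the integrals of x dy and -y dx equal, so half the
    area is the sum of the integrals of x dy, each given by [winding_integral]. *)
Lemma sum_winding_area (rho C : R) (gamma : R -> 'rV[R]_(2 * n)) : 0 <= rho -> 2 * rho ^+ 2 < 1 ->
  0 <= C -> dyadic_holder_coords rho C gamma -> gamma 0 = gamma 1 ->
  \sum_(j < n) (\int[(lebesgue_measure \x lebesgue_measure)%E]_(z in [set: R * R])
    (winding (fun t => (gamma t 0 (xidx j), gamma t 0 (yidx j))) z)%:~R) = 2^-1 * area gamma.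
Proof.
move=> rho0 rho1 C0 gH g01; rewrite /area mulr_sumr; apply: eq_bigr => j _.
have gx := gH (xidx j); have gy := gH (yidx j).
have bp := young_by_parts rho1 C0 gx gy; rewrite g01 subrr in bp.
have -> : 2^-1 * (young_integral (fun t => gamma t 0 (xidx j)) (fun t => gamma t 0 (yidx j)) -
    young_integral (fun t => gamma t 0 (yidx j)) (fun t => gamma t 0 (xidx j))) =
    young_integral (fun t => gamma t 0 (xidx j)) (fun t => gamma t 0 (yidx j)).
  by move: bp; set X := young_integral _ _; set Y := young_integral _ _ => bp; lra.
have wi := @winding_integral R (fun t => (gamma t 0 (xidx j), gamma t 0 (yidx j))) C rho C0 rho0 rho1.
apply: (cvg_unique (@Rhausdorff R) (wi _ _)); last exact: (left_sum_cvg rho1 C0 C0 gx gy).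
  by move=> k s t Is It st; rewrite prod_normE ge_max /=; apply/andP; split; [exact: gx|exact: gy].
by rewrite g01.
Qed.

End PlaneAreas.

Theorem theorem7p12 (R : realType) (m n : nat) (Omega : set 'rV[R]_m)
    (alpha : R) (f : 'rV[R]_m -> 'rV[R]_(2 * n)) :
  open Omega -> connected Omega ->
  2^-1 < alpha <= 1 ->
  holder_loc (@euclid_dist R _) alpha Omega f ->
  [<-> (* (a) *)
       exists tau : 'rV[R]_m -> R,
         holder_loc (@koranyi R n) alpha Omega (fun p => (f p, tau p));
       (* (b) *)
       forall eta : R -> 'rV[R]_m, closed_curve_in Omega eta ->
         let gamma := f \o eta in
         \sum_(j < n)
           (gen_integral alpha (fun t => gamma t 0 (xidx j))
                               (fun t => gamma t 0 (yidx j))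
            - gen_integral alpha (fun t => gamma t 0 (yidx j))
                                 (fun t => gamma t 0 (xidx j))) = 0;
       (* (c) *)
       forall eta : R -> 'rV[R]_m, closed_curve_in Omega eta ->
         let gamma := fun (j : 'I_n) (t : R) =>
           (f (eta t) 0 (xidx j), f (eta t) 0 (yidx j)) in
         \sum_(j < n)
           (\int[(lebesgue_measure \x lebesgue_measure)%E]_(z in [set: R * R])
              (winding (gamma j) z)%:~R) = 0].
Proof.
move=> oO cO /andP[alpha12 alpha1] fH.
have alpha0 : 0 <= alpha by lra.
have holder eta : closed_curve_in Omega eta ->
    exists2 C, 0 <= C & forall i, holder01 C alpha (fun t => f (eta t) 0 i).
  by case=> sm eO _; have := curve_holder alpha12 fH sm eO.
have genE eta : closed_curve_in Omega eta ->
    \sum_(j < n) (gen_integral alpha (fun t => f (eta t) 0 (xidx j)) (fun t => f (eta t) 0 (yidx j))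
      - gen_integral alpha (fun t => f (eta t) 0 (yidx j)) (fun t => f (eta t) 0 (xidx j))) =
    area (fun t => f (eta t)).
  move=> /holder[C C0 CH]; apply: eq_bigr => j _.
  by rewrite !(gen_integral_young alpha12 C0 C0 (CH _) (CH _)).
have windE eta : closed_curve_in Omega eta ->
    \sum_(j < n) (\int[(lebesgue_measure \x lebesgue_measure)%E]_(z in [set: R * R])
      (winding (fun t => (f (eta t) 0 (xidx j), f (eta t) 0 (yidx j))) z)%:~R) =
    2^-1 * area (fun t => f (eta t)).
  move=> ceta; have [C C0 CH] := holder eta ceta; case: ceta => _ _ e01.
  apply: (@sum_winding_area _ _ (2 `^ (- alpha)) C) => //.
  - exact: dyadic_rate.
  - by move=> i; exact: dyadic_holder01.
  - by rewrite e01.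
tfae=> [[tau tauH] eta ceta /=|ab eta ceta /=|wind].
- by rewrite genE//; exact: horizontal_area tauH ceta.
- by rewrite windE// -genE// ab// mulr0.
- have loops eta : closed_curve_in Omega eta -> area (fun t => f (eta t)) = 0.
    move=> ceta; have := wind eta ceta; rewrite /= windE// => /eqP.
    by rewrite mulf_eq0 invr_eq0 pnatr_eq0 /= => /eqP.
  (* The empty set offers no base point, but any [tau] will do there. *)
  have [-> |nE] := eqVneq Omega set0.
    by exists (fun=> 0) => K _ K0; exists 0 => p q /K0.
  have /set0P O0 := nE.
  have [tau tauE] := potential_exists oO cO alpha12 fH loops O0.
  by exists tau; exact: (potential_holder oO alpha12 fH tauE).
Qed.
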